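(* In the setting described in the context (with $M\to+\infty$, $N\to+\infty$, $c_N=ML/N\to c\in(0,+\infty)$), let $(\mathbf{T}_N(z),\widetilde{\mathbf{T}}_N(z))$ be the unique pair in $\mathcal{S}_{ML}(\mathbb{R}^+)\times\mathcal{S}_N(\mathbb{R}^+)$ satisfying, for each $z\in\mathbb{C}\setminus\mathbb{R}^+$, $$\mathbf{T}_N(z)=-\frac1z\left(\mathbf{I}_{ML}+\Psi\left(\widetilde{\mathbf{T}}_N^{T}(z)\right)\right)^{-1},\qquad \widetilde{\mathbf{T}}_N(z)=-\frac1z\left(\mathbf{I}_{N}+c_N\overline{\Psi}^{T}\left(\mathbf{T}_N(z)\right)\right)^{-1},$$ let $\boldsymbol\mu_N$ be the positive $ML\times ML$ matrix-valued measure with $\mathbf{T}_N(z)=\int_{\mathbb{R}^+}\frac{d\boldsymbol\mu_N(\lambda)}{\lambda-z}$, and let $\mu_N=\frac{1}{ML}\mathrm{tr}(\boldsymbol\mu_N)$, a probability measure on $\mathbb{R}^+$. Let $\hat\lambda_{1,N},\ldots,\hat\lambda_{ML,N}$ be the eigenvalues of $\mathbf{W}_N\mathbf{W}_N^H$. Then, almost surely, for each bounded continuous function $\phi$ on $\mathbb{R}^+$, $$\frac{1}{ML}\sum_{k=1}^{ML}\phi(\hat\lambda_{k,N})-\int_{\mathbb{R}^+}\phi(\lambda)\,d\mu_N(\lambda)\longrightarrow0\quad\text{as } N\to+\infty.$$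
   Context: Dimensions: $M=M_N$ and $L=L_N$ are positive integers indexed by $N\ge 1$, with $M\to+\infty$ and $c_N=\frac{ML}{N}\to c$, $0<c<+\infty$, as $N\to+\infty$. Spectral densities: for each $M$, $\mathcal{S}_1,\ldots,\mathcal{S}_M$ are positive functions on $[0,1]$ and $r_m(k)=\int_0^1\mathcal{S}_m(\nu)e^{2\mathrm{i}\pi\nu k}d\nu$, $k\in\mathbb{Z}$. It is assumed that $\sup_M\sum_{n\in\mathbb{Z}}\left(\frac1M\sum_{m=1}^M|r_m(n)|^2\right)^{1/2}<+\infty$ (so each $\mathcal{S}_m$ is continuous), $\sup_M\sup_{m\le M}\max_{\nu}\mathcal{S}_m(\nu)<+\infty$ and $\inf_M\inf_{m\le M}\min_{\nu}\mathcal{S}_m(\nu)>0$. Random matrix: for each $N$, $(w_{m,N}(n))_{m=1,\ldots,M,\,n=1,\ldots,N+L-1}$ are jointly (circularly symmetric) complex Gaussian zero-mean random variables with $\mathbb{E}[w_{m,N}(k)w_{m',N}^*(k')]=\frac{r_m(k-k')}{N}\delta_{m-m'}$ (so different $m$ are independent), all defined on a common probability space. $\mathbf{W}_{m,N}$ is the $L\times N$ Hankel matrix with entries $\{\mathbf{W}_{m,N}\}_{i,j}=w_{m,N}(i+j-1)$, and $\mathbf{W}_N=[\mathbf{W}_{1,N}^T,\ldots,\mathbf{W}_{M,N}^T]^T$ is $ML\times N$. $(\cdot)^H$ is conjugate transpose. Operators: $\mathbf{d}_R(\nu)=(1,e^{2\mathrm{i}\pi\nu},\ldots,e^{2\mathrm{i}\pi(R-1)\nu})^T$,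 $\mathbf{a}_R(\nu)=\mathbf{d}_R(\nu)/\sqrt R$. For an $R\times R$ matrix $\mathbf{M}$, $\Psi_K^{(m)}(\mathbf{M})=\int_0^1\mathcal{S}_m(\nu)\,\mathbf{a}_R^H(\nu)\mathbf{M}\mathbf{a}_R(\nu)\,\mathbf{d}_K(\nu)\mathbf{d}_K^H(\nu)\,d\nu$, a $K\times K$ matrix. For an $N\times N$ matrix $\mathbf{M}$, $\Psi(\mathbf{M})$ is the $ML\times ML$ block-diagonal matrix with $m$-th $L\times L$ diagonal block $\Psi_L^{(m)}(\mathbf{M})$. For an $ML\times ML$ matrix $\mathbf{M}$ with $m$-th $L\times L$ diagonal block $\mathbf{M}^{m,m}$, $\overline{\Psi}(\mathbf{M})=\frac1M\sum_{m=1}^M\Psi_N^{(m)}(\mathbf{M}^{m,m})$ ($N\times N$), and $\overline{\Psi}^T(\mathbf{M})$ denotes its transpose. Class $\mathcal{S}_K(\mathbb{R}^+)$: the set of $K\times K$ matrix-valued functions on $\mathbb{C}\setminus\mathbb{R}^+$ of the form $\int_{\mathbb{R}^+}\frac{d\boldsymbol\mu(\lambda)}{\lambda-z}$, where $\boldsymbol\mu$ is a positive $K\times K$ matrix-valued measure carried by $\mathbb{R}^+$ with $\boldsymbol\mu(\mathbb{R}^+)=\mathbf{I}_K$. (Existence and uniqueness of the pair $(\mathbf{T}_N,\widetilde{\mathbf{T}}_N)$ is known.) *)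

(* Defs.v *)
From HB Require Import structures.
From mathcomp Require Import all_boot all_order all_algebra.
From mathcomp Require Import all_classical all_reals all_analysis.
From mathcomp Require Import spectral complex.

Set Implicit Arguments.
Unset Strict Implicit.
Unset Printing Implicit Defensive.

Import Order.TTheory GRing.Theory Num.Theory.
Import numFieldNormedType.Exports.

Local Open Scope classical_set_scope.
Local Open Scope ring_scope.
Local Open Scope sesquilinear_scope.
Local Open Scope complex_scope.

(* Real-valued parts and modulus, as opposed to the [R[i]]-valued [Num.Re],
   [Num.Im] and norm of a closed field. *)
Notation Re := complex.Re.
Notation Im := complex.Im.
Notation normc := ComplexField.Normc.normc.

Definition cintegral (R : realType) d (T : measurableType d)
    (mu : {measure set T -> \bar R}) (D : set T) (f : T -> R[i]) : R[i] :=
  (\int[mu]_(x in D) Re (f x)) +i* (\int[mu]_(x in D) Im (f x)).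

Definition cexpectation (R : realType) d (T : measurableType d)
    (P : probability T R) (X : T -> R[i]) : R[i] :=
  cintegral P setT X.

(* Constants are Gaussian: [normal_prob m 0] is a junk value in the library, so
   the variance-zero case is spelled out as a Dirac mass. *)
Definition gaussian_rv (R : realType) d (T : measurableType d)
    (P : probability T R) (X : T -> R) : Prop :=
  measurable_fun setT (X : T -> measurableTypeR R) /\
  exists m s : R, forall A : set (measurableTypeR R), measurable A ->
    P (X @^-1` A) = if s == 0 then \d_m A else normal_prob m s A.

(* Joint Gaussianity of the real and imaginary parts, zero mean, and circular
   symmetry in the form of a vanishing relation (pseudo-covariance) matrix. *)
Definition circular_gaussian (R : realType) d (T : measurableType d)
    (P : probability T R) (I : finType) (w : I -> T -> R[i]) : Prop :=
  [/\ forall a b : I -> R,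
        gaussian_rv P
          (fun t => \sum_(i : I) (a i * Re (w i t) + b i * Im (w i t))),
      forall i, cexpectation P (w i) = 0 &
      forall i j, cexpectation P (fun t => w i t * w j t) = 0].

Definition cexp (R : realType) (x : R) : R[i] := cos x +i* sin x.

Definition autocov (R : realType) (S : R -> R) (k : int) : R[i] :=
  cintegral (@lebesgue_measure R) `[0, 1]
    (fun nu => (S nu)%:C * cexp (2 * pi * nu * k%:~R)).

Definition dvec (R : realType) (K : nat) (nu : R) : 'cV[R[i]]_K :=
  \col_(k < K) cexp (2 * pi * k%:R * nu).

Definition avec (R : realType) (K : nat) (nu : R) : 'cV[R[i]]_K :=
  ((Num.sqrt K%:R)^-1)%:C *: dvec K nu.

Definition qform (C : numClosedFieldType) (K : nat) (A : 'M[C]_K)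
    (x : 'cV[C]_K) : C :=
  (x ^t* *m A *m x) ord0 ord0.

Definition Psi1 (R : realType) (S : R -> R) (Q K : nat)
    (A : 'M[R[i]]_Q) : 'M[R[i]]_K :=
  \matrix_(i, j) cintegral (@lebesgue_measure R) `[0, 1]
    (fun nu => (S nu)%:C * qform A (avec Q nu)
               * (dvec K nu *m (dvec K nu) ^t*) i j).

(* Matrices made of M x M blocks of size L x L have the dimension expected by
   [mxdiag], [mxcol] and [submxblock]; see [blockdimE]. *)
Notation blockdim M L := (\sum_(m < M) L)%N.

Lemma blockdimE (M L : nat) : blockdim M L = (M * L)%N.
Proof. by rewrite sum_nat_const card_ord. Qed.

Definition Psi (R : realType) (M L N : nat) (S : 'I_M -> R -> R)
    (A : 'M[R[i]]_N) : 'M[R[i]]_(blockdim M L) :=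
  \mxdiag_(m < M) (Psi1 (S m) L A).

Definition Psibar (R : realType) (M L N : nat) (S : 'I_M -> R -> R)
    (A : 'M[R[i]]_(blockdim M L)) : 'M[R[i]]_N :=
  (M%:R)^-1 *: \sum_(m < M) Psi1 (S m) N (submxblock A m m).

(* With indices i, j starting at 0, the entry w(i + j - 1) of the usual 1-based
   indexing is w (i + j).+1. *)
Definition hankel (T : Type) (L N : nat) (w : nat -> T) : 'M[T]_(L, N) :=
  \matrix_(i < L, j < N) w (i + j).+1.

Definition block_hankel (T : Type) (M L N : nat) (w : 'I_M -> nat -> T) :
    'M[T]_(blockdim M L, N) :=
  \mxcol_(m < M) hankel L N (w m).

(* A positive matrix-valued measure on the Borel sets of the real line: all the
   quadratic forms x^H mu(.) x are positive measures. As for the library's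
   measures, positivity is also imposed on (irrelevant) non-Borel sets. *)
Record mxmeasure (R : realType) (K : nat) := MxMeasure {
  mxmeas :> set (measurableTypeR R) -> 'M[R[i]]_K;
  mxmeas0 : mxmeas set0 = 0;
  mxmeas_ge0 : forall A x, 0 <= qform (mxmeas A) x;
  mxmeas_sigma_additive : forall x : 'cV[R[i]]_K,
    semi_sigma_additive (fun A => (Re (qform (mxmeas A) x))%:E) }.

Definition qmeasure (R : realType) (K : nat) (mu : mxmeasure R K)
    (x : 'cV[R[i]]_K) (A : set (measurableTypeR R)) : \bar R :=
  (Re (qform (mu A) x))%:E.

Definition ntrace_measure (R : realType) (K : nat) (mu : mxmeasure R K)
    (A : set (measurableTypeR R)) : \bar R :=
  ((K%:R)^-1 * Re (\tr (mu A)))%:E.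

Section mxmeasure_instances.
Variables (R : realType) (K : nat) (mu : mxmeasure R K).
Implicit Types (A : set (measurableTypeR R)) (x : 'cV[R[i]]_K).

Let Re_ge0 (z : R[i]) : 0 <= z -> 0 <= Re z.
Proof. by rewrite lecE => /andP[]. Qed.

Lemma qmeasure0 x : qmeasure mu x set0 = 0%E.
Proof. by rewrite /qmeasure mxmeas0 /qform mulmx0 mul0mx mxE. Qed.

Lemma qmeasure_ge0 x A : (0 <= qmeasure mu x A)%E.
Proof. by rewrite lee_fin Re_ge0// mxmeas_ge0. Qed.

HB.instance Definition _ x := isMeasure.Build _ (measurableTypeR R) R
  (qmeasure mu x) (qmeasure0 x) (qmeasure_ge0 x)
  (@mxmeas_sigma_additive R K mu x).

Let qform_delta (A : 'M[R[i]]_K) (i : 'I_K) : qform A (delta_mx i ord0) = A i i.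
Proof.
rewrite /qform.
have -> : (delta_mx i ord0 : 'cV[R[i]]_K) ^t* = delta_mx ord0 i.
  by apply/matrixP => a b; rewrite !mxE andbC rmorph_nat.
by rewrite -rowE -colE !mxE.
Qed.

Let ntraceE : ntrace_measure mu =
  fun A => (\sum_(i < K) ((K%:R)^-1)%:E * qmeasure mu (delta_mx i ord0) A)%E.
Proof.
apply/funext => A; rewrite /ntrace_measure /qmeasure /mxtrace.
under [RHS]eq_bigr do rewrite qform_delta -EFinM.
by rewrite sumEFin -mulr_sumr raddf_sum.
Qed.

Lemma ntrace_measure0 : ntrace_measure mu set0 = 0%E.
Proof. by rewrite /ntrace_measure mxmeas0 mxtrace0 mulr0. Qed.

Lemma ntrace_measure_ge0 A : (0 <= ntrace_measure mu A)%E.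
Proof.
rewrite ntraceE; apply: sume_ge0 => i _.
by rewrite mule_ge0 ?qmeasure_ge0// lee_fin invr_ge0.
Qed.

Lemma ntrace_measure_sigma_additive : semi_sigma_additive (ntrace_measure mu).
Proof.
move=> F mF tF mUF; rewrite ntraceE.
have -> : (fun n => \sum_(0 <= k < n) \sum_(i < K)
      ((K%:R)^-1)%:E * qmeasure mu (delta_mx i ord0) (F k))%E =
    (fun n => \sum_(i < K)
      ((K%:R)^-1)%:E * \sum_(0 <= k < n) qmeasure mu (delta_mx i ord0) (F k))%E.
  apply/funext => n; rewrite exchange_big/=; apply: eq_bigr => i _.
  by rewrite ge0_sume_distrr// => k _; exact: qmeasure_ge0.
apply: cvg_nnesum => i _.
  near=> n; rewrite mule_ge0 ?lee_fin ?invr_ge0//.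
  by apply: sume_ge0 => k _; exact: qmeasure_ge0.
by apply: cvgeZl => //; exact: mxmeas_sigma_additive.
Unshelve. all: by end_near.
Qed.

HB.instance Definition _ := isMeasure.Build _ (measurableTypeR R) R
  (ntrace_measure mu) ntrace_measure0 ntrace_measure_ge0
  ntrace_measure_sigma_additive.

End mxmeasure_instances.

Definition nnegR (R : realType) : set (measurableTypeR R) := `[0, +oo[.

(* [F] is, on the complement of the nonnegative half-line, the Stieltjes
   transform of the matrix-valued measure [mu] carried by that half-line and of
   total mass the identity. The integral with respect to [mu] is meant weakly:
   x^H (int f dmu) x = int f d(x^H mu x) for every vector x, which determines
   int f dmu by polarization. In [R[i]], [0 <= z] says that z is real and
   nonnegative. *)
Definition stieltjes_repr (R : realType) (K : nat) (mu : mxmeasure R K)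
    (F : R[i] -> 'M[R[i]]_K) : Prop :=
  [/\ mu (~` @nnegR R) = 0,
      mu (@nnegR R) = 1%:M &
      forall z : R[i], ~~ (0 <= z) -> forall x : 'cV[R[i]]_K,
        qform (F z) x =
        cintegral (qmeasure mu x) (@nnegR R) (fun l : R => (l%:C - z)^-1)].

Definition stieltjes_class (R : realType) (K : nat)
    (F : R[i] -> 'M[R[i]]_K) : Prop :=
  exists mu : mxmeasure R K, stieltjes_repr mu F.

(* Main.v *)
(** Write [X_k = (W W^H)^k] and [Y_k = (W^H W)^k]. Gaussian integration by parts
    gives the exact identity [E X_(k+1) = sum_(q <= k) E (S(Y_q) X_(k-q))], with
    [S(D) = Psi(D^T)], and a dual one for the [Y_k]. The moments [T_k] of the
    limit measure, read off from the expansion of [T_N] at infinity, satisfy the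
    same recursions without the expectations. The Gaussian Poincare inequality
    has constant [B L / N], which tends to [0]; it decouples the expectation of
    the product, so that [n^-1 tr (E X_k - T_k)] tends to [0] for each [k].
    [S(D)] only depends on the quadratic forms of [D] at the vectors [a_N(nu)],
    so in this induction [X_k] and [T_k] have to be compared only through
    normalized traces against bounded matrices, and in mean square through the
    quadratic forms at the vectors [e_m (x) a_L(nu)]. Applied twice, the Poincare
    inequality bounds the fourth central moment of [n^-1 tr X_k] by [O(N^-2)],
    which is summable: the empirical moments are almost surely asymptotic to the
    [n^-1 tr T_k]. The latter are at most [K^k], uniformly in [N], and
    convergence of moments turns into weak convergence by the Weierstrass
    theorem. *)

Require Import Defs.
From HB Require Import structures.
From mathcomp Require Import all_boot all_order all_algebra complex.

(* A module, as the notations of [mpoly] clash with those of the analysis library. *)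
Module PolyAlgebra.
From mathcomp Require Import mpoly.
Set Implicit Arguments.
Unset Strict Implicit.
Unset Printing Implicit Defensive.
Import GRing.Theory Num.Theory.
Local Open Scope ring_scope.

(** For each N only polynomials in finitely many Gaussian variables occur. The Gaussian calculus
    therefore runs on an abstract polynomial algebra with derivations, where the expectation is a
    positive linear functional; integrability is settled once, when this functional is built from
    the random variables. The obstacle is that [S(D)] sees [D] through quadratic forms, whose
    variance is only of order [B L / N = B c_N / M]: it tends to 0 without any rate, as nothing more
    than [M -> oo] is known. Hence the two ways of comparing matrices, and an induction on k whose
    constants depend on k, eps and bounds on the model but never on N; smallness enters as
    [gkap G * D <= 1]. Full normalized traces enjoy an additional factor [1/n], and this is what
    produces a summable rate. Each estimate on [W W^H] has a twin on [W^H W]; a single proof gives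
    both, through the dual structures [dualA] and [dualG]. On the limit side everything is bounded
    in operator norm, thanks to the Catalan-like recursion of the moments. *)

Record polyAlg (C : numClosedFieldType) (V : finType) := PolyAlg {
  pcar :> comAlgType C;
  pvar : V -> pcar;
  pder : V -> {linear pcar -> pcar};
  pstar : {rmorphism pcar -> pcar};
  pev : (V -> C) -> {rmorphism pcar -> C};
  pind : forall Q : pcar -> Prop, Q 1 -> (forall v f, Q f -> Q (pvar v * f)) ->
    (forall c f g, Q f -> Q g -> Q (c *: f + g)) -> forall f, Q f;
  pderM : forall v f g, pder v (f * g) = pder v f * g + f * pder v g;
  pder_var : forall v w, pder v (pvar w) = (v == w)%:R;
  pstarZ : forall c f, pstar (c *: f) = c^* *: pstar f;
  pstar_var : forall v, pstar (pvar v) = pvar v;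
  pevZ : forall x c f, pev x (c *: f) = c * pev x f;
  pev_var : forall x v, pev x (pvar v) = x v }.

Lemma polyAlg_exists (C : numClosedFieldType) (V : finType) : polyAlg C V.
Proof.
pose n := #|V|.
refine (@PolyAlg C V {mpoly C[n]} (fun v => 'X_(enum_rank v))
  (fun v => mderiv (enum_rank v)) (map_mpoly (Num.conj : {rmorphism C -> C}))
  (fun x => meval (fun i => x (enum_val i))) _ _ _ _ _ _ _).
- move=> Q Q1 QX QL.
  have Q0 : Q 0 by have := QL (-1) _ _ Q1 Q1; rewrite scaleN1r addNr.
  have QM (m : 'X_{1.. n}) : Q 'X_[m].
    elim: {m}(mdeg m) {-2}m (leqnn (mdeg m)) => [|d IH] m.
      by rewrite leqn0 mdeg_eq0 => /eqP ->; rewrite mpolyX0.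
    move=> hm; have [->|m0] := eqVneq m 0%MM; first by rewrite mpolyX0.
    have [i mi] : exists i, (0 < m i)%N.
      apply/existsP; apply: contraR m0; rewrite negb_exists => /forallP h.
      apply/eqP/mnmP => i; rewrite mnm0E; apply/eqP.
      by have := h i; rewrite lt0n negbK.
    have E : (m = U_(i) + (m - U_(i)))%MM.
      by rewrite addmC submK// lep1mP -lt0n.
    rewrite E mpolyXD -(enum_valK i); apply: QX; rewrite enum_valK; apply: IH.
    by move: hm; rewrite [in X in X -> _]E mdegD mdeg1.
  elim/mpolyind => [//|c m f _ _ Qf]; exact: QL.
- by move=> v f g; exact: mderivM.
- move=> v w; rewrite [LHS]mderivX mnm1E.
  rewrite (inj_eq enum_rank_inj) eq_sym; case: eqP => [->|_]; last by rewrite scale0r.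
  rewrite scale1r (_ : (_ - _)%MM = 0%MM) ?mpolyX0 //.
  by apply/mnmP => i; rewrite mnmBE subnn mnm0E.
- by move=> c f /=; rewrite map_mpolyZ.
- by move=> v /=; rewrite map_mpolyX.
- by move=> x c f; exact: mevalZ.
- by move=> x v; rewrite [LHS]mevalXU enum_rankK.
Qed.
End PolyAlgebra.

From mathcomp Require Import spectral ring lra zify boolp.

Set Implicit Arguments.
Unset Strict Implicit.
Unset Printing Implicit Defensive.

Import Order.TTheory GRing.Theory Num.Theory.
Import PolyAlgebra.

Local Open Scope ring_scope.
Local Open Scope sesquilinear_scope.

(** * Gaussian functionals on polynomial algebras *)

(** Positivity is tested on a family of real samples [gx o], so that inequalities between
    expectations reduce to pointwise ones. The covariance is [gE (X_v X_w)] itself, and [gE_ibp] at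
    [f = 1] forces the variables to be centered. *)
Record gaussFun (C : numClosedFieldType) (V : finType) (A : polyAlg C V) := GaussFun {
  gOm : Type;
  gx : gOm -> V -> C;
  gx_real : forall o v, gx o v \is Num.real;
  gE :> {linear A -> C^o};
  gE1 : gE 1 = 1;
  gE_ge0 : forall f, (forall o, 0 <= pev A (gx o) f) -> 0 <= gE f;
  gE_ibp : forall v f,
    gE (pvar A v * f) = \sum_w gE (pvar A v * pvar A w) * gE (pder A w f) }.

Arguments gOm {C V A} _.
Arguments gx {C V A} _ _ _.
Arguments gE {C V A} _.

Section Poly.
Variables (C : numClosedFieldType) (V : finType) (A : polyAlg C V).
Implicit Types (f g h : A) (v w : V).
Local Notation X := (pvar A).
Local Notation D := (pder A).
Local Notation star := (pstar A).

Lemma pind_prod (Q : A -> Prop) :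
  (forall s : seq V, Q (\prod_(v <- s) X v)) ->
  (forall c f g, Q f -> Q g -> Q (c *: f + g)) -> forall f, Q f.
Proof.
move=> Qp Ql f; pose Q' f := exists2 r : seq (C * seq V), True &
  f = \sum_(i <- r) i.1 *: \prod_(v <- i.2) X v.
have Q0 : Q 0 by have := Ql (-1) _ _ (Qp [::]) (Qp [::]); rewrite scaleN1r addNr.
have [r _ ->] : Q' f.
  apply: (@pind _ _ A) => [|v {}f [r _ ->]|c {}f g [r _ ->] [r' _ ->]].
  - by exists [:: (1, [::])] => //; rewrite big_seq1 big_nil scale1r.
  - exists [seq (i.1, v :: i.2) | i <- r] => //.
    rewrite big_map mulr_sumr; apply: eq_bigr => i _ /=.
    by rewrite big_cons scalerAr.
  - exists ([seq (c * i.1, i.2) | i <- r] ++ r') => //.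
    rewrite big_cat big_map scaler_sumr /=; congr (_ + _).
    by apply: eq_bigr => i _; rewrite scalerA.
by elim: r => [|i r IH]; rewrite ?big_nil ?big_cons //; apply: Ql.
Qed.

Lemma pder1 v : D v 1 = 0.
Proof.
have := pderM v (1 : A) 1; rewrite !mul1r mulr1 => /eqP.
by rewrite -{1}[D v 1]addr0 (inj_eq (addrI _)) eq_sym => /eqP.
Qed.

Lemma pder_comm v w f : D v (D w f) = D w (D v f).
Proof.
move: f; apply: pind => [|u f IH|c f g IHf IHg].
- by rewrite !pder1 !linear0.
- rewrite !pderM !linearD /= !pderM !pder_var.
  have d0 (x y z : V) : D x (y == z)%:R = 0 :> A.
    by case: (y == z); rewrite ?pder1 ?linear0.
  by rewrite !d0 !mul0r !add0r IH; ring.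
- by rewrite !linearP /= IHf IHg.
Qed.

Lemma pstarK f : star (star f) = f.
Proof.
move: f; apply: pind => [|u f IH|c f g IHf IHg].
- by rewrite !rmorph1.
- by rewrite !rmorphM /= !pstar_var IH.
- by rewrite rmorphD /= pstarZ rmorphD /= pstarZ conjCK IHf IHg.
Qed.

Lemma pder_star v f : D v (star f) = star (D v f).
Proof.
move: f; apply: pind => [|u f IH|c f g IHf IHg].
- by rewrite rmorph1 pder1 rmorph0.
- rewrite rmorphM /= !pderM rmorphD !rmorphM /= !pstar_var IH pder_var.
  by rewrite rmorph_nat.
- by rewrite rmorphD /= pstarZ !linearP /= rmorphD /= pstarZ IHf IHg.
Qed.

Lemma pev_star (x : V -> C) f :
  (forall v, x v \is Num.real) -> pev A x (star f) = (pev A x f)^*.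
Proof.
move=> xr; move: f; apply: pind => [|u f IH|c f g IHf IHg].
- by rewrite !rmorph1.
- by rewrite !rmorphM /= pstar_var pev_var IH (CrealP (xr u)).
- by rewrite rmorphD /= pstarZ rmorphD /= pevZ rmorphD /= pevZ rmorphD rmorphM IHf IHg.
Qed.

End Poly.

Section Poincare.
Variables (C : numClosedFieldType) (V : finType) (A : polyAlg C V).
Variable E : gaussFun A.
Implicit Types (f g h : A) (v w : V).
Local Notation X := (pvar A).
Local Notation D := (pder A).
Local Notation star := (pstar A).

Lemma gEZ c f : E (c *: f) = c * E f. Proof. exact: linearZ. Qed.

Lemma pev_conj o f : pev A (gx E o) (star f) = (pev A (gx E o) f)^*.
Proof. exact/pev_star/gx_real. Qed.

Lemma gE_le f g : (forall o, pev A (gx E o) f <= pev A (gx E o) g) -> E f <= E g.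
Proof.
move=> le; rewrite -subr_ge0 -raddfB; apply: gE_ge0 => o.
by rewrite rmorphB subr_ge0.
Qed.

Lemma gE_norm_ge0 f : 0 <= E (f * star f).
Proof. by apply: gE_ge0 => o; rewrite rmorphM /= pev_conj mul_conjC_ge0. Qed.

Lemma gE_star f : E (star f) = (E f)^*.
Proof.
have R2 : (2 : C) != 0 by rewrite pnatr_eq0.
have reE h : star h = h -> E h \is Num.real.
  move=> hh; have re o : pev A (gx E o) h \is Num.real.
    by apply/CrealP; rewrite -pev_conj hh.
  (* Positivity alone gives reality: [2 h = ((h + 1)^2 + 1) - (h^2 + 1) - 1], a combination of
     polynomials that are nonnegative at every sample. *)
  have le : 0 <= E (h ^+ 2 + 1).
    apply: gE_ge0 => o; rewrite rmorphD rmorphXn rmorph1 /=.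
    by rewrite addr_ge0 // real_exprn_even_ge0.
  have le2 : 0 <= E ((h + 1) ^+ 2 + 1).
    apply: gE_ge0 => o; rewrite rmorphD rmorphXn rmorphD rmorph1 /=.
    by rewrite addr_ge0 // real_exprn_even_ge0 // realD.
  have -> : E h = (E ((h + 1) ^+ 2 + 1) - E (h ^+ 2 + 1) - E 1) / 2.
    rewrite -!raddfB /= (_ : _ - _ - _ = h *+ 2); last by rewrite mulr2n; ring.
    by rewrite raddfMn /= mulr2n; field.
  by rewrite gE1 rpred_div ?rpredB ?realn ?real1 ?ger0_real.
pose a : A := 2^-1 *: (f + star f); pose b : A := (2^-1 * 'i) *: (star f - f).
have Ef : f = a + 'i *: b.
  rewrite /a /b scalerA mulrCA -expr2 sqrCi mulrN1 scaleNr -scalerBr.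
  have -> : f + star f - (star f - f) = 2%:R *: f by rewrite scaler_nat mulr2n; ring.
  by rewrite scalerA mulVf ?scale1r.
have sa : star a = a.
  by rewrite /a pstarZ rmorphD /= pstarK [star f + f]addrC fmorphV rmorph_nat.
have sb : star b = b.
  rewrite /b pstarZ rmorphB /= pstarK rmorphM /= fmorphV rmorph_nat /= conjCi.
  by rewrite mulrN scaleNr -scalerN opprB.
clearbody a b; rewrite Ef rmorphD /= pstarZ sa sb !raddfD /= !gEZ rmorphM /=.
by rewrite (CrealP (reE _ sa)) (CrealP (reE _ sb)).
Qed.

Let K v w : C := E (X v * X w).

Let Ksym v w : K v w = K w v. Proof. by rewrite /K mulrC. Qed.

Let Kreal v w : (K v w)^* = K v w.
Proof. by rewrite /K -gE_star rmorphM /= !pstar_var. Qed.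

Lemma cov_form (c d : V -> C) :
  \sum_v \sum_w K v w * (c v * (d w)^*) =
  E ((\sum_v c v *: X v) * star (\sum_w d w *: X w)).
Proof.
rewrite rmorph_sum mulr_suml raddf_sum; apply: eq_bigr => v _.
rewrite mulr_sumr raddf_sum; apply: eq_bigr => w _ /=.
have -> : c v *: X v * star (d w *: X w) = (c v * (d w)^*) *: (X v * X w).
  by rewrite pstarZ pstar_var -scalerAl -scalerAr scalerA.
by rewrite gEZ mulrC.
Qed.

Let Kpsd (c : V -> C) : 0 <= \sum_v \sum_w K v w * (c v * (c w)^*).
Proof. rewrite cov_form; exact: gE_norm_ge0. Qed.

(** The sign makes the operator nonnegative; [energy] below is its Dirichlet form. *)
Let L f : A := \sum_v X v * D v f - \sum_v \sum_w K v w *: D v (D w f).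

Let L_lin c f g : L (c *: f + g) = c *: L f + L g.
Proof.
rewrite /L; have -> : \sum_v X v * D v (c *: f + g) =
    c *: (\sum_v X v * D v f) + \sum_v X v * D v g.
  rewrite scaler_sumr -big_split; apply: eq_bigr => v _ /=.
  by rewrite linearP mulrDr scalerAr.
have -> : \sum_v \sum_w K v w *: D v (D w (c *: f + g)) =
    c *: (\sum_v \sum_w K v w *: D v (D w f)) + \sum_v \sum_w K v w *: D v (D w g).
  rewrite scaler_sumr -big_split; apply: eq_bigr => v _ /=.
  rewrite scaler_sumr -big_split; apply: eq_bigr => w _ /=.
  by rewrite !linearP.
by rewrite scalerBr; ring.
Qed.

(** The commutator of [D u] with [L] is [D u] itself: this is curvature 1, and the source of the
    constant 1 in the Poincare inequality. *)
Let DL u f : D u (L f) = D u f + L (D u f).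
Proof.
rewrite /L linearB !linear_sum /=.
have -> : \sum_v D u (X v * D v f) = D u f + \sum_v X v * D v (D u f).
  under eq_bigr do rewrite pderM pder_var.
  rewrite big_split /= (bigD1 u) //= eqxx mul1r big1 ?addr0; last first.
    by move=> v; rewrite eq_sym => /negbTE ->; rewrite mul0r.
  by congr (_ + _); apply: eq_bigr => v _; rewrite pder_comm.
rewrite -addrA; congr (_ + _); congr (_ + _); apply: eq_bigr => v _; congr (- _).
rewrite linear_sum; apply: eq_bigr => w _ /=.
by rewrite linearZ /= (pder_comm u v) (pder_comm u w).
Qed.

Let energy f g := \sum_v \sum_w K v w * E (D v f * star (D w g)).

Let ibpL f g : E (L f * star g) = energy f g.
Proof.
rewrite /L mulrBl mulr_suml raddfB !raddf_sum /= /energy.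
have -> : \sum_v E (X v * D v f * star g) =
   \sum_v \sum_w K v w * (E (D w (D v f) * star g) + E (D v f * star (D w g))).
  apply: eq_bigr => v _; rewrite -mulrA gE_ibp; apply: eq_bigr => w _.
  by rewrite pderM raddfD pder_star.
rewrite mulr_suml raddf_sum /= -sumrB; apply: eq_bigr => v _.
rewrite mulr_suml raddf_sum /= -sumrB; apply: eq_bigr => w _ /=.
by rewrite -scalerAl gEZ mulrDr pder_comm addrC addKr.
Qed.

Let energyC f g : energy g f = (energy f g)^*.
Proof.
rewrite /energy rmorph_sum exchange_big; apply: eq_bigr => v _ /=.
rewrite rmorph_sum; apply: eq_bigr => w _ /=.
by rewrite rmorphM /= Kreal Ksym -gE_star rmorphM /= pstarK mulrC [E _ * _]mulrC
   [D w g * _]mulrC.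
Qed.

Let energy_ge0 f : 0 <= energy f f.
Proof.
rewrite /energy.
have -> : \sum_v \sum_w K v w * E (D v f * star (D w f)) =
   E (\sum_v \sum_w K v w *: (D v f * star (D w f))).
  rewrite raddf_sum; apply: eq_bigr => v _; rewrite raddf_sum.
  by apply: eq_bigr => w _; rewrite /= gEZ.
apply: gE_ge0 => o; rewrite rmorph_sum.
have := Kpsd (fun v => pev A (gx E o) (D v f)); congr (_ <= _).
apply: eq_bigr => v _; rewrite rmorph_sum; apply: eq_bigr => w _ /=.
by rewrite pevZ rmorphM /= pev_conj.
Qed.

(** Positivity of [K (x) K] on the Hessian, without factoring [K]: at a fixed sample the second [K]
    is read as the covariance of linear forms, that is as an expectation over an independent copy,
    and under this expectation the first [K] gives a nonnegative form. *)
Let hessian_ge0 f :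
  0 <= \sum_v \sum_w K v w * energy (D v f) (D w f).
Proof.
have -> : \sum_v \sum_w K v w * energy (D v f) (D w f) =
   E (\sum_v \sum_w \sum_v' \sum_w' (K v w * K v' w') *:
      (D v' (D v f) * star (D w' (D w f)))).
  rewrite raddf_sum; apply: eq_bigr => v _; rewrite raddf_sum.
  apply: eq_bigr => w _; rewrite raddf_sum /energy mulr_sumr.
  apply: eq_bigr => v' _; rewrite raddf_sum mulr_sumr; apply: eq_bigr => w' _.
  by rewrite /= gEZ mulrA.
apply: gE_ge0 => o; set e := pev A (gx E o).
pose F v w := e (D w (D v f)).
have -> : e (\sum_v \sum_w \sum_v' \sum_w' (K v w * K v' w') *:
      (D v' (D v f) * star (D w' (D w f)))) =
   E (\sum_v \sum_w K v w *: ((\sum_v' F v v' *: X v') *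
                              star (\sum_w' F w w' *: X w'))).
  rewrite rmorph_sum raddf_sum; apply: eq_bigr => v _ /=.
  rewrite rmorph_sum raddf_sum; apply: eq_bigr => w _ /=.
  rewrite gEZ -cov_form mulr_sumr rmorph_sum; apply: eq_bigr => v' _ /=.
  rewrite rmorph_sum mulr_sumr; apply: eq_bigr => w' _ /=.
  by rewrite /F /e pevZ rmorphM /= pev_conj -!mulrA.
apply: gE_ge0 => o'; rewrite rmorph_sum.
have := Kpsd (fun v => pev A (gx E o') (\sum_v' F v v' *: X v')).
congr (_ <= _); apply: eq_bigr => v _; rewrite [RHS]rmorph_sum; apply: eq_bigr => w _.
by rewrite /= pevZ rmorphM /= pev_conj.
Qed.

(** Integrated curvature bound: after [ibpL], the commutation [DL] splits [D w (L f)] and leaves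
    exactly [energy f f] plus the Hessian term. *)
Let energy_le f : energy f f <= E (L f * star (L f)).
Proof.
rewrite ibpL -subr_ge0; apply: le_trans (hessian_ge0 f) _.
rewrite le_eqVlt; apply/orP; left; apply/eqP.
rewrite /energy -sumrB; apply: eq_bigr => v _; rewrite -sumrB.
apply: eq_bigr => w _; rewrite DL rmorphD mulrDr raddfD mulrDr addrC addKr /=.
congr (_ * _); rewrite -[in RHS](pstarK (D v f)) -rmorphM gE_star.
by rewrite (mulrC (star _)) ibpL -energyC.
Qed.

Let prodD v (s : seq V) :
  exists r : seq (C * seq V), all (fun i => size i.2 < size s)%N r /\
    D v (\prod_(u <- s) X u) = \sum_(i <- r) i.1 *: \prod_(u <- i.2) X u.
Proof.
elim: s => [|u s [r [sr Er]]].
  by exists [::]; rewrite !big_nil pder1.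
exists (((v == u)%:R, s) :: [seq (i.1, u :: i.2) | i <- r]).
rewrite /= ltnS leqnn all_map; split; first exact: sr.
rewrite !big_cons pderM pder_var big_map /= Er mulr_sumr.
congr (_ + _); first by rewrite -mulr_algl scaler_nat.
by apply: eq_bigr => i _; rewrite big_cons -scalerAr.
Qed.

Let euler (s : seq V) :
  \sum_v X v * D v (\prod_(u <- s) X u) = (size s)%:R *: \prod_(u <- s) X u.
Proof.
elim: s => [|u s IH].
  by rewrite scale0r big1 // => v _; rewrite big_nil pder1 mulr0.
have -> : \sum_v X v * D v (\prod_(j <- u :: s) X j) = \sum_v ((v == u)%:R *
    (X v * \prod_(j <- s) X j) + X u * (X v * D v (\prod_(j <- s) X j))).
  by apply: eq_bigr => v _; rewrite big_cons pderM pder_var; ring.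
rewrite big_split /= -mulr_sumr IH big_cons; set m := \prod_(j <- s) X j.
have -> : \sum_v (v == u)%:R * (X v * m) = X u * m.
  rewrite (bigD1 u) //= eqxx mul1r big1 ?addr0 // => v /negbTE ->.
  by rewrite mul0r.
by rewrite -scalerAr !scaler_nat mulrS.
Qed.

(** On a monomial the first order part of [L] is multiplication by the degree ([euler]), and the
    second order part lowers the degree. So [L] can be inverted modulo constants by induction on the
    degree, with no semigroup. *)
Let poisson f : exists g c, f = L g + c *: 1.
Proof.
have L0 : L 0 = 0 by have := L_lin (-1) 0 0; rewrite !scaleN1r oppr0 addr0 addNr.
pose Q f := exists g c, f = L g + c *: 1.
have Ql c f1 f2 : Q f1 -> Q f2 -> Q (c *: f1 + f2).
  move=> [g1 [c1 ->]] [g2 [c2 ->]]; exists (c *: g1 + g2), (c * c1 + c2).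
  by rewrite L_lin scalerDr scalerA scalerDl; ring.
have Q0 : Q 0 by exists 0, 0; rewrite L0 scale0r addr0.
have Qsum (r : seq (C * seq V)) :
    (forall i, i \in r -> Q (\prod_(u <- i.2) X u)) ->
    Q (\sum_(i <- r) i.1 *: \prod_(u <- i.2) X u).
  elim: r => [|i r IH] h; rewrite ?big_nil ?big_cons //.
  apply: Ql; first by apply: h; rewrite mem_head.
  by apply: IH => j jr; apply: h; rewrite inE jr orbT.
apply: (pind_prod (Q := Q)) => // s.
elim: {s}(size s) {-2}s (leqnn (size s)) => [|d IH] s.
  rewrite leqn0 size_eq0 => /eqP ->; rewrite big_nil.
  by exists 0, 1; rewrite L0 scale1r add0r.
move=> ss; case: (posnP (size s)) => [/eqP|s0].
  by rewrite size_eq0 => /eqP ->; apply: IH.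
set m := \prod_(u <- s) X u.
have Em : m = (size s)%:R^-1 *: (L m + \sum_v \sum_w K v w *: D v (D w m)).
  rewrite /L subrK euler scalerA mulVf ?scale1r // pnatr_eq0 -lt0n //.
have Q2 v w : Q (D v (D w m)).
  have [r [sr ->]] := prodD w s.
  rewrite raddf_sum; elim: r sr => [_|i r IHr /= /andP[si sr]].
    by rewrite big_nil.
  rewrite big_cons linearZ /=; apply: Ql (IHr sr).
  have [r' [sr' ->]] := prodD v i.2; apply: Qsum => j jr'.
  apply: IH; have := allP sr' _ jr'; move: si ss; clear.
  by move=> h1 h2 h3; rewrite -ltnS; apply: (leq_trans h3); rewrite -ltnS;
     apply: (leq_trans h1); apply: leqW.
have QK : Q (\sum_v \sum_w K v w *: D v (D w m)).
  apply: big_ind => // [a b Qa Qb|v _].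
    by have := Ql 1 _ _ Qa Qb; rewrite scale1r.
  apply: big_ind => // [a b Qa Qb|w _].
    by have := Ql 1 _ _ Qa Qb; rewrite scale1r.
  by have := Ql (K v w) _ _ (Q2 v w) Q0; rewrite addr0.
have QL : Q (L m) by exists m, 0; rewrite scale0r addr0.
have QS : Q (L m + \sum_v \sum_w K v w *: D v (D w m)).
  by have := Ql 1 _ _ QL QK; rewrite scale1r.
rewrite Em; by have := Ql ((size s)%:R^-1) _ _ QS Q0; rewrite addr0.
Qed.

(* Bakry-Emery: for the Ornstein-Uhlenbeck operator [L], [E(f,f) <= |L f|^2];
   solving [f - E f = L g] turns this into the spectral gap inequality. *)
Theorem poincare f :
  E (f * star f) - E f * (E f)^* <=
  \sum_v \sum_w E (X v * X w) * E (D v f * star (D w f)).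
Proof.
rewrite -/(energy f f).
have [g [c Ef]] := poisson f.
have EL h : E (L h) = 0.
  rewrite -[L h]mulr1 -[1](rmorph1 star) ibpL /energy.
  rewrite big1 // => v _; rewrite big1 // => w _.
  by rewrite pder1 rmorph0 mulr0 raddf0 mulr0.
have Ec : E f = c by rewrite Ef raddfD /= EL gEZ gE1 mulr1 add0r.
have starL : E (star (L g)) = 0 by rewrite gE_star EL rmorph0.
have varE : E (f * star f) - E f * (E f)^* = E (L g * star (L g)).
  rewrite Ec Ef rmorphD /= pstarZ rmorph1 mulrDl !mulrDr raddfD /=.
  rewrite ![E (_ + _)]raddfD /= -scalerAr mulr1 gEZ EL.
  rewrite -!scalerAl mul1r gEZ starL -scalerAr mulr1 !gEZ gE1; ring.
have var_en : E (L g * star (L g)) = energy f g.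
  have -> : L g = f - c *: 1 by rewrite {1}Ef addrK.
  rewrite -ibpL.
  have -> : E (L f * star g) = E (f * star (L g)).
    rewrite ibpL -[in RHS](pstarK f) -rmorphM gE_star mulrC ibpL.
    by rewrite [in RHS]energyC conjCK.
  have -> : L g = f - c *: 1 by rewrite {1}Ef addrK.
  rewrite mulrBl raddfB /= -scalerAl mul1r gEZ.
  have -> : E (star (f - c *: 1)) = 0 by have -> : f - c *: 1 = L g by rewrite Ef addrK.
  by rewrite mulr0 subr0.
have energyB h1 h2 : energy (h1 - h2) (h1 - h2) =
    energy h1 h1 - energy h1 h2 - energy h2 h1 + energy h2 h2.
  rewrite /energy -!sumrB -big_split; apply: eq_bigr => v _ /=.
  rewrite -!sumrB -big_split; apply: eq_bigr => w _ /=.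
  rewrite !linearB rmorphB /= mulrBl !mulrBr !raddfB /= ; ring.
(* With [v] the variance of [f], [energy f g = v] and [energy g g <= v]; expanding
   [energy (f - g) (f - g) >= 0] then gives [energy f f >= 2 v - v]. *)
rewrite varE; have le1 := energy_le g; have := energy_ge0 (f - g).
rewrite energyB (energyC f g) -var_en.
have vreal : (E (L g * star (L g)))^* = E (L g * star (L g)).
  by apply/CrealP/ger0_real/gE_norm_ge0.
rewrite vreal => le0.
rewrite -subr_ge0; apply: le_trans le0 _.
rewrite -subr_ge0; have := le1; rewrite -subr_ge0; congr (_ <= _).
by rewrite /=; ring.
Qed.

End Poincare.

(** * Positive matrices and moment sequences *)

Section Linear.
Variable C : numClosedFieldType.

Definition vnorm2 m (x : 'cV[C]_m) : C := \sum_i x i 0 * (x i 0)^*.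

Lemma vnorm2_ge0 m (x : 'cV[C]_m) : 0 <= vnorm2 x.
Proof. by apply: sumr_ge0 => i _; exact: mul_conjC_ge0. Qed.

Lemma vnorm2E m (x : 'cV[C]_m) : vnorm2 x = (x^t* *m x) 0 0.
Proof. by rewrite mxE; apply: eq_bigr => i _; rewrite !mxE mulrC. Qed.

Lemma vnorm2Z m c (x : 'cV[C]_m) : vnorm2 (c *: x) = c * c^* * vnorm2 x.
Proof.
rewrite /vnorm2 mulr_sumr; apply: eq_bigr => i _.
by rewrite mxE rmorphM mulrACA.
Qed.

Lemma trC_mul m n p (x : 'M[C]_(m, n)) (y : 'M[C]_(n, p)) : (x *m y)^t* = y^t* *m x^t*.
Proof. by rewrite trmx_mul map_mxM. Qed.

Lemma dot_conj m (x y : 'cV[C]_m) : ((x^t* *m y) 0 0)^* = (y^t* *m x) 0 0.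
Proof.
rewrite !mxE rmorph_sum; apply: eq_bigr => i _ /=.
by rewrite !mxE rmorphM /= conjCK mulrC.
Qed.

Lemma cauchy_schwarz m (x y : 'cV[C]_m) :
  (x^t* *m y) 0 0 * ((x^t* *m y) 0 0)^* <= vnorm2 x * vnorm2 y.
Proof.
set a := (x^t* *m y) 0 0.
have [y0|y0] := eqVneq (vnorm2 y) 0.
  have yi i : y i 0 = 0.
    have := y0; rewrite /vnorm2 => /eqP; rewrite psumr_eq0; last first.
      by move=> j _; exact: mul_conjC_ge0.
    by move=> /allP /(_ i); rewrite mem_index_enum mul_conjC_eq0 => /(_ isT)/eqP.
  by rewrite y0 mulr0 /a mxE big1 ?mul0r // => i _; rewrite yi mulr0.
have yp : 0 < vnorm2 y by rewrite lt_neqAle eq_sym y0 vnorm2_ge0.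
have := vnorm2_ge0 (vnorm2 y *: x - a^* *: y).
have E : vnorm2 (vnorm2 y *: x - a^* *: y) =
   vnorm2 y * (vnorm2 x * vnorm2 y - a * a^*).
  have yr : (vnorm2 y)^* = vnorm2 y by apply/CrealP/ger0_real/vnorm2_ge0.
  have aE : a = \sum_i (x i 0)^* * y i 0.
    by rewrite /a mxE; apply: eq_bigr => i _; rewrite !mxE.
  have aE' : a^* = \sum_i x i 0 * (y i 0)^*.
    rewrite aE rmorph_sum; apply: eq_bigr => i _.
    by rewrite rmorphM /= conjCK.
  have -> : vnorm2 (vnorm2 y *: x - a^* *: y) = \sum_i
     (vnorm2 y ^+ 2 * (x i 0 * (x i 0)^*) - vnorm2 y * a * (x i 0 * (y i 0)^*)
      - vnorm2 y * a^* * ((x i 0)^* * y i 0) + a * a^* * (y i 0 * (y i 0)^*)).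
    rewrite [LHS]/vnorm2; apply: eq_bigr => i _.
    by rewrite !mxE rmorphB !rmorphM /= conjCK yr; ring.
  rewrite big_split !sumrB -!mulr_sumr /= -aE -aE' -/(vnorm2 x) -/(vnorm2 y).
  ring.
by rewrite E pmulr_rge0 // subr_ge0.
Qed.

(** Operator norm at most [c]. Squares are used throughout, so that no square root has to be taken
    in [C]. *)
Definition opb m (A : 'M[C]_m) (c : C) :=
  forall x : 'cV[C]_m, vnorm2 (A *m x) <= c ^+ 2 * vnorm2 x.

(** At [x = A y / c] the hypothesis reads [u / c <= u / (2 c) + c w / 2] with [u = |A y|^2] and
    [w = |y|^2], that is [u <= c^2 w]. *)
Lemma opbP m (A : 'M[C]_m) c : 0 < c ->
  (forall x y : 'cV[C]_m, `|(x^t* *m A *m y) 0 0| <= c * (vnorm2 x + vnorm2 y) / 2) ->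
  opb A c.
Proof.
move=> c0 h y; have := h (c^-1 *: (A *m y)) y.
rewrite -mulmxA (_ : _ *m _ = c^-1 *: ((A *m y)^t* *m (A *m y))); last first.
  by rewrite linearZ /= map_mxZ scalemxAl fmorphV /= (CrealP (gtr0_real c0)).
rewrite mxE -vnorm2E vnorm2Z fmorphV /= (CrealP (gtr0_real c0)) ger0_norm; last first.
  by rewrite mulr_ge0 ?vnorm2_ge0 // invr_ge0 ltW.
set u := vnorm2 (A *m y); set w := vnorm2 y => le.
have cn : c != 0 by rewrite gt_eqF.
rewrite -subr_ge0; move: le; rewrite -subr_ge0.
rewrite -(@pmulr_rge0 _ (2 * c)) ?mulr_gt0 //.
congr (_ <= _); field; exact: cn.
Qed.

Lemma opb_form m (A : 'M[C]_m) c : 0 < c -> opb A c ->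
  forall x y : 'cV[C]_m, `|(x^t* *m A *m y) 0 0| <= c * (vnorm2 x + vnorm2 y) / 2.
Proof.
move=> c0 h x y; have := cauchy_schwarz x (A *m y).
rewrite mulmxA; set a := (_ *m _ *m y) 0 0 => cs.
have rhs0 : 0 <= c * (vnorm2 x + vnorm2 y) / 2.
  by rewrite divr_ge0 // mulr_ge0 ?(ltW c0) // addr_ge0 ?vnorm2_ge0.
rewrite -(@ler_pXn2r _ 2) ?nnegrE // normCK.
apply: le_trans cs _; apply: le_trans (ler_wpM2l (vnorm2_ge0 x) (h y)) _.
rewrite -subr_ge0.
have -> : (c * (vnorm2 x + vnorm2 y) / 2) ^+ 2 - vnorm2 x * (c ^+ 2 * vnorm2 y) =
   (c * (vnorm2 x - vnorm2 y) / 2) ^+ 2 by field.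
apply: real_exprn_even_ge0 => //; apply: rpredM; rewrite ?rpredV ?realn //.
by apply: rpredM; rewrite ?rpredB ?ger0_real ?vnorm2_ge0 // ltW.
Qed.

Lemma opbM m (A B : 'M[C]_m) a b : 0 <= a -> opb A a -> opb B b -> opb (A *m B) (a * b).
Proof.
move=> a0 hA hB x; rewrite -mulmxA; apply: le_trans (hA _) _.
rewrite exprMn -[leRHS]mulrA; apply: ler_wpM2l; last exact: hB.
by rewrite exprn_ge0.
Qed.

Lemma opb1 m : opb (1%:M : 'M[C]_m) 1.
Proof. by move=> x; rewrite mul1mx expr1n mul1r. Qed.

(* [s] is the moment sequence of a finitely supported probability on [0, oo). *)
Definition ismom (s : nat -> C) := exists (I : finType) (w l : I -> C),
  [/\ forall i, 0 <= w i, forall i, 0 <= l i, \sum_i w i = 1 &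
      forall k, s k = \sum_i w i * l i ^+ k].

Lemma ismom_ge0 s k : ismom s -> 0 <= s k.
Proof.
move=> [I [w [l [w0 l0 _ ->]]]]; apply: sumr_ge0 => i _.
by rewrite mulr_ge0 ?exprn_ge0.
Qed.

(** Under the product of the two laws, [x^a y^b <= max(x, y)^(a+b) <= x^(a+b) + y^(a+b)]. Two
    different sequences are allowed because the lemma has to mix a state of [W W^H] with a state of
    [W^H W]. *)
Lemma ismom_mul s s' a b : ismom s -> ismom s' ->
  s a * s' b <= s (a + b)%N + s' (a + b)%N.
Proof.
move=> [I [w [l [w0 l0 w1 sE]]]] [I' [w' [l' [w0' l0' w1' sE']]]].
have -> : s (a + b)%N + s' (a + b)%N = \sum_i \sum_j w i * w' j *
    (l i ^+ (a + b) + l' j ^+ (a + b)).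
  have -> : \sum_i \sum_j w i * w' j * (l i ^+ (a + b) + l' j ^+ (a + b)) =
     \sum_i (w i * l i ^+ (a + b) * \sum_j w' j +
             w i * \sum_j w' j * l' j ^+ (a + b)).
    apply: eq_bigr => i _; rewrite !mulr_sumr -big_split; apply: eq_bigr => j _ /=.
    by ring.
  by rewrite w1' big_split -!mulr_suml /= w1 -sE -sE'; ring.
rewrite sE sE' mulr_suml; apply: ler_sum => i _; rewrite mulr_sumr.
apply: ler_sum => j _; rewrite mulrACA ler_wpM2l ?mulr_ge0 //.
have [le|lt] := real_leP (ger0_real (l0 i)) (ger0_real (l0' j)).
  apply: ler_wpDl; first by rewrite exprn_ge0.
  by rewrite exprD ler_wpM2r ?exprn_ge0 // lerXn2r // nnegrE.
apply: ler_wpDr; first by rewrite exprn_ge0.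
by rewrite exprD ler_wpM2l ?exprn_ge0 // lerXn2r // ?nnegrE // ltW.
Qed.

Lemma ismom_sqr s a : ismom s -> s a ^+ 2 <= 2 * s (a + a)%N.
Proof. by move=> h; have := ismom_mul a a h h; rewrite mulr_natl mulr2n. Qed.

Section Gram.
Variables (n p : nat) (B : 'M[C]_(n, p)).
Let H := B *m B^t*.

Lemma gram_spectral : exists (P : 'M[C]_n) (l : 'I_n -> C),
  [/\ P \is unitarymx, forall i, 0 <= l i &
      forall k, H ^+ k = P^t* *m diag_mx (\row_i l i ^+ k) *m P].
Proof.
have Hh : H^t* = H by rewrite trC_mul trmxCK.
have nH : H \is normalmx by apply/normalmxP; rewrite Hh.
have [P [D [uP HE']]] : exists (P : 'M[C]_n) (D : 'rV[C]_n), P \is unitarymx /\ H = P^t* *m diag_mx D *m P.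
  have /orthomx_spectralP HE := nH; exists (spectralmx H), (spectral_diag H).
  by rewrite {2}HE -(invmx_unitary (spectral_unitarymx H)) spectral_unitarymx.
have PP : P *m P^t* = 1%:M by apply/unitarymxP.
have PP' : P^t* *m P = 1%:M by rewrite -(invmx_unitary uP) mulVmx // unitarymx_unit.
exists P, (fun i => D 0 i); split => //.
- move=> i; have -> : D 0 i = (P *m H *m P^t*) i i.
    by rewrite HE' !mulmxA PP mul1mx -mulmxA PP mulmx1 mxE eqxx mulr1n.
  have -> : P *m H *m P^t* = (P *m B) *m (P *m B)^t*.
    by rewrite trC_mul /H !mulmxA.
  rewrite mxE; apply: sumr_ge0 => j _; rewrite [X in _ * X]mxE [X in _ * X^*]mxE.
  exact: mul_conjC_ge0.
- elim=> [|k IH].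
    rewrite expr0 (_ : diag_mx _ = 1%:M) ?mulmx1 ?PP' //.
    by apply/matrixP => i j; rewrite !mxE.
  rewrite exprSr IH {1}HE' -[LHS]/(_ *m _ *m _ *m (_ *m _ *m _)).
  rewrite !mulmxA -[_ *m P *m P^t*]mulmxA PP mulmx1 -[X in X *m P]mulmxA mulmx_diag.
  congr (_ *m _ *m _); congr diag_mx; apply/rowP => i; rewrite !mxE.
  by rewrite exprSr.
Qed.

(** The law is the spectral measure of [H] at [x], with weights [|(P x)_i|^2]. *)
Lemma gram_state (x : 'cV[C]_n) : vnorm2 x = 1 ->
  ismom (fun k => (x^t* *m H ^+ k *m x) 0 0).
Proof.
move=> x1; have [P [l [uP l0 HE]]] := gram_spectral.
have PP' : P^t* *m P = 1%:M by rewrite -(invmx_unitary uP) mulVmx // unitarymx_unit.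
exists 'I_n, (fun i => (P *m x) i 0 * ((P *m x) i 0)^*), l; split => //.
- by move=> i; exact: mul_conjC_ge0.
- rewrite -/(vnorm2 (P *m x)) vnorm2E trC_mul -mulmxA (mulmxA (P^t* )) PP' mul1mx.
  by rewrite -vnorm2E.
- move=> k; rewrite HE !mulmxA -[x^t* *m P^t*]trC_mul -mulmxA -mulmxA.
  rewrite mxE; apply: eq_bigr => i _; rewrite mul_diag_mx !mxE.
  by set z := \sum_j _; ring.
Qed.

Lemma gram_trace : (0 < n)%N -> ismom (fun k => n%:R^-1 * \tr (H ^+ k)).
Proof.
move=> n0; have [P [l [uP l0 HE]]] := gram_spectral.
have PP : P *m P^t* = 1%:M by apply/unitarymxP.
exists 'I_n, (fun=> n%:R^-1), l; split => //.
- by move=> i; rewrite invr_ge0.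
- by rewrite sumr_const card_ord -[LHS]mulr_natl mulfV // pnatr_eq0 -lt0n.
- move=> k; rewrite HE mxtrace_mulC mulmxA PP mul1mx mxtrace_diag mulr_sumr.
  by apply: eq_bigr => i _; rewrite mxE.
Qed.

End Gram.
End Linear.

(** * Gaussian matrices with a spectral covariance *)

(* The spectral representation of the covariance, abstractly. In the application
   a point of [aT] is a pair [(m, nu)], [av] is [e_m (x) a_L(nu)], [au] is
   [a_N(nu)], [aJ] averages over [(m, nu)] and [aJs] does so with weight
   [S_m(nu) <= aB]; [good] stands for continuity. *)
Record angle (C : numClosedFieldType) (n p : nat) := Angle {
  an_gt0 : (0 < n)%N;
  ap_gt0 : (0 < p)%N;
  aT : Type;
  good : (aT -> C) -> Prop;
  good_cst : forall c, good (fun=> c);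
  good_lin : forall c f g, good f -> good g -> good (fun t => c * f t + g t);
  good_mul : forall f g, good f -> good g -> good (fun t => f t * g t);
  good_conj : forall f, good f -> good (fun t => (f t)^*);
  good_inv : forall f, good f -> good (fun t => (1 + f t * (f t)^*)^-1);
  av : aT -> 'cV[C]_n;
  au : aT -> 'cV[C]_p;
  good_av : forall i, good (fun t => av t i 0);
  good_au : forall j, good (fun t => au t j 0);
  aJ : (aT -> C) -> C;
  aJs : (aT -> C) -> C;
  aB : C;
  aB_ge0 : 0 <= aB;
  aJ_lin : forall c f g, good f -> good g ->
    aJ (fun t => c * f t + g t) = c * aJ f + aJ g;
  aJs_lin : forall c f g, good f -> good g ->
    aJs (fun t => c * f t + g t) = c * aJs f + aJs g;
  aJ_ge0 : forall f, good f -> (forall t, 0 <= f t) -> 0 <= aJ f;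
  aJs_ge0 : forall f, good f -> (forall t, 0 <= f t) -> 0 <= aJs f;
  aJs_le : forall f, good f -> (forall t, 0 <= f t) -> aJs f <= aB * aJ f;
  aJs_conj : forall f, good f -> aJs (fun t => (f t)^*) = (aJs f)^*;
  aJ_vv : forall i k, aJ (fun t => av t i 0 * (av t k 0)^*) = (i == k)%:R / n%:R;
  aJ_uu : forall i k, aJ (fun t => au t i 0 * (au t k 0)^*) = (i == k)%:R / p%:R;
  av1 : forall t, vnorm2 (av t) = 1;
  au1 : forall t, vnorm2 (au t) = 1 }.

Arguments aT {C n p} _.
Arguments good {C n p} _ _.
Arguments av {C n p} _ _.
Arguments au {C n p} _ _.
Arguments aJ {C n p} _ _.
Arguments aJs {C n p} _ _.
Arguments aB {C n p} _.

Section DualAngle.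
Variables (C : numClosedFieldType) (n p : nat) (a : angle C n p).
Notation cj x := (map_mx Num.conj x).
Let r : C := n%:R / p%:R.

Let r_ge0 : 0 <= r. Proof. by rewrite divr_ge0. Qed.

Lemma vnorm2_conj m (x : 'cV[C]_m) : vnorm2 (cj x) = vnorm2 x.
Proof. by apply: eq_bigr => i _; rewrite !mxE conjCK mulrC. Qed.

Let J_conj_vv i k : aJ a (fun t => cj (av a t) i 0 * (cj (av a t) k 0)^*) = (i == k)%:R / n%:R.
Proof.
rewrite eq_sym -(aJ_vv a); congr (aJ a _).
by apply/funext => t; rewrite !mxE conjCK mulrC.
Qed.

Let J_conj_uu i k : aJ a (fun t => cj (au a t) i 0 * (cj (au a t) k 0)^*) = (i == k)%:R / p%:R.
Proof.
rewrite eq_sym -(aJ_uu a); congr (aJ a _).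
by apply/funext => t; rewrite !mxE conjCK mulrC.
Qed.

(** The parameters of [W^H]. The vectors are conjugated because the covariance of the conjugated
    entries is the conjugate of [Gam]. The weight [n/p] compensates for the prefactor of [Gam],
    which becomes [p]; in the application it is the factor [c_N] in front of [Psibar]. *)
Definition dualA : angle C p n.
Proof.
refine (@Angle C p n (ap_gt0 a) (an_gt0 a) (aT a) (good a) (@good_cst _ _ _ a)
  (@good_lin _ _ _ a) (@good_mul _ _ _ a) (@good_conj _ _ _ a) (@good_inv _ _ _ a)
  (fun t => cj (au a t)) (fun t => cj (av a t)) _ _ (aJ a) (fun f => r * aJs a f)
  (r * aB a) _ (@aJ_lin _ _ _ a) _ (@aJ_ge0 _ _ _ a) _ _ _ _ _ _ _).
- move=> j; rewrite (_ : (fun t => _) = fun t => (au a t j 0)^*).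
    exact/good_conj/good_au.
  by apply/funext => t; rewrite mxE.
- move=> j; rewrite (_ : (fun t => _) = fun t => (av a t j 0)^*).
    exact/good_conj/good_av.
  by apply/funext => t; rewrite mxE.
- by rewrite mulr_ge0 // aB_ge0.
- by move=> c f g gf gg; rewrite aJs_lin //; ring.
- by move=> f gf f0; rewrite mulr_ge0 // aJs_ge0.
- by move=> f gf f0; rewrite -mulrA ler_wpM2l // aJs_le.
- move=> f gf; rewrite aJs_conj // rmorphM /=; congr (_ * _).
  by apply/esym/CrealP/ger0_real.
- exact: J_conj_uu.
- exact: J_conj_vv.
- by move=> t; rewrite vnorm2_conj au1.
- by move=> t; rewrite vnorm2_conj av1.
Defined.

(* [E (W_ij conj W_kl)] *)
Definition Gam (b : angle C n p) i j k l : C := n%:R *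
  aJs b (fun t => av b t i 0 * au b t j 0 * (av b t k 0 * au b t l 0)^*).

Lemma good_Gam i j k l :
  good a (fun t => av a t i 0 * au a t j 0 * (av a t k 0 * au a t l 0)^*).
Proof.
apply: good_mul; last apply: good_conj; apply: good_mul;
  by [exact: good_av|exact: good_au].
Qed.

End DualAngle.

Lemma Gam_dual (C : numClosedFieldType) (n p : nat) (a : angle C n p) i j k l :
  Gam (dualA a) j i l k = (Gam a i j k l)^*.
Proof.
rewrite /Gam /= rmorphM /= conjC_nat mulrA mulrCA mulfV ?mulr1; last first.
  by rewrite pnatr_eq0 -lt0n (ap_gt0 a).
congr (_ * _); rewrite -aJs_conj; last exact: good_Gam.
by congr aJs; apply/funext => t; rewrite !mxE !rmorphM /= !conjCK; ring.
Qed.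

(* A Gaussian [n * p] matrix [gW], seen through the algebra [gA] of polynomials in
   its entries and their conjugates: [gEx] is the expectation, [gev] the
   evaluation at a sample, [gd i j] and [gdb i j] the derivations with respect to
   the (i, j) entry and its conjugate. *)
Record gmat (C : numClosedFieldType) (n p : nat) (a : angle C n p) := Gmat {
  gA : comAlgType C;
  gstar : {rmorphism gA -> gA};
  gstarK : forall f, gstar (gstar f) = f;
  gstarZ : forall c f, gstar (c *: f) = c^* *: gstar f;
  gOmega : Type;
  gev : gOmega -> {rmorphism gA -> C};
  gevZ : forall o c f, gev o (c *: f) = c * gev o f;
  gev_star : forall o f, gev o (gstar f) = (gev o f)^*;
  gEx : {linear gA -> C^o};
  gEx1 : gEx 1 = 1;
  gEx_ge0 : forall f, (forall o, 0 <= gev o f) -> 0 <= gEx f;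
  gEx_star : forall f, gEx (gstar f) = (gEx f)^*;
  gW : 'M[gA]_(n, p);
  gd : 'I_n -> 'I_p -> {linear gA -> gA};
  gdb : 'I_n -> 'I_p -> {linear gA -> gA};
  gdM : forall i j f g, gd i j (f * g) = gd i j f * g + f * gd i j g;
  gdbM : forall i j f g, gdb i j (f * g) = gdb i j f * g + f * gdb i j g;
  gd_W : forall i j k l, gd i j (gW k l) = ((k == i) && (l == j))%:R;
  gd_sW : forall i j k l, gd i j (gstar (gW k l)) = 0;
  gdb_W : forall i j k l, gdb i j (gW k l) = 0;
  gdb_sW : forall i j k l, gdb i j (gstar (gW k l)) = ((k == i) && (l == j))%:R;
  gibp : forall i j f, gEx (gW i j * f) =
    \sum_k \sum_l Gam a i j k l * gEx (gdb k l f);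
  gibps : forall i j f, gEx (gstar (gW i j) * f) =
    \sum_k \sum_l (Gam a i j k l)^* * gEx (gd k l f);
  gkap : C;
  gkap_ge0 : 0 <= gkap;
  gpoinc : forall f, gEx (f * gstar f) - gEx f * (gEx f)^* <=
    gkap * gEx (\sum_i \sum_j (gd i j f * gstar (gd i j f) +
                               gdb i j f * gstar (gdb i j f))) }.

Arguments gA {C n p a} _.
Arguments gstar {C n p a} _.
Arguments gOmega {C n p a} _.
Arguments gev {C n p a} _ _.
Arguments gEx {C n p a} _.
Arguments gW {C n p a} _.
Arguments gd {C n p a} _ _ _.
Arguments gdb {C n p a} _ _ _.
Arguments gkap {C n p a} _.

Section DualGmat.
Variables (C : numClosedFieldType) (n p : nat) (a : angle C n p) (G : gmat a).

(** Starring the entries exchanges the derivations with respect to an entry and to its conjugate, so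
    the two integrations by parts trade places. *)
Definition dualG : gmat (dualA a).
Proof.
refine (@Gmat C p n (dualA a) (gA G) (gstar G) (@gstarK _ _ _ _ G)
  (@gstarZ _ _ _ _ G) (gOmega G) (@gev _ _ _ _ G) (@gevZ _ _ _ _ G)
  (@gev_star _ _ _ _ G) (gEx G) (gEx1 G) (@gEx_ge0 _ _ _ _ G)
  (@gEx_star _ _ _ _ G) (\matrix_(j, i) gstar G (gW G i j))
  (fun j i => gdb G i j) (fun j i => gd G i j) _ _ _ _ _ _ _ _
  (gkap G) (gkap_ge0 G) _).
- by move=> i j f g; rewrite gdbM.
- by move=> i j f g; rewrite gdM.
- by move=> i j k l; rewrite mxE gdb_sW andbC.
- by move=> i j k l; rewrite mxE gstarK gdb_W.
- by move=> i j k l; rewrite mxE gd_sW.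
- by move=> i j k l; rewrite mxE gstarK gd_W andbC.
- move=> j i f; rewrite mxE gibps exchange_big; apply: eq_bigr => l _.
  by apply: eq_bigr => k _; rewrite Gam_dual.
- move=> j i f; rewrite mxE gstarK gibp exchange_big; apply: eq_bigr => l _.
  by apply: eq_bigr => k _; rewrite Gam_dual conjCK.
- move=> f; have := gpoinc f; congr (_ <= _ * gEx G _).
  rewrite exchange_big; apply: eq_bigr => j _; apply: eq_bigr => i _.
  by rewrite addrC.
Defined.
End DualGmat.

Section Angle.
Variables (C : numClosedFieldType) (n p : nat) (a : angle C n p).
Implicit Types (f g : aT a -> C).

Lemma good_add f g : good a f -> good a g -> good a (fun t => f t + g t).
Proof.
move=> gf gg; rewrite (_ : (fun t => _) = fun t => 1 * f t + g t); first exact: good_lin.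
by apply/funext => t; rewrite mul1r.
Qed.

Lemma good_sum (I : finType) (f : I -> aT a -> C) :
  (forall i, good a (f i)) -> good a (fun t => \sum_i f i t).
Proof.
move=> gf; elim: (index_enum I) => [|i s IH].
  rewrite (_ : (fun t => _) = fun=> 0); first exact: good_cst.
  by apply/funext => t; rewrite big_nil.
rewrite (_ : (fun t => _) = fun t => f i t + \sum_(j <- s) f j t).
  exact: good_add.
by apply/funext => t; rewrite big_cons.
Qed.

Lemma good_scale c f : good a f -> good a (fun t => c * f t).
Proof. by move=> gf; apply: good_mul => //; exact: good_cst. Qed.

Lemma good_sub f g : good a f -> good a g -> good a (fun t => f t - g t).
Proof.
move=> gf gg; rewrite (_ : (fun t => _) = fun t => f t + -1 * g t).
  by apply: good_add => //; exact: good_scale.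
by apply/funext => t; rewrite mulN1r.
Qed.

Section LinearFunctional.
Variable J : (aT a -> C) -> C.
Hypothesis J_lin : forall c f g, good a f -> good a g ->
  J (fun t => c * f t + g t) = c * J f + J g.

Lemma fun_lin0 : J (fun=> 0) = 0.
Proof.
have g0 := good_cst a 0; have := J_lin (-1) g0 g0.
by rewrite (_ : (fun t => _) = fun=> 0) ?mulN1r ?addNr //; apply/funext => t; rewrite mulr0 addr0.
Qed.

Lemma fun_lin_scale c f : good a f -> J (fun t => c * f t) = c * J f.
Proof.
move=> gf; have := J_lin c gf (good_cst a 0); rewrite fun_lin0 addr0 => <-.
by congr J; apply/funext => t; rewrite addr0.
Qed.

Lemma fun_lin_add f g : good a f -> good a g -> J (fun t => f t + g t) = J f + J g.
Proof.
move=> gf gg; rewrite -[J f]mul1r -J_lin //.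
by congr J; apply/funext => t; rewrite mul1r.
Qed.

Lemma fun_lin_sub f g : good a f -> good a g -> J (fun t => f t - g t) = J f - J g.
Proof.
move=> gf gg; rewrite -mulN1r addrC -J_lin //.
by congr J; apply/funext => t; rewrite mulN1r addrC.
Qed.

Lemma fun_lin_sum (I : finType) (f : I -> aT a -> C) :
  (forall i, good a (f i)) -> J (fun t => \sum_i f i t) = \sum_i J (f i).
Proof.
move=> gf.
have h (s : seq I) : good a (fun t => \sum_(i <- s) f i t) /\
    J (fun t => \sum_(i <- s) f i t) = \sum_(i <- s) J (f i).
  elim: s => [|i s [gs IH]].
    rewrite (_ : (fun t => _) = fun=> 0); last by apply/funext => t; rewrite big_nil.
    by rewrite big_nil fun_lin0; split => //; exact: good_cst.
  rewrite (_ : (fun t => _) = fun t => f i t + \sum_(j <- s) f j t); last first.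
    by apply/funext => t; rewrite big_cons.
  by rewrite big_cons fun_lin_add // IH; split => //; exact: good_add.
by have [] := h (index_enum I).
Qed.
End LinearFunctional.

Lemma addC_conj_le (s : C) : s + s^* <= 2 * `|s|.
Proof.
have -> : s + s^* = 2 * 'Re s by rewrite ReE mulrC mulfVK ?pnatr_eq0.
by rewrite ler_wpM2l //; have [] := leif_Re_Creal s.
Qed.

(** Rotating [h] by the phase of [J h] reduces the bound to positivity. It stands for
    [|J h| <= J |h|], which cannot be used as such: [good] is not known to contain [|h|]. *)
Lemma phase_bound (J : (aT a -> C) -> C) h q :
  (forall c f g, good a f -> good a g ->
    J (fun t => c * f t + g t) = c * J f + J g) ->
  (forall f, good a f -> (forall t, 0 <= f t) -> 0 <= J f) ->
  (forall f, good a f -> J (fun t => (f t)^*) = (J f)^*) ->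
  good a h -> good a q -> 0 <= J q ->
  (forall t w, `|w| = 1 -> w * h t + (w * h t)^* <= q t) ->
  `|J h| * 2 <= J q.
Proof.
move=> Jl J0 Jc gh gq Jq0 hq.
have [->|Jh0] := eqVneq (J h) 0; first by rewrite normr0 mul0r.
pose w := `|J h| / J h.
have w1 : `|w| = 1 by rewrite normf_div normr_id divff // normr_eq0.
have gwh : good a (fun t => w * h t) by exact: good_scale.
have gwh' : good a (fun t => (w * h t)^*) by exact: good_conj.
have E1 : J (fun t => w * h t) = `|J h|.
  by rewrite (fun_lin_scale Jl) // /w mulfVK.
have E2 : J (fun t => (w * h t)^*) = `|J h|.
  by rewrite Jc // E1; apply/CrealP/normr_real.
rewrite mulr_natr mulr2n -{1}E1 -E2 -(fun_lin_add Jl) // -subr_ge0 -(fun_lin_sub Jl) //.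
  apply: J0 => [|t]; first by apply: good_sub => //; exact: good_add.
  by rewrite subr_ge0 hq.
exact: good_add.
Qed.

Lemma aJ_le f g : good a f -> good a g -> (forall t, f t <= g t) -> aJ a f <= aJ a g.
Proof.
move=> gf gg le; rewrite -subr_ge0 -(fun_lin_sub (@aJ_lin _ _ _ a)) //.
by apply: aJ_ge0 => [|t]; [exact: good_sub|rewrite subr_ge0].
Qed.

Lemma aJs_le' f g : good a f -> good a g -> (forall t, f t <= g t) -> aJs a f <= aJs a g.
Proof.
move=> gf gg le; rewrite -subr_ge0 -(fun_lin_sub (@aJs_lin _ _ _ a)) //.
by apply: aJs_ge0 => [|t]; [exact: good_sub|rewrite subr_ge0].
Qed.

Lemma good_dot (x : 'cV[C]_n) : good a (fun t => (x^t* *m av a t) 0 0).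
Proof.
rewrite (_ : (fun t => _) = fun t => \sum_i (x i 0)^* * av a t i 0).
  by apply: good_sum => i; apply: good_scale; exact: good_av.
by apply/funext => t; rewrite mxE; apply: eq_bigr => i _; rewrite !mxE.
Qed.

Lemma good_dot' (x : 'cV[C]_n) : good a (fun t => ((av a t)^t* *m x) 0 0).
Proof.
rewrite (_ : (fun t => _) = fun t => ((x^t* *m av a t) 0 0)^*).
  by apply: good_conj; exact: good_dot.
by apply/funext => t; rewrite dot_conj.
Qed.

(** By [aJ_vv] the vectors [av a t] form a tight frame with respect to [aJ], so the cross terms
    vanish. *)
Lemma parseval (x : 'cV[C]_n) :
  aJ a (fun t => (x^t* *m av a t) 0 0 * ((av a t)^t* *m x) 0 0) = n%:R^-1 * vnorm2 x.
Proof.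
rewrite (_ : (fun t => _) = fun t => \sum_i \sum_k ((x i 0)^* * x k 0) *
    (av a t i 0 * (av a t k 0)^*)); last first.
  apply/funext => t; rewrite !mxE mulr_suml; apply: eq_bigr => i _.
  by rewrite mulr_sumr; apply: eq_bigr => k _; rewrite !mxE; ring.
have gvv i k : good a (fun t => av a t i 0 * (av a t k 0)^*).
  by apply: good_mul; [exact: good_av|apply: good_conj; exact: good_av].
rewrite (fun_lin_sum (@aJ_lin _ _ _ a)); last first.
  by move=> i; apply: good_sum => k; exact: good_scale.
rewrite /vnorm2 mulr_sumr; apply: eq_bigr => i _.
rewrite (fun_lin_sum (@aJ_lin _ _ _ a)); last by move=> k; exact: good_scale.
rewrite (bigD1 i) //= big1 ?addr0; last first.
  move=> k ki; rewrite (fun_lin_scale (@aJ_lin _ _ _ a)) // aJ_vv.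
  by rewrite eq_sym (negbTE ki) mul0r mulr0.
rewrite (fun_lin_scale (@aJ_lin _ _ _ a)) // aJ_vv eqxx mulr1n mul1r mulrC.
by rewrite [x i 0 * _]mulrC.
Qed.

(* Weyl-Heisenberg type quantization of a symbol on the parameter space. *)
Definition quant (J : (aT a -> C) -> C) (phi : aT a -> C) : 'M[C]_n :=
  \matrix_(i, k) (n%:R * J (fun t => phi t * (av a t i 0 * (av a t k 0)^*))).

Lemma quant_form J phi (x y : 'cV[C]_n) :
  (forall c f g, good a f -> good a g ->
    J (fun t => c * f t + g t) = c * J f + J g) -> good a phi ->
  (x^t* *m quant J phi *m y) 0 0 =
  n%:R * J (fun t => phi t * ((x^t* *m av a t) 0 0 * ((av a t)^t* *m y) 0 0)).
Proof.
move=> Jl gphi.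
have gvv i k : good a (fun t => phi t * (av a t i 0 * (av a t k 0)^*)).
  by apply: good_mul => //; apply: good_mul; [exact: good_av|apply: good_conj; exact: good_av].
rewrite (_ : (fun t => _) = fun t => \sum_k \sum_i ((x i 0)^* * y k 0) *
    (phi t * (av a t i 0 * (av a t k 0)^*))); last first.
  apply/funext => t; rewrite exchange_big !mxE mulr_suml mulr_sumr; apply: eq_bigr => i _.
  by rewrite !mulr_sumr; apply: eq_bigr => k _; rewrite !mxE; ring.
rewrite (fun_lin_sum Jl); last first.
  by move=> i; apply: good_sum => k; exact: good_scale.
rewrite mxE mulr_sumr; apply: eq_bigr => k _.
rewrite (fun_lin_sum Jl); last by move=> i; exact: good_scale.
rewrite mxE mulr_suml mulr_sumr; apply: eq_bigr => i _.
by rewrite (fun_lin_scale Jl) // !mxE; ring.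
Qed.

(** The bridge between the two ways of comparing matrices: a normalized trace against a quantized
    symbol is an average of quadratic forms weighted by this symbol. *)
Lemma quant_tr (A : 'M[C]_n) phi : good a phi ->
  n%:R^-1 * \tr (quant (aJ a) phi *m A) =
  aJ a (fun t => phi t * ((av a t)^t* *m A *m av a t) 0 0).
Proof.
move=> gphi.
have gvv i k : good a (fun t => phi t * (av a t i 0 * (av a t k 0)^*)).
  by apply: good_mul => //; apply: good_mul; [exact: good_av|apply: good_conj; exact: good_av].
rewrite (_ : (fun t => _) = fun t => \sum_i \sum_k A k i *
    (phi t * (av a t i 0 * (av a t k 0)^*))); last first.
  apply/funext => t; rewrite mxE mulr_sumr; apply: eq_bigr => i _.
  rewrite mxE mulr_suml mulr_sumr; apply: eq_bigr => k _; rewrite !mxE; ring.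
rewrite (fun_lin_sum (@aJ_lin _ _ _ a)); last first.
  by move=> i; apply: good_sum => k; exact: good_scale.
rewrite /mxtrace mulr_sumr; apply: eq_bigr => i _.
rewrite (fun_lin_sum (@aJ_lin _ _ _ a)); last by move=> k; exact: good_scale.
rewrite mxE mulr_sumr; apply: eq_bigr => k _.
rewrite (fun_lin_scale (@aJ_lin _ _ _ a)) // !mxE mulrC.
by rewrite mulrC !mulrA mulVf ?mul1r 1?mulrC // pnatr_eq0 -lt0n (an_gt0 a).
Qed.

(* The weight is majorized by its sup norm before Cauchy-Schwarz and [parseval]. *)
Lemma quant_opb_gen J b phi c : 0 <= b -> 0 < c * b ->
  (forall c f g, good a f -> good a g ->
    J (fun t => c * f t + g t) = c * J f + J g) ->
  (forall f, good a f -> (forall t, 0 <= f t) -> 0 <= J f <= b * aJ a f) ->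
  (forall f, good a f -> J (fun t => (f t)^*) = (J f)^*) ->
  good a phi -> (forall t, `|phi t| <= c) -> opb (quant J phi) (c * b).
Proof.
move=> b0 cb0 Jl Jb Jc gphi hphi; apply: opbP => // x y; rewrite quant_form //.
set h := fun t => _.
have gh : good a h.
  by apply: good_mul => //; apply: good_mul; [exact: good_dot|exact: good_dot'].
pose q t := c * ((x^t* *m av a t) 0 0 * ((av a t)^t* *m x) 0 0 +
                 (y^t* *m av a t) 0 0 * ((av a t)^t* *m y) 0 0).
have gq : good a q.
  apply: good_scale; apply: good_add; apply: good_mul;
  by [exact: good_dot|exact: good_dot'].
have J0 f : good a f -> (forall t, 0 <= f t) -> 0 <= J f.
  by move=> gf f0; have /andP[] := Jb _ gf f0.
have dotsq (z : 'cV[C]_n) t : (z^t* *m av a t) 0 0 * ((av a t)^t* *m z) 0 0 =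
    `|(z^t* *m av a t) 0 0| ^+ 2 by rewrite normCK dot_conj.
have q0 t : 0 <= q t.
  have c0 : 0 <= c by apply: le_trans (hphi t).
  by rewrite mulr_ge0 // addr_ge0 // dotsq exprn_ge0.
have key : `|J h| * 2 <= J q.
  apply: phase_bound => // [|t w w1]; first by have /andP[] := Jb _ gq q0.
  apply: le_trans (addC_conj_le _) _; rewrite normrM w1 mul1r /h normrM mulrCA.
  rewrite /q; apply: ler_pM; rewrite ?mulr_ge0 ?hphi //.
  rewrite normrM !dotsq -(norm_conjC (((av a t)^t* *m y) 0 0)) dot_conj.
  set r := `|_ |; set s := `| _|.
  rewrite -subr_ge0 (_ : _ - _ = (r - s) ^+ 2); last by ring.
  by apply: real_exprn_even_ge0; rewrite // rpredB // normr_real.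
rewrite normrM normr_nat ler_pdivlMr // -[leLHS]mulrA.
apply: le_trans (ler_wpM2l (ler0n _ n) key) _.
have /andP[_ le2] := Jb _ gq q0.
apply: le_trans (ler_wpM2l (ler0n _ n) le2) _.
have gd (z : 'cV[C]_n) : good a (fun t => (z^t* *m av a t) 0 0 * ((av a t)^t* *m z) 0 0).
  exact: (good_mul (good_dot z) (good_dot' z)).
rewrite /q (fun_lin_scale (@aJ_lin _ _ _ a)); last exact: good_add.
rewrite (fun_lin_add (@aJ_lin _ _ _ a)) // !parseval.
rewrite le_eqVlt; apply/orP; left; apply/eqP; field.
by rewrite pnatr_eq0 -lt0n (an_gt0 a).
Qed.

End Angle.

Lemma mul_delta_mx_entry (B : comNzRingType) m n p q (P : 'M[B]_(m, n)) (Q : 'M[B]_(p, q)) i k j l :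
  (P *m delta_mx i k *m Q) j l = P j i * Q k l.
Proof.
rewrite !mxE (bigD1 k) //= big1 ?addr0 => [|k' kk']; last first.
  rewrite mxE big1 ?mul0r // => i' _; rewrite mxE.
  by rewrite (negbTE kk') andbF mulr0.
congr (_ * _); rewrite mxE (bigD1 i) //= big1 ?addr0 => [|i' ii'].
  by rewrite mxE !eqxx mulr1.
by rewrite mxE (negbTE ii') mulr0.
Qed.

Section Derivation.
Variables (C : numClosedFieldType) (A : comAlgType C) (D : {linear A -> A}).
Hypothesis DM : forall f g, D (f * g) = D f * g + f * D g.

Lemma derivation1 : D 1 = 0.
Proof.
have := DM 1 1; rewrite !mul1r mulr1 => /eqP.
by rewrite -{1}[D 1]addr0 (inj_eq (addrI _)) eq_sym => /eqP.
Qed.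

Lemma map_derivM m n p (M : 'M[A]_(m, n)) (N : 'M[A]_(n, p)) :
  map_mx D (M *m N) = map_mx D M *m N + M *m map_mx D N.
Proof.
apply/matrixP => i k; rewrite !mxE raddf_sum -big_split; apply: eq_bigr => j _ /=.
by rewrite DM !mxE.
Qed.

Lemma map_deriv_cst m n (M : 'M[C]_(m, n)) : map_mx D (map_mx (in_alg A) M) = 0.
Proof.
by apply/matrixP => i j; rewrite !mxE /= linearZ /= derivation1 scaler0.
Qed.

Lemma map_derivX n (M : 'M[A]_n) q :
  map_mx D (M ^+ q) = \sum_(i < q) M ^+ i *m map_mx D M *m M ^+ (q - i.+1).
Proof.
elim: q => [|q IH].
  rewrite big_ord0 expr0; apply/matrixP => i j; rewrite !mxE.
  by case: (i == j); rewrite ?derivation1 ?raddf0.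
rewrite exprS -[_ * _]/(_ *m _) map_derivM IH big_ord_recl expr0 mul1mx subSS subn0.
congr (_ + _); rewrite mulmx_sumr; apply: eq_bigr => i _.
by rewrite lift0 subSS exprS -[_ * _]/(_ *m _) !mulmxA.
Qed.
End Derivation.

(** * Derivatives and recursions for the powers of [W W^H] *)

Section Model.
Variables (C : numClosedFieldType) (n p : nat) (a : angle C n p) (G : gmat a).
Local Notation A := (gA G).
Local Notation E := (gEx G).
Local Notation star := (gstar G).
Local Notation ev := (gev G).
Local Notation W := (gW G).
Local Notation d := (gd G).
Local Notation db := (gdb G).
Local Notation v := (av a).
Local Notation u := (au a).

Definition cm m q (M : 'M[C]_(m, q)) : 'M[A]_(m, q) := map_mx (in_alg A) M.
Definition gWs : 'M[A]_(p, n) := map_mx star W^T.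
Definition gX k : 'M[A]_n := (W *m gWs) ^+ k.
Definition gY k : 'M[A]_p := (gWs *m W) ^+ k.
Local Notation Ws := gWs.
Local Notation X := gX.
Local Notation Y := gY.
Definition nrm (f : A) : A := f * star f.
Definition bil m (x : 'cV[C]_m) (M : 'M[A]_m) (y : 'cV[C]_m) : A :=
  (cm (x^t* ) *m M *m cm y) 0 0.

Lemma EZ c f : E (c *: f) = c * E f. Proof. exact: linearZ. Qed.

Lemma E_le f g : (forall o, ev o f <= ev o g) -> E f <= E g.
Proof.
move=> le; rewrite -subr_ge0 -raddfB; apply: gEx_ge0 => o.
by rewrite rmorphB subr_ge0.
Qed.

Lemma ev_nrm o f : ev o (nrm f) = `|ev o f| ^+ 2.
Proof. by rewrite rmorphM /= gev_star normCK. Qed.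

Lemma E_nrm_ge0 f : 0 <= E (nrm f).
Proof. by apply: gEx_ge0 => o; rewrite ev_nrm exprn_ge0. Qed.

Lemma ev_cm o m q (M : 'M[C]_(m, q)) : map_mx (ev o) (cm M) = M.
Proof. by apply/matrixP => i j; rewrite !mxE /= gevZ rmorph1 mulr1. Qed.

Lemma cmM m q r (M : 'M[C]_(m, q)) (N : 'M[C]_(q, r)) : cm (M *m N) = cm M *m cm N.
Proof. exact: map_mxM. Qed.

Lemma ev_bil o m (x : 'cV[C]_m) M y :
  ev o (bil x M y) = (x^t* *m map_mx (ev o) M *m y) 0 0.
Proof.
by rewrite -{2}(ev_cm o y) -(ev_cm o (x^t* )) -!map_mxM [RHS]mxE.
Qed.

Lemma bilE m (x : 'cV[C]_m) M y :
  bil x M y = \sum_i \sum_k ((x i 0)^* * y k 0) *: M i k.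
Proof.
rewrite /bil mxE exchange_big; apply: eq_bigr => k _.
rewrite mxE mulr_suml; apply: eq_bigr => i _.
by rewrite !mxE /= -scalerAl mul1r -scalerAr mulr1 scalerA mulrC.
Qed.

Lemma bilB m (x : 'cV[C]_m) M N y : bil x (M - N) y = bil x M y - bil x N y.
Proof. by rewrite /bil mulmxBr mulmxBl !mxE. Qed.

Lemma bil_cm m (x : 'cV[C]_m) (M : 'M[C]_m) y :
  bil x (cm M) y = ((x^t* *m M *m y) 0 0)%:A.
Proof. by rewrite /bil -!cmM mxE. Qed.

Lemma E_bil m (x : 'cV[C]_m) M y :
  E (bil x M y) = (x^t* *m map_mx E M *m y) 0 0.
Proof.
transitivity (\sum_i \sum_k (x i 0)^* * y k 0 * E (M i k)).
  rewrite bilE raddf_sum; apply: eq_bigr => i _; rewrite raddf_sum.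
  by apply: eq_bigr => k _; rewrite /= EZ.
rewrite mxE exchange_big; apply: eq_bigr => k _; rewrite mxE mulr_suml.
by apply: eq_bigr => i _; rewrite !mxE mulrAC.
Qed.

Lemma evW o : map_mx (ev o) Ws = (map_mx (ev o) W)^t*.
Proof. by apply/matrixP => i j; rewrite !mxE gev_star. Qed.

Lemma evX o k : map_mx (ev o) (X k) =
  (map_mx (ev o) W *m (map_mx (ev o) W)^t* ) ^+ k.
Proof.
elim: k => [|k IH]; first by rewrite /X !expr0 [LHS]map_mx1.
by rewrite /X !exprS -![_ * _]/(_ *m _) !map_mxM IH evW.
Qed.

Lemma bil_state o (x : 'cV[C]_n) : vnorm2 x = 1 ->
  ismom (fun k => ev o (bil x (X k) x)).
Proof.
move=> x1; have [I [w [l [h1 h2 h3 h4]]]] := gram_state (map_mx (ev o) W) x1.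
by exists I, w, l; split => // k; rewrite -h4 ev_bil evX.
Qed.

Lemma ev_tr o (M : 'M[A]_n) : ev o (n%:R^-1 *: \tr M) = n%:R^-1 * \tr (map_mx (ev o) M).
Proof.
rewrite gevZ /mxtrace rmorph_sum; congr (_ * _); apply: eq_bigr => i _.
by rewrite mxE.
Qed.

Lemma tr_state o : ismom (fun k => ev o (n%:R^-1 *: \tr (X k))).
Proof.
have [I [w [l [h1 h2 h3 h4]]]] := gram_trace (map_mx (ev o) W) (an_gt0 a).
by exists I, w, l; split => // k; rewrite -h4 ev_tr evX.
Qed.

(** Finite sums of fixed polynomials with good coefficients. The form is chosen so that closure
    under products and stars goes by induction and that [E] returns a good function. *)
Inductive goodA : (aT a -> A) -> Prop :=
| goodA0 : goodA (fun=> 0)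
| goodAS c f g : good a c -> goodA g -> goodA (fun t => c t *: f + g t).

Lemma goodA_add f g : goodA f -> goodA g -> goodA (fun t => f t + g t).
Proof.
move=> gf gg; elim: gf => [|c h f' gc _ IH].
  by rewrite (_ : (fun t => _) = g) //; apply/funext => t; rewrite add0r.
rewrite (_ : (fun t => _) = fun t => c t *: h + (f' t + g t)); first exact: goodAS.
by apply/funext => t; rewrite addrA.
Qed.

Lemma goodA_base c f : good a c -> goodA (fun t => c t *: f).
Proof.
move=> gc; rewrite (_ : (fun t => _) = fun t => c t *: f + 0).
  exact: goodAS goodA0.
by apply/funext => t; rewrite addr0.
Qed.

Lemma goodA_sum (I : finType) (f : I -> aT a -> A) :
  (forall i, goodA (f i)) -> goodA (fun t => \sum_i f i t).
Proof.
move=> gf; elim: (index_enum I) => [|i s IH].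
  by rewrite (_ : (fun t => _) = fun=> 0); [exact: goodA0|apply/funext => t; rewrite big_nil].
rewrite (_ : (fun t => _) = fun t => f i t + \sum_(j <- s) f j t).
  exact: goodA_add.
by apply/funext => t; rewrite big_cons.
Qed.

Lemma goodA_mul f g : goodA f -> goodA g -> goodA (fun t => f t * g t).
Proof.
move=> gf gg; elim: gf => [|c h f' gc _ IH].
  by rewrite (_ : (fun t => _) = fun=> 0); [exact: goodA0|apply/funext => t; rewrite mul0r].
rewrite (_ : (fun t => _) = fun t => c t *: (h * g t) + f' t * g t); last first.
  by apply/funext => t; rewrite mulrDl scalerAl.
apply: goodA_add => //; elim: gg => [|c' h' g' gc' _ IH'].
  rewrite (_ : (fun t => _) = fun=> 0); first exact: goodA0.
  by apply/funext => t; rewrite mulr0 scaler0.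
rewrite (_ : (fun t => _) = fun t => (c t * c' t) *: (h * h') + c t *: (h * g' t)).
  by apply: goodAS => //; exact: good_mul.
by apply/funext => t; rewrite mulrDr scalerDr -scalerAr scalerA.
Qed.

Lemma goodA_star f : goodA f -> goodA (fun t => star (f t)).
Proof.
elim=> [|c h f' gc _ IH].
  by rewrite (_ : (fun t => _) = fun=> 0); [exact: goodA0|apply/funext => t; rewrite rmorph0].
rewrite (_ : (fun t => _) = fun t => (c t)^* *: star h + star (f' t)).
  by apply: goodAS => //; exact: good_conj.
by apply/funext => t; rewrite rmorphD /= gstarZ.
Qed.

Lemma goodA_nrm f : goodA f -> goodA (fun t => nrm (f t)).
Proof. by move=> gf; apply: goodA_mul => //; exact: goodA_star. Qed.

Lemma good_E f : goodA f -> good a (fun t => E (f t)).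
Proof.
elim=> [|c h f' gc _ IH].
  by rewrite (_ : (fun t => _) = fun=> 0); [exact: good_cst|apply/funext => t; rewrite raddf0].
rewrite (_ : (fun t => _) = fun t => E h * c t + E (f' t)); first exact: good_lin.
by apply/funext => t; rewrite raddfD /= EZ mulrC.
Qed.

Lemma goodA_bil m (x y : aT a -> 'cV[C]_m) M :
  (forall i, good a (fun t => x t i 0)) -> (forall i, good a (fun t => y t i 0)) ->
  goodA (fun t => bil (x t) M (y t)).
Proof.
move=> gx gy; rewrite (_ : (fun t => _) =
   fun t => \sum_i \sum_k ((x t i 0)^* * y t k 0) *: M i k).
  apply: goodA_sum => i; apply: goodA_sum => k; apply: goodA_base.
  by apply: good_mul => //; exact: good_conj.
by apply/funext => t; rewrite bilE.
Qed.

Lemma goodA_bilv M : goodA (fun t => bil (v t) M (v t)).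
Proof. by apply: goodA_bil => i; exact: good_av. Qed.

Lemma goodA_bilu M :
  goodA (fun t => bil (map_mx Num.conj (u t)) M (map_mx Num.conj (u t))).
Proof. by apply: goodA_bil => i; exact: (good_av (dualA a) i). Qed.

Lemma J_bil M : aJ a (fun t => E (bil (v t) M (v t))) = E (n%:R^-1 *: \tr M).
Proof.
have gvv i k : good a (fun t => v t i 0 * (v t k 0)^*).
  by apply: good_mul; [exact: good_av|apply: good_conj; exact: good_av].
rewrite (_ : (fun t => _) = fun t => \sum_i \sum_k E (M i k) *
    (v t k 0 * (v t i 0)^*)); last first.
  apply/funext => t; rewrite bilE raddf_sum; apply: eq_bigr => i _.
  rewrite raddf_sum; apply: eq_bigr => k _ /=; rewrite EZ mulrC.
  by rewrite [_^* * _]mulrC.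
rewrite (fun_lin_sum (@aJ_lin _ _ _ a)); last first.
  by move=> i; apply: good_sum => k; exact: good_scale.
rewrite /mxtrace scaler_sumr raddf_sum; apply: eq_bigr => i _.
rewrite (fun_lin_sum (@aJ_lin _ _ _ a)); last by move=> k; exact: good_scale.
rewrite (bigD1 i) //= big1 ?addr0; last first.
  move=> k ki; rewrite (fun_lin_scale (@aJ_lin _ _ _ a)) // aJ_vv.
  by rewrite (negbTE ki) mul0r mulr0.
by rewrite (fun_lin_scale (@aJ_lin _ _ _ a)) // aJ_vv eqxx mulr1n div1r EZ mulrC.
Qed.

Lemma map_gd_W i j : map_mx (d i j) W = delta_mx i j.
Proof. by apply/matrixP => k l; rewrite !mxE gd_W. Qed.
Lemma map_gd_Ws i j : map_mx (d i j) Ws = 0.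
Proof. by apply/matrixP => k l; rewrite !mxE gd_sW. Qed.
Lemma map_gdb_W i j : map_mx (db i j) W = 0.
Proof. by apply/matrixP => k l; rewrite !mxE gdb_W. Qed.
Lemma map_gdb_Ws i j : map_mx (db i j) Ws = delta_mx j i.
Proof. by apply/matrixP => k l; rewrite !mxE gdb_sW andbC. Qed.

Lemma WsX k : Ws *m X k = Y k *m Ws.
Proof.
elim: k => [|k IH]; first by rewrite /X /Y !expr0 [LHS]mulmx1 [RHS]mul1mx.
by rewrite /X /Y !exprS -![_ * _]/(_ *m _) -!mulmxA -/(X k) IH !mulmxA.
Qed.

Lemma XW k : X k *m W = W *m Y k.
Proof.
elim: k => [|k IH]; first by rewrite /X /Y !expr0 [LHS]mul1mx [RHS]mulmx1.
by rewrite /X /Y !exprS -![_ * _]/(_ *m _) -!mulmxA -/(X k) IH !mulmxA.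
Qed.

Lemma XS k : X k.+1 = W *m (Ws *m X k).
Proof. by rewrite /X exprS -[_ * _]/(_ *m _) mulmxA. Qed.

Lemma X0 : X 0 = 1%:M. Proof. by []. Qed.

Lemma XD i j : X (i + j) = X i *m X j. Proof. by rewrite /X exprD. Qed.

Lemma d_X i j k : map_mx (d i j) (X k) =
  \sum_(q < k) X q *m delta_mx i j *m (Ws *m X (k - q.+1)).
Proof.
rewrite map_derivX; last exact: gdM; apply: eq_bigr => q _.
rewrite map_derivM; last exact: gdM.
by rewrite map_gd_W map_gd_Ws mulmx0 addr0 !mulmxA.
Qed.

Lemma db_X i j k : map_mx (db i j) (X k) =
  \sum_(q < k) (X q *m W) *m delta_mx j i *m X (k - q.+1).
Proof.
rewrite map_derivX; last exact: gdbM; apply: eq_bigr => q _.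
rewrite map_derivM; last exact: gdbM.
by rewrite map_gdb_W map_gdb_Ws mul0mx add0r !mulmxA.
Qed.

Lemma db_WsX i j k : map_mx (db i j) (Ws *m X k) =
  \sum_(q < k.+1) Y q *m delta_mx j i *m X (k - q).
Proof.
rewrite map_derivM; last exact: gdbM.
rewrite db_X map_gdb_Ws big_ord_recl /Y expr0 mul1mx subn0; congr (_ + _).
rewrite mulmx_sumr; apply: eq_bigr => q _; rewrite lift0.
by rewrite XW !mulmxA exprS.
Qed.

Definition Sop (P : 'M[A]_p) : 'M[A]_n :=
  \matrix_(i, k) \sum_j \sum_l Gam a i j k l *: P j l.

(** Integration by parts on the leftmost [W] of [W (Ws X_k)]: since [gdb] kills [W], it pairs with
    each of the [k + 1] factors [Ws] in turn, leaving [Y_q] between the paired factors and [X_(k-q)]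
    to their right. *)
Lemma E_X_rec k : map_mx E (X k.+1) =
  \sum_(q < k.+1) map_mx E (Sop (Y q) *m X (k - q)).
Proof.
apply/matrixP => i b; rewrite summxE XS !mxE raddf_sum.
transitivity (\sum_j \sum_c \sum_l \sum_(q < k.+1)
    Gam a i j c l * E (Y q j l * X (k - q) c b)).
  apply: eq_bigr => j _; rewrite /= gibp; apply: eq_bigr => c _.
  apply: eq_bigr => l _; rewrite -mulr_sumr -raddf_sum; congr (_ * E _).
  have -> : db c l ((Ws *m X k) j b) = map_mx (db c l) (Ws *m X k) j b by rewrite [RHS]mxE.
  rewrite db_WsX summxE; apply: eq_bigr => q _; exact: mul_delta_mx_entry.
under eq_bigr do under eq_bigr do rewrite exchange_big.
under eq_bigr do rewrite exchange_big.
rewrite exchange_big; apply: eq_bigr => q _ /=.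
rewrite !mxE raddf_sum exchange_big; apply: eq_bigr => c _.
rewrite !mxE mulr_suml raddf_sum; apply: eq_bigr => j _.
rewrite mulr_suml raddf_sum; apply: eq_bigr => l _ /=.
by rewrite -scalerAl EZ.
Qed.

(** The spectral form of the covariance separates the indices of [P] from those of [Q] at each
    parameter [t]: the trace sees [P] only through its quadratic forms at the conjugates of
    [u t]. *)
Lemma trace_form (A0 : 'M[C]_n) P Q :
  E (n%:R^-1 *: \tr (cm A0 *m (Sop P *m Q))) =
  aJs a (fun t => E (bil (map_mx Num.conj (u t)) P (map_mx Num.conj (u t)) *
                     bil (v t) (Q *m cm A0) (v t))).
Proof.
rewrite mxtrace_mulC -mulmxA; set R := Q *m _.
have gg i j k l := good_Gam a i j k l.
transitivity (\sum_i \sum_k \sum_j \sum_l E (P j l * R k i) *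
    aJs a (fun t => v t i 0 * u t j 0 * (v t k 0 * u t l 0)^*)).
  rewrite /mxtrace scaler_sumr raddf_sum; apply: eq_bigr => i _ /=.
  rewrite mxE scaler_sumr raddf_sum; apply: eq_bigr => k _ /=.
  rewrite mxE mulr_suml scaler_sumr raddf_sum; apply: eq_bigr => j _ /=.
  rewrite mulr_suml scaler_sumr raddf_sum; apply: eq_bigr => l _ /=.
  rewrite -scalerAl scalerA EZ mulrC /Gam; congr (_ * _); rewrite mulKf //.
  by rewrite pnatr_eq0 -lt0n (an_gt0 a).
rewrite (_ : (fun t => _) = fun t => \sum_i \sum_k \sum_j \sum_l E (P j l * R k i) *
    (v t i 0 * u t j 0 * (v t k 0 * u t l 0)^*)); last first.
  apply/funext => t; rewrite !bilE mulrC exchange_big mulr_suml raddf_sum.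
  apply: eq_bigr => i _; rewrite mulr_suml raddf_sum; apply: eq_bigr => k _ /=.
  rewrite mulr_sumr raddf_sum; apply: eq_bigr => j _ /=.
  rewrite mulr_sumr raddf_sum; apply: eq_bigr => l _ /=.
  rewrite -scalerAl -scalerAr scalerA EZ mulrC [R k i * _]mulrC; congr (_ * _).
  by rewrite !mxE rmorphM /= conjCK; ring.
rewrite (fun_lin_sum (@aJs_lin _ _ _ a)); last first.
  by move=> i; do 3! apply: good_sum => ?; exact: good_scale.
apply: eq_bigr => i _; rewrite (fun_lin_sum (@aJs_lin _ _ _ a)); last first.
  by move=> k; do 2! apply: good_sum => ?; exact: good_scale.
apply: eq_bigr => k _; rewrite (fun_lin_sum (@aJs_lin _ _ _ a)); last first.
  by move=> j; apply: good_sum => ?; exact: good_scale.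
apply: eq_bigr => j _; rewrite (fun_lin_sum (@aJs_lin _ _ _ a)); last first.
  by move=> l; exact: good_scale.
by apply: eq_bigr => l _; rewrite (fun_lin_scale (@aJs_lin _ _ _ a)).
Qed.

End Model.

Section Scalars.
Variable C : numClosedFieldType.

Lemma gramX_trC n p (B : 'M[C]_(n, p)) k : ((B *m B^t* ) ^+ k)^t* = (B *m B^t* ) ^+ k.
Proof.
set H := B *m B^t*; have HH : H^t* = H by rewrite trC_mul trmxCK.
elim: k => [|k IH]; first by rewrite expr0 trmx1 map_mx1.
by rewrite {1}exprS -[H * _]/(H *m _) trC_mul IH HH -[_ *m H]/(_ * H) -exprSr.
Qed.

Lemma norm_sum_sqr k (z : 'I_k -> C) : `|\sum_q z q| ^+ 2 <= k%:R * \sum_q `|z q| ^+ 2.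
Proof.
have := cauchy_schwarz (const_mx 1 : 'cV[C]_k) (\col_q z q).
have -> : (((const_mx 1 : 'cV[C]_k)^t*) *m \col_q z q) 0 0 = \sum_q z q.
  by rewrite mxE; apply: eq_bigr => q _; rewrite !mxE rmorph1 mul1r.
rewrite -normCK; have -> : vnorm2 (const_mx 1 : 'cV[C]_k) = k%:R.
  rewrite /vnorm2; under eq_bigr do rewrite mxE rmorph1 mulr1.
  by rewrite sumr_const card_ord.
have -> // : vnorm2 (\col_q z q) = \sum_q `|z q| ^+ 2.
by apply: eq_bigr => q _; rewrite mxE normCK.
Qed.

Lemma norm_subX4_le (x y : C) : `|x - y| ^+ 4 <= 8%:R * (`|x| ^+ 4 + `|y| ^+ 4).
Proof.
have le1 : `|x - y| ^+ 2 <= 2 * (`|x| ^+ 2 + `|y| ^+ 2).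
  have := norm_sum_sqr (fun i : 'I_2 => if i == 0 then x else - y).
  by rewrite !big_ord_recl !big_ord0 /= !addr0 normrN.
have -> : `|x - y| ^+ 4 = (`|x - y| ^+ 2) ^+ 2 by rewrite -exprM.
apply: le_trans (_ : (2 * (`|x| ^+ 2 + `|y| ^+ 2)) ^+ 2 <= _).
  by rewrite lerXn2r ?nnegrE ?mulr_ge0 ?addr_ge0 ?exprn_ge0.
rewrite -subr_ge0; have -> : 8%:R * (`|x| ^+ 4 + `|y| ^+ 4) - (2 * (`|x| ^+ 2 + `|y| ^+ 2)) ^+ 2 =
   4%:R * (`|x| ^+ 2 - `|y| ^+ 2) ^+ 2 by ring.
by rewrite mulr_ge0 // real_exprn_even_ge0 // rpredB // ger0_real // exprn_ge0.
Qed.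

End Scalars.

(** * A priori moment bounds and variance of quadratic forms *)

Section Estimates.
Variables (C : numClosedFieldType) (n p : nat) (a : angle C n p) (G : gmat a).
Local Notation A := (gA G).
Local Notation E := (gEx G).
Local Notation star := (gstar G).
Local Notation ev := (gev G).
Local Notation W := (gW G).
Local Notation Ws := (gWs G).
Local Notation X := (gX G).
Local Notation Y := (gY G).
Local Notation d := (gd G).
Local Notation db := (gdb G).
Local Notation v := (av a).
Local Notation ub t := (map_mx Num.conj (au a t)).
Local Notation cm := (cm G).

Definition mom k : C := E (n%:R^-1 *: \tr (X k)).

Lemma mom_ge0 k : 0 <= mom k.
Proof. by apply: gEx_ge0 => o; exact: ismom_ge0 (tr_state o). Qed.

Lemma mom0 : mom 0 = 1.
Proof.
rewrite /mom X0 mxtrace1 -scaler_nat scalerA mulVf ?scale1r ?gEx1 //.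
by rewrite pnatr_eq0 -lt0n (an_gt0 a).
Qed.

Lemma W_dual : gW (dualG G) = Ws.
Proof. by apply/matrixP => i j; rewrite !mxE. Qed.

Lemma Ws_dual : gWs (dualG G) = W.
Proof. by apply/matrixP => i j; rewrite !mxE gstarK. Qed.

Lemma X_dual k : gX (dualG G) k = Y k.
Proof. by rewrite /gX W_dual Ws_dual. Qed.

Lemma bilu_state o t : ismom (fun k => ev o (bil (ub t) (Y k) (ub t))).
Proof.
have := bil_state (G := dualG G) o (av1 (a := dualA a) t).
by congr ismom; apply/funext => k; rewrite X_dual.
Qed.

Lemma J_bilu M : aJ a (fun t => E (bil (ub t) M (ub t))) = E (p%:R^-1 *: \tr M).
Proof. exact: (@J_bil _ _ _ _ (dualG G)). Qed.

Lemma tr_YS k : \tr (Y k.+1) = \tr (X k.+1).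
Proof.
rewrite /gY exprSr -[_ * _]/(_ *m _) mulmxA -[_ *m Ws]WsX -mulmxA mxtrace_mulC.
by rewrite -mulmxA /gX [in RHS]exprSr.
Qed.

(** Cauchy-Schwarz in the form [2 |x y| <= s x^2 + y^2 / s]. The free weight [s] lets a small mean
    square of [F] compensate for a mean square of [H] that is merely bounded. *)
Lemma js_bound F H s : 0 < s -> goodA F -> goodA H ->
  `|aJs a (fun t => E (F t * H t))| * 2 <=
  aB a * (s * aJ a (fun t => E (nrm (F t))) + s^-1 * aJ a (fun t => E (nrm (H t)))).
Proof.
move=> s0 gF gH; pose q t := s * E (nrm (F t)) + s^-1 * E (nrm (H t)).
have gnF := good_E (goodA_nrm gF); have gnH := good_E (goodA_nrm gH).
have gq : good a q by apply: good_add; exact: good_scale.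
have q0 t : 0 <= q t.
  by rewrite addr_ge0 // mulr_ge0 ?E_nrm_ge0 // ?invr_ge0 ltW.
have -> : s * aJ a (fun t => E (nrm (F t))) + s^-1 * aJ a (fun t => E (nrm (H t))) = aJ a q.
  rewrite /q (fun_lin_add (@aJ_lin _ _ _ a)); try exact: good_scale.
  by rewrite !(fun_lin_scale (@aJ_lin _ _ _ a)).
apply: le_trans (aJs_le gq q0); apply: phase_bound => //.
- exact: aJs_lin.
- exact: aJs_ge0.
- exact: aJs_conj.
- by apply: good_E; exact: goodA_mul.
- exact: aJs_ge0.
move=> t w w1; rewrite -EZ -gEx_star -raddfD /q -!EZ -raddfD.
apply: E_le => o; rewrite !rmorphD /= gev_star !gevZ !ev_nrm (rmorphM (ev o)) /=.
apply: le_trans (addC_conj_le _) _; rewrite !normrM w1 mul1r.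
set x := `|ev o (F t)|; set y := `|ev o (H t)|.
rewrite -subr_ge0.
have -> : s * x ^+ 2 + s^-1 * y ^+ 2 - 2 * (x * y) = s^-1 * (s * x - y) ^+ 2.
  by field; rewrite gt_eqF.
rewrite mulr_ge0 ?invr_ge0 ?(ltW s0) // real_exprn_even_ge0 // rpredB //.
  by rewrite rpredM ?normr_real // gtr0_real.
exact: normr_real.
Qed.

Lemma E_tr_cm (A0 : 'M[C]_n) M :
  E (n%:R^-1 *: \tr (cm A0 *m M)) = n%:R^-1 * \tr (A0 *m map_mx E M).
Proof.
rewrite EZ /mxtrace raddf_sum; congr (_ * _); apply: eq_bigr => i _ /=.
rewrite !mxE raddf_sum; apply: eq_bigr => j _ /=.
by rewrite !mxE /= -scalerAl mul1r EZ.
Qed.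

Lemma cm1 m : cm (1%:M : 'M[C]_m) = 1%:M.
Proof. exact: map_mx1. Qed.

(** At each sample and each [t], [ismom_mul] replaces the mixed product of orders [q] and [k - q] by
    two moments of order [k], so the recursion closes without any decoupling. *)
Lemma mom_rec k : mom k.+1 <= aB a * k.+1%:R *
  (aJ a (fun t => E (bil (ub t) (Y k) (ub t))) + mom k).
Proof.
have -> : mom k.+1 = \sum_(q < k.+1) aJs a (fun t =>
    E (bil (ub t) (Y q) (ub t) * bil (v t) (X (k - q)) (v t))).
  have := E_tr_cm 1%:M (X k.+1); rewrite cm1 !mul1mx => e.
  rewrite /mom e E_X_rec raddf_sum mulr_sumr; apply: eq_bigr => q _ /=.
  have := trace_form 1%:M (Y q) (X (k - q)).
  by rewrite E_tr_cm mul1mx cm1 mulmx1.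
pose h t : C := E (bil (ub t) (Y k) (ub t)) + E (bil (v t) (X k) (v t)).
have gh : good a h by apply: good_add; apply: good_E; [exact: goodA_bilu|exact: goodA_bilv].
have h0 t : 0 <= h t.
  rewrite addr_ge0 // gEx_ge0 // => o.
    exact: ismom_ge0 (bilu_state o t).
  exact: ismom_ge0 (bil_state o (av1 t)).
have -> : aB a * k.+1%:R * (aJ a (fun t => E (bil (ub t) (Y k) (ub t))) + mom k) =
   \sum_(q < k.+1) aB a * aJ a h.
  rewrite sumr_const card_ord mulrAC -[RHS]mulr_natr; congr (_ * _); rewrite /h.
  rewrite (fun_lin_add (@aJ_lin _ _ _ a)) ?J_bil //; apply: good_E.
    exact: goodA_bilu.
  exact: goodA_bilv.
apply: ler_sum => q _; apply: le_trans (aJs_le gh h0).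
apply: aJs_le' => // [|t].
  by apply: good_E; apply: goodA_mul; [exact: goodA_bilu|exact: goodA_bilv].
rewrite /h -raddfD; apply: E_le => o; rewrite rmorphM rmorphD /=.
have := ismom_mul q (k - q) (bilu_state o t) (bil_state (G := G) o (av1 t)).
by rewrite subnKC // -ltnS.
Qed.

(** A crude bound, of factorial growth in [k]; what matters is that it depends on the model through
    [b] and [r] only. *)
Fixpoint mbnd (b r : C) k : C :=
  if k is k'.+1 then b * k%:R * ((2 + r) * mbnd b r k') else 1.

Lemma mbnd_ge0 b r k : 0 <= b -> 0 <= r -> 0 <= mbnd b r k.
Proof.
by move=> b0 r0; elim: k => [|k IH] //=; rewrite !mulr_ge0 // addr_ge0.
Qed.

Lemma mom_bound b r k : aB a <= b -> n%:R / p%:R <= r -> mom k <= mbnd b r k.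
Proof.
move=> hb hr; have b0 : 0 <= b by apply: le_trans hb; exact: aB_ge0.
have r0 : 0 <= r by apply: le_trans hr; rewrite divr_ge0.
elim: k => [|k IH]; first by rewrite mom0.
apply: le_trans (mom_rec k) _ => /=.
have J0 : 0 <= aJ a (fun t => E (bil (ub t) (Y k) (ub t))).
  rewrite J_bilu; apply: gEx_ge0 => o.
  have := ismom_ge0 k (tr_state (G := dualG G) o); by rewrite X_dual.
apply: ler_pM; rewrite ?mulr_ge0 ?aB_ge0 ?addr_ge0 ?mom_ge0 ?ler_wpM2r //.
apply: le_trans (_ : (2 + r) * mom k <= _); last by rewrite ler_wpM2l ?addr_ge0.
(* At order 0 the average is 1; at positive orders the traces of [Y] and [X] agree and it equals
   [n/p] times [mom]. The factor [2 + r] covers both cases. *)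
rewrite J_bilu; case: k {IH J0} => [|k].
  rewrite mom0 mulr1 {1}/gY expr0 mxtrace1 -scaler_nat scalerA mulVf; last first.
    by rewrite pnatr_eq0 -lt0n (ap_gt0 a).
  by rewrite scale1r gEx1 -[X in X <= _]addr0 lerD2l.
rewrite tr_YS; have -> : E (p%:R^-1 *: \tr (X k.+1)) = n%:R / p%:R * mom k.+1.
  rewrite /mom !EZ mulrA; congr (_ * _).
  by rewrite mulrAC mulfV ?mul1r // pnatr_eq0 -lt0n (an_gt0 a).
rewrite mulrDl addrC lerD // ?ler_wpM2r ?mom_ge0 //.
by rewrite -{1}[mom _]mul1r ler_wpM2r ?mom_ge0 // ler1n.
Qed.

Let ev_row o (x : 'cV[C]_n) q i : ev o ((cm (x^t* ) *m X q) 0 i) =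
  (x^t* *m (map_mx (ev o) W *m (map_mx (ev o) W)^t* ) ^+ q) 0 i.
Proof. by rewrite -evX -{2}(ev_cm (G := G) o (x^t* )) -map_mxM [RHS]mxE. Qed.

Let row_norm m (y : 'rV[C]_m) : \sum_i `|y 0 i| ^+ 2 = (y *m y^t* ) 0 0.
Proof. by rewrite mxE; apply: eq_bigr => i _; rewrite !mxE normCK. Qed.

Let col_norm m (y : 'cV[C]_m) : \sum_i `|y i 0| ^+ 2 = (y^t* *m y) 0 0.
Proof. by rewrite -vnorm2E; apply: eq_bigr => i _; rewrite normCK. Qed.

(** The gradient is a sum of [k + 1] rank one matrices. The squared Frobenius norm of each is a
    product of two moments of the state at [x], of total order [2 k + 1], hence at most [2 s_(2k+1)]
    by [ismom_mul]. The sum costs [(k + 1)^2], and the two families of derivatives double the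
    result. *)
Lemma var_bil (x : 'cV[C]_n) k : vnorm2 x = 1 ->
  E (nrm (bil x (X k.+1) x)) - E (bil x (X k.+1) x) * (E (bil x (X k.+1) x))^* <=
  gkap G * (4%:R * k.+1%:R ^+ 2 * E (bil x (X (k + k.+1)) x)).
Proof.
move=> x1; apply: le_trans (gpoinc _) _; apply: ler_wpM2l (gkap_ge0 G) _ _ _.
rewrite -EZ; apply: E_le => o; rewrite gevZ.
set s := fun k => ev o (bil x (X k) x).
have sm : ismom s by exact: bil_state.
pose Wo := map_mx (ev o) W; pose H := Wo *m Wo^t*.
have sE q : s q = (x^t* *m H ^+ q *m x) 0 0 by rewrite /s ev_bil evX.
have key (m r : nat) (P : 'I_k.+1 -> 'I_m -> C) (Q : 'I_k.+1 -> 'I_r -> C) :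
    (forall q : 'I_k.+1, (\sum_i `|P q i| ^+ 2) * (\sum_j `|Q q j| ^+ 2) <= 2 * s (k + k.+1)%N) ->
    \sum_i \sum_j `|\sum_q P q i * Q q j| ^+ 2 <= 2 * k.+1%:R ^+ 2 * s (k + k.+1)%N.
  move=> h; apply: le_trans (_ : \sum_i \sum_j k.+1%:R * \sum_q `|P q i * Q q j| ^+ 2 <= _).
    by apply: ler_sum => i _; apply: ler_sum => j _; exact: norm_sum_sqr.
  have -> : \sum_i \sum_j k.+1%:R * \sum_q `|P q i * Q q j| ^+ 2 =
     k.+1%:R * \sum_q (\sum_i `|P q i| ^+ 2) * (\sum_j `|Q q j| ^+ 2).
    under eq_bigr do rewrite -mulr_sumr exchange_big.
    rewrite -mulr_sumr exchange_big; congr (_ * _); apply: eq_bigr => q _.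
    rewrite mulr_suml; apply: eq_bigr => i _; rewrite mulr_sumr.
    by apply: eq_bigr => j _; rewrite normrM exprMn.
  rewrite expr2 -mulrA mulrCA -!mulrA ler_wpM2l //.
  apply: le_trans (ler_sum _ (fun q _ => h q)) _.
  by rewrite sumr_const card_ord -[leLHS]mulr_natl.
have dE i j : ev o (d i j (bil x (X k.+1) x)) = \sum_(q < k.+1)
    (x^t* *m H ^+ q) 0 i * (Wo^t* *m (H ^+ (k - q) *m x)) j 0.
  have -> : d i j (bil x (X k.+1) x) = (map_mx (d i j) (cm (x^t* ) *m X k.+1 *m cm x)) 0 0.
    by rewrite [RHS]mxE.
  rewrite !(map_derivM (@gdM _ _ _ _ G i j)) !(map_deriv_cst (@gdM _ _ _ _ G i j)).
  rewrite mul0mx add0r mulmx0 addr0 d_X mulmx_sumr mulmx_suml summxE rmorph_sum.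
  apply: eq_bigr => q _; rewrite subSS !mulmxA -(mulmxA _ Ws) -(mulmxA _ (_ *m _) (cm x)).
  rewrite mul_delta_mx_entry rmorphM /= ev_row; congr (_ * _).
  by rewrite -[in RHS](ev_cm (G := G) o x) /H -evX -evW -!map_mxM [RHS]mxE.
have dbE i j : ev o (db i j (bil x (X k.+1) x)) = \sum_(q < k.+1)
    (H ^+ (k - q) *m x) i 0 * (x^t* *m H ^+ q *m Wo) 0 j.
  have -> : db i j (bil x (X k.+1) x) = (map_mx (db i j) (cm (x^t* ) *m X k.+1 *m cm x)) 0 0.
    by rewrite [RHS]mxE.
  rewrite !(map_derivM (@gdbM _ _ _ _ G i j)) !(map_deriv_cst (@gdbM _ _ _ _ G i j)).
  rewrite mul0mx add0r mulmx0 addr0 db_X mulmx_sumr mulmx_suml summxE rmorph_sum.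
  apply: eq_bigr => q _; rewrite subSS !mulmxA -(mulmxA _ (X _) (cm x)).
  rewrite mul_delta_mx_entry rmorphM /= mulrC; congr (_ * _).
    by rewrite -[in RHS](ev_cm (G := G) o x) /H -evX -!map_mxM [RHS]mxE.
  by rewrite -[in RHS](ev_cm (G := G) o (x^t* )) /H -evX -!map_mxM [RHS]mxE.
rewrite rmorph_sum; under eq_bigr do rewrite rmorph_sum.
rewrite /=; under eq_bigr do under eq_bigr do rewrite rmorphD /= !ev_nrm dE dbE.
under eq_bigr do rewrite big_split; rewrite big_split /=.
have -> : 4%:R * k.+1%:R ^+ 2 * ev o (bil x (X (k + k.+1)) x) =
   2 * k.+1%:R ^+ 2 * s (k + k.+1)%N + 2 * k.+1%:R ^+ 2 * s (k + k.+1)%N.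
  by rewrite /s; ring.
have Hh q : (H ^+ q)^t* = H ^+ q by exact: gramX_trC.
have n1 q : \sum_i `|(x^t* *m H ^+ q) 0 i| ^+ 2 = s (q + q)%N.
  by rewrite row_norm trC_mul Hh trmxCK sE exprD !mulmxA.
have n2 q : \sum_j `|(Wo^t* *m (H ^+ q *m x)) j 0| ^+ 2 = s (q + q).+1.
  by rewrite col_norm !trC_mul Hh trmxCK sE -addSn exprD exprSr -!mulmxA.
have n3 q : \sum_i `|(H ^+ q *m x) i 0| ^+ 2 = s (q + q)%N.
  by rewrite col_norm trC_mul Hh sE exprD !mulmxA.
have n4 q : \sum_j `|(x^t* *m H ^+ q *m Wo) 0 j| ^+ 2 = s (q + q).+1.
  by rewrite row_norm !trC_mul Hh trmxCK sE -addSn exprD exprSr -!mulmxA.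
have idx (q : 'I_k.+1) : ((q + q) + ((k - q) + (k - q)).+1 = k + k.+1)%N.
  have := ltn_ord q; rewrite ltnS => qk; rewrite addnS addnACA subnKC //.
  by rewrite addnS.
have idx' (q : 'I_k.+1) : ((k - q) + (k - q) + (q + q).+1 = k + k.+1)%N.
  have := ltn_ord q; rewrite ltnS => qk; rewrite addnS addnACA subnK //.
  by rewrite addnS.
apply: lerD; apply: key => q; rewrite ?n1 ?n2 ?n3 ?n4.
  apply: le_trans (ismom_mul _ _ sm sm) _.
  by rewrite idx mulr_natl mulr2n.
apply: le_trans (ismom_mul _ _ sm sm) _.
by rewrite idx' mulr_natl mulr2n.
Qed.

End Estimates.

(** * Comparison with the limit recursion *)

Section Comparison.
Variables (C : numClosedFieldType) (n p : nat) (a : angle C n p) (G : gmat a).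
Variables (T : nat -> 'M[C]_n) (Tt : nat -> 'M[C]_p).
Local Notation A := (gA G).
Local Notation E := (gEx G).
Local Notation star := (gstar G).
Local Notation ev := (gev G).
Local Notation X := (gX G).
Local Notation Y := (gY G).
Local Notation v := (av a).
Local Notation ub t := (map_mx Num.conj (au a t)).
Local Notation cm := (cm G).
Local Notation mom := (mom G).

Definition SopC (D : 'M[C]_p) : 'M[C]_n :=
  quant (aJs a) (fun t => ((ub t)^t* *m D *m ub t) 0 0).

Lemma good_uform (D : 'M[C]_p) : good a (fun t => ((ub t)^t* *m D *m ub t) 0 0).
Proof.
rewrite (_ : (fun t => _) = fun t => E (bil (ub t) (cm D) (ub t))).
  by apply: good_E; exact: goodA_bilu.
by apply/funext => t; rewrite bil_cm EZ gEx1 mulr1.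
Qed.

Lemma Sop_cm (D : 'M[C]_p) : Sop (cm D) = cm (SopC D).
Proof.
apply/matrixP => i k; rewrite !mxE /=.
transitivity ((\sum_j \sum_l Gam a i j k l * D j l)%:A : A).
  rewrite scaler_suml; apply: eq_bigr => j _; rewrite scaler_suml.
  by apply: eq_bigr => l _; rewrite mxE scalerA.
congr (_ *: _); have gg j l := good_Gam a i j k l.
rewrite (_ : (fun t => _) = fun t => \sum_j \sum_l D j l *
    (v t i 0 * au a t j 0 * (v t k 0 * au a t l 0)^*)); last first.
  apply/funext => t; rewrite mxE mulr_suml exchange_big; apply: eq_bigr => l _.
  rewrite mxE !mulr_suml; apply: eq_bigr => j _.
  by rewrite !mxE rmorphM /= conjCK; ring.
rewrite (fun_lin_sum (@aJs_lin _ _ _ a)); last first.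
  by move=> j; apply: good_sum => ?; exact: good_scale.
rewrite mulr_sumr; apply: eq_bigr => j _.
rewrite (fun_lin_sum (@aJs_lin _ _ _ a)); last by move=> l; exact: good_scale.
rewrite mulr_sumr; apply: eq_bigr => l _.
by rewrite (fun_lin_scale (@aJs_lin _ _ _ a)) // mulrCA mulrC.
Qed.

Lemma SopB P Q : Sop (P - Q) = Sop P - Sop Q :> 'M[A]_n.
Proof.
apply/matrixP => i k; rewrite !mxE -sumrB; apply: eq_bigr => j _.
by rewrite -sumrB; apply: eq_bigr => l _; rewrite !mxE scalerBr.
Qed.

Lemma SopC_opb (D : 'M[C]_p) t : 0 < aB a -> 0 < t -> opb D t -> opb (SopC D) (t * aB a).
Proof.
move=> B0 t0 hD; apply: quant_opb_gen.
- exact: ltW.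
- exact: mulr_gt0.
- exact: aJs_lin.
- by move=> f gf f0; rewrite aJs_ge0 //= aJs_le.
- exact: aJs_conj.
- exact: good_uform.
move=> s; apply: le_trans (opb_form t0 hD _ _) _.
by rewrite !(av1 (a := dualA a)) -mulrA mulfV ?mulr1 // (_ : 1 + 1 = 2) ?pnatr_eq0.
Qed.

Lemma J1 : aJ a (fun=> 1) = 1.
Proof.
transitivity (aJ a (fun t => \sum_i v t i 0 * (v t i 0)^*)).
  by congr (aJ a _); apply/funext => t; rewrite -/(vnorm2 (v t)) av1.
rewrite (fun_lin_sum (@aJ_lin _ _ _ a)); last first.
  by move=> i; apply: good_mul; [exact: good_av|apply: good_conj; exact: good_av].
under eq_bigr do rewrite aJ_vv eqxx mulr1n div1r.
by rewrite sumr_const card_ord -[LHS]mulr_natl mulfV // pnatr_eq0 -lt0n (an_gt0 a).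
Qed.

Hypothesis T0 : T 0 = 1%:M.
Hypothesis T_rec : forall k, T k.+1 = \sum_(q < k.+1) SopC (Tt q) *m T (k - q).

Definition Delta k := map_mx E (X k) - T k.

(** By duality with the operator norm: the trace norm of [Delta k], divided by [n], is at most
    [e]. *)
Definition testb k e := forall (A0 : 'M[C]_n) c, 0 < c -> opb A0 c ->
  `|n%:R^-1 * \tr (A0 *m Delta k)| <= c * e.

Definition dist k := aJ a (fun t => E (nrm (bil (v t) (X k - cm (T k)) (v t)))).
Definition distd k := aJ a (fun t => E (nrm (bil (ub t) (Y k - cm (Tt k)) (ub t)))).

Lemma testb0 : testb 0 0.
Proof.
move=> A0 c _ _; rewrite /Delta T0 X0 (_ : map_mx E 1%:M = 1%:M) ?subrr.
  by rewrite mulmx0 mxtrace0 !mulr0 normr0.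
by apply/matrixP => i j; rewrite !mxE; case: (i == j); rewrite ?raddf0 //= gEx1.
Qed.

Lemma dist0 : dist 0 = 0.
Proof.
rewrite /dist T0 X0 cm1 subrr -[RHS](fun_lin0 (@aJ_lin _ _ _ a)); congr (aJ a _).
by apply/funext => t; rewrite bilE big1 ?/nrm ?mul0r ?raddf0 // => i _;
   rewrite big1 // => j _; rewrite mxE scaler0.
Qed.

Let Deltastep k (A0 : 'M[C]_n) :
  n%:R^-1 * \tr (A0 *m Delta k.+1) = \sum_(q < k.+1)
    (E (n%:R^-1 *: \tr (cm A0 *m (Sop (Y q - cm (Tt q)) *m X (k - q)))) +
     n%:R^-1 * \tr ((A0 *m SopC (Tt q)) *m Delta (k - q))).
Proof.
rewrite /Delta E_X_rec T_rec -sumrB mulmx_sumr raddf_sum mulr_sumr.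
apply: eq_bigr => q _; rewrite E_tr_cm -mulrDr -raddfD /=; congr (_ * \tr _).
rewrite -mulmxA -mulmxDr; congr (_ *m _).
have Ecm (M : 'M[A]_n) D : map_mx E (cm D *m M) = D *m map_mx E M.
  apply/matrixP => i j; rewrite !mxE raddf_sum; apply: eq_bigr => l _ /=.
  by rewrite !mxE /= -scalerAl mul1r EZ.
rewrite SopB Sop_cm mulmxBl map_mxB Ecm mulmxBr addrA subrK //.
Qed.

(* [S(Y_q) X - S(Tt_q) T = S(Y_q - Tt_q) X + S(Tt_q) (X - T)], and the first term
   only involves the quadratic forms of [Y_q - Tt_q] measured by [distd]. *)
Lemma testb_step k (eps tau mu dl : nat -> C) s : 0 < s -> 0 < aB a ->
  (forall q, (q <= k)%N -> testb q (eps q)) ->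
  (forall q, (q <= k)%N -> 0 < tau q /\ opb (Tt q) (tau q)) ->
  (forall q, (q <= k)%N -> mom (q + q) <= mu q) ->
  (forall q, (q <= k)%N -> distd q <= dl q) ->
  testb k.+1 (\sum_(q < k.+1) (aB a * (s * dl q + s^-1 * mu (k - q)%N) +
                               aB a * tau q * eps (k - q)%N)).
Proof.
move=> s0 B0 heps htau hmu hdl A0 c c0 hA; rewrite Deltastep.
apply: le_trans (ler_norm_sum _ _ _) _; rewrite mulr_sumr; apply: ler_sum => q _.
have qk : (q <= k)%N by rewrite -ltnS.
apply: le_trans (ler_normD _ _) _; rewrite mulrDr lerD //; last first.
  have [t0 ht] := htau q qk.
  have := heps (k - q)%N (leq_subr _ _) _ _ _ (opbM (ltW c0) hA (SopC_opb B0 t0 ht)).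
  rewrite mulr_gt0 ?mulr_gt0 // => /(_ isT).
  by rewrite (_ : c * (tau q * aB a) * _ = c * (aB a * tau q * eps (k - q)%N)) //; ring.
rewrite trace_form.
set F := fun t => bil (ub t) (Y q - cm (Tt q)) (ub t).
set H := fun t => bil (v t) (X (k - q) *m cm A0) (v t).
have gF : goodA F by exact: goodA_bilu.
have gH : goodA H by exact: goodA_bilv.
(* The weight [c s] makes both terms homogeneous of degree 1 in [c]: [(c s) dl + (c s)^-1 c^2 mu = c
   (s dl + s^-1 mu)]. *)
have s1 : 0 < c * s by exact: mulr_gt0.
have := js_bound s1 gF gH.
set z := aJs a _ => hz.
have nJH : aJ a (fun t => E (nrm (H t))) <= c ^+ 2 * mu (k - q)%N.
  apply: le_trans (_ : aJ a (fun t => c ^+ 2 * E (bil (v t) (X ((k - q) + (k - q))) (v t))) <= _).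
    apply: aJ_le; first by apply: good_E; exact: goodA_nrm.
      by apply: good_scale; apply: good_E; exact: goodA_bilv.
    move=> t; rewrite -EZ; apply: E_le => o; rewrite ev_nrm gevZ normCK.
    rewrite /H !ev_bil map_mxM ev_cm -mulmxA -(mulmxA (map_mx _ _)).
    set Q := map_mx (ev o) (X (k - q)).
    have QH : Q^t* = Q by rewrite /Q evX gramX_trC.
    have -> : ((v t)^t* *m (Q *m (A0 *m v t))) = (Q *m v t)^t* *m (A0 *m v t).
      by rewrite trC_mul QH !mulmxA.
    apply: le_trans (cauchy_schwarz _ _) _.
    have -> : ((v t)^t* *m map_mx (ev o) (X ((k - q) + (k - q))) *m v t) 0 0 =
        vnorm2 (Q *m v t).
      by rewrite vnorm2E trC_mul QH XD map_mxM !mulmxA.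
    rewrite mulrC ler_wpM2r ?vnorm2_ge0 //; apply: le_trans (hA _) _.
    by rewrite av1 mulr1.
  rewrite (fun_lin_scale (@aJ_lin _ _ _ a)); last by apply: good_E; exact: goodA_bilv.
  by rewrite J_bil ler_wpM2l ?exprn_ge0 ?(ltW c0) // hmu // leq_subr.
have mu0 : 0 <= mu (k - q)%N by apply: le_trans (mom_ge0 _ _) (hmu _ (leq_subr _ _)).
have nJF : aJ a (fun t => E (nrm (F t))) <= dl q by exact: hdl.
have dl0 : 0 <= dl q.
  apply: le_trans nJF; apply: aJ_ge0 => [|t]; last exact: E_nrm_ge0.
  by apply: good_E; exact: goodA_nrm.
apply: le_trans (_ : `|z| * 2 <= _).
  by rewrite mulr_natr mulr2n lerDl.
apply: le_trans hz _; rewrite mulrCA ler_wpM2l ?(ltW B0) //.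
rewrite mulrDr lerD //; first by rewrite mulrA ler_wpM2l // ltW.
apply: le_trans (ler_wpM2l _ nJH) _; first by rewrite invr_ge0 ltW.
rewrite le_eqVlt; apply/orP; left; apply/eqP; field.
by rewrite !gt_eqF.
Qed.

(* The variance of the quadratic form is bounded by the Poincare inequality. Its
   bias [g] is tested against the quantization of [conj g / (1 + |g|^2)], a matrix
   of norm at most 1, as [|g|^2 <= (1 + K) |g|^2 / (1 + |g|^2) + |g|^4 / K]. *)
Lemma dist_step k e tau K : 0 < K -> testb k.+1 e -> 0 < tau -> opb (T k.+1) tau ->
  dist k.+1 <= gkap G * (4%:R * k.+1%:R ^+ 2 * mom (k + k.+1)) +
   ((1 + K) * e + K^-1 * (64%:R * mom (4 * k.+1) + 8%:R * tau ^+ 4)).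
Proof.
move=> K0 he t0 hT.
pose xi t := bil (v t) (X k.+1) (v t).
pose tt t := ((v t)^t* *m T k.+1 *m v t) 0 0.
pose g t := E (xi t) - tt t.
have gxi : goodA xi by exact: goodA_bilv.
have gtt : good a tt.
  rewrite (_ : tt = fun t => E (bil (v t) (cm (T k.+1)) (v t))).
    by apply: good_E; exact: goodA_bilv.
  by apply/funext => t; rewrite bil_cm EZ gEx1 mulr1.
have gg : good a g by apply: good_sub => //; exact: good_E.
have gE t : g t = ((v t)^t* *m Delta k.+1 *m v t) 0 0.
  rewrite /g /xi E_bil /tt /Delta mulmxBr mulmxBl [RHS]mxE; congr (_ + _).
  by rewrite [RHS]mxE.
(* Mean square error as variance plus squared bias. *)
have e1 t : E (nrm (bil (v t) (X k.+1 - cm (T k.+1)) (v t))) =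
   (E (nrm (xi t)) - E (xi t) * (E (xi t))^*) + `|g t| ^+ 2.
  rewrite bilB bil_cm -/(tt t) -/(xi t) normCK /g /nrm.
  rewrite !rmorphB /= gstarZ rmorph1 mulrBl !mulrBr !raddfB /=.
  by rewrite -!scalerAl -!scalerAr mul1r !mulr1 !EZ gEx_star gEx1; ring.
have gng : good a (fun t => `|g t| ^+ 2).
  rewrite (_ : (fun t => _) = fun t => g t * (g t)^*).
    by apply: good_mul => //; exact: good_conj.
  by apply/funext => t; rewrite normCK.
have gng4 : good a (fun t => `|g t| ^+ 4).
  rewrite (_ : (fun t => _) = fun t => `|g t| ^+ 2 * `|g t| ^+ 2); first exact: good_mul.
  by apply/funext => t; rewrite -exprD.
have gX q : good a (fun t => E (bil (v t) (X q) (v t))) by apply: good_E; exact: goodA_bilv.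
apply: le_trans (_ : aJ a (fun t => gkap G * (4%:R * k.+1%:R ^+ 2 *
     E (bil (v t) (X (k + k.+1)) (v t))) + `|g t| ^+ 2) <= _).
  apply: aJ_le.
  - by apply: good_E; apply: goodA_nrm; exact: goodA_bilv.
  - by apply: good_add => //; apply: good_scale; exact: good_scale.
  - by move=> t; rewrite e1 lerD2r; apply: var_bil; exact: av1.
rewrite (fun_lin_add (@aJ_lin _ _ _ a)) //; last by apply: good_scale; exact: good_scale.
rewrite (fun_lin_scale (@aJ_lin _ _ _ a)); last exact: good_scale.
rewrite (fun_lin_scale (@aJ_lin _ _ _ a)) // J_bil lerD2l.
pose phi t := (g t)^* * (1 + g t * (g t)^*)^-1.
have gphi : good a phi by apply: good_mul; [exact: good_conj|exact: good_inv].
pose r t := `|g t| ^+ 2 * (1 + `|g t| ^+ 2)^-1.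
have rE : r = fun t => phi t * ((v t)^t* *m Delta k.+1 *m v t) 0 0.
  by apply/funext => t; rewrite -gE /phi /r normCK; ring.
have gr : good a r by rewrite rE; apply: good_mul => //; rewrite (_ : (fun t => _) = g) //; apply/funext => t; rewrite -gE.
have p1 t : 0 < 1 + `|g t| ^+ 2 by rewrite ltr_pwDl ?exprn_ge0.
have Jr : aJ a r <= e.
  have ob : opb (quant (aJ a) phi) (1 * 1).
    apply: quant_opb_gen; rewrite ?mulr1 //.
    - exact: aJ_lin.
    - by move=> f gf f0; rewrite aJ_ge0 //= mul1r.
    (* That [aJ] commutes with conjugation follows from its positivity: a real [f1] is the
       difference of the nonnegative good functions [f1 + (1 + f1^2)] and [1 + f1^2], and a general
       [f] is treated through its real and imaginary parts. *)
    - move=> f gf; have R0 f1 : good a f1 -> (forall t, f1 t = (f1 t)^*) -> (aJ a f1)^* = aJ a f1.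
        move=> gf1 re; apply/CrealP.
        have re1 t : f1 t \is Num.real by apply/CrealP.
        have g1 : good a (fun t => 1 + f1 t * (f1 t)^*).
          by apply: good_add; [exact: good_cst|apply: good_mul => //; exact: good_conj].
        have -> : aJ a f1 = aJ a (fun t => f1 t + (1 + f1 t * (f1 t)^*)) - aJ a (fun t => 1 + f1 t * (f1 t)^*).
          by rewrite (fun_lin_add (@aJ_lin _ _ _ a)) // addrK.
        apply: rpredB; apply: ger0_real; apply: aJ_ge0 => //.
        - exact: good_add.
        - move=> t; rewrite -re; have -> : f1 t + (1 + f1 t * f1 t) = (f1 t + 2^-1) ^+ 2 + 3%:R / 4%:R by field.
          by rewrite addr_ge0 ?divr_ge0 // real_exprn_even_ge0 // rpredD // rpredV realn.
        - by move=> t; rewrite addr_ge0 // mul_conjC_ge0.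
      pose f1 t := f t + (f t)^*; pose f2 t := 'i * (f t - (f t)^*).
      have gfc := good_conj gf.
      have gf1 : good a f1 by exact: good_add.
      have gf2 : good a f2 by apply: good_scale; exact: good_sub.
      have h1 := R0 f1 gf1 (fun t => ltac:(by rewrite /f1 rmorphD /= conjCK addrC)).
      have h2 : (aJ a f2)^* = aJ a f2.
        apply: R0 => // t; rewrite /f2 rmorphM rmorphB /= conjCK conjCi; ring.
      move: h1 h2; rewrite (fun_lin_add (@aJ_lin _ _ _ a)) // /f2.
      rewrite (fun_lin_scale (@aJ_lin _ _ _ a)); last exact: good_sub.
      rewrite (fun_lin_sub (@aJ_lin _ _ _ a)) // rmorphD rmorphM rmorphB /= conjCi.
      set x := aJ a f; set y := aJ a _ => h1 h2.
      have h3 : x^* - y^* = y - x.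
        have i0 : 'i != 0 :> C by exact: neq0Ci.
        by apply: (mulfI i0); rewrite -[LHS]opprK -mulNr h2; ring.
      have : y *+ 2 = x^* *+ 2.
        have -> : y *+ 2 = (x + y) + (y - x) by rewrite mulr2n; ring.
        by rewrite -h1 -h3 mulr2n; ring.
      by move/eqP; rewrite eqrMn2r //= => /eqP.
    - move=> t; rewrite /phi normrM norm_conjC -normCK normfV.
      rewrite [`|1 + _|]gtr0_norm // ler_pdivrMr // mul1r.
      rewrite -subr_ge0 (_ : _ - _ = (`|g t| - 2^-1) ^+ 2 + 3%:R / 4%:R); last by field.
      by rewrite addr_ge0 ?divr_ge0 // real_exprn_even_ge0 // rpredB ?normr_real // rpredV realn.
  have := he _ _ _ ob; rewrite mulr1 ltr01 => /(_ isT); rewrite quant_tr // -rE mul1r.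
  by rewrite ger0_norm // aJ_ge0 // => t; rewrite mulr_ge0 ?exprn_ge0 // invr_ge0 ltW.
apply: le_trans (_ : aJ a (fun t => (1 + K) * r t + K^-1 * `|g t| ^+ 4) <= _).
  apply: aJ_le => //; first by apply: good_add; exact: good_scale.
  move=> t; rewrite /r; have -> : `|g t| ^+ 4 = (`|g t| ^+ 2) ^+ 2 by rewrite -exprM.
  have := p1 t; have := exprn_ge0 2 (normr_ge0 (g t)); set q := `|g t| ^+ 2 => q0 q1.
  rewrite -subr_ge0; have -> : (1 + K) * (q / (1 + q)) + K^-1 * q ^+ 2 - q =
     q * (((K - q) ^+ 2 + q ^+ 2 + q + q + K ^+ 2) / 2) / (K * (1 + q)) by field; rewrite !gt_eqF.
  have sq0 : 0 <= (K - q) ^+ 2.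
    by apply: real_exprn_even_ge0 => //; apply: rpredB; [exact: gtr0_real|exact: ger0_real].
  have num0 : 0 <= (K - q) ^+ 2 + q ^+ 2 + q + q + K ^+ 2.
    have K2 : 0 <= K ^+ 2 by rewrite exprn_ge0 // ltW.
    have q2 : 0 <= q ^+ 2 by rewrite exprn_ge0.
    exact: (addr_ge0 (addr_ge0 (addr_ge0 (addr_ge0 sq0 q2) q0) q0) K2).
  by rewrite divr_ge0 ?mulr_ge0 ?invr_ge0 ?(ltW K0) ?(ltW q1).
rewrite (fun_lin_add (@aJ_lin _ _ _ a)); try exact: good_scale.
rewrite !(fun_lin_scale (@aJ_lin _ _ _ a)) //.
apply: lerD; first by rewrite ler_wpM2l // addr_ge0 // ltW.
rewrite ler_wpM2l ?invr_ge0 ?(ltW K0) //.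
(* The constant is [8 * 8]: [|x - y|^4 <= 8 (|x|^4 + |y|^4)], and two uses of [ismom_sqr] give
   [(E xi)^4 <= 4 * 2] times the expected form of order [4 (k + 1)]. *)
apply: le_trans (_ : aJ a (fun t => 64%:R * E (bil (v t) (X (4 * k.+1)) (v t)) + 8%:R * tau ^+ 4) <= _).
  apply: aJ_le => //; first by apply: good_add; [exact: good_scale|exact: good_cst].
  move=> t; apply: le_trans (norm_subX4_le _ _) _.
  have -> : 64%:R * E (bil (v t) (X (4 * k.+1)) (v t)) + 8%:R * tau ^+ 4 =
     8%:R * (8%:R * E (bil (v t) (X (4 * k.+1)) (v t)) + tau ^+ 4) by ring.
  rewrite ler_wpM2l // lerD //.
    have sm o := bil_state (G := G) o (av1 t).
    have Ece h : E h * (E h)^* <= E (nrm h).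
      have := E_nrm_ge0 (h - (E h)%:A); rewrite /nrm rmorphB /= gstarZ rmorph1.
      rewrite mulrBl !mulrBr !raddfB /= -!scalerAl -!scalerAr mul1r !mulr1 !EZ gEx_star gEx1.
      by move=> hh; rewrite -subr_ge0; apply: le_trans hh _; rewrite le_eqVlt; apply/orP; left; apply/eqP; ring.
    have pos q : 0 <= E (bil (v t) (X q) (v t)).
      by apply: gEx_ge0 => o; exact: (ismom_ge0 q (sm o)).
    have sq q : E (bil (v t) (X q) (v t)) ^+ 2 <= 2 * E (bil (v t) (X (q + q)) (v t)).
      apply: le_trans (_ : E (nrm (bil (v t) (X q) (v t))) <= _).
        by apply: le_trans (Ece _); rewrite expr2 (CrealP (ger0_real (pos q))).
      rewrite -EZ; apply: E_le => o; rewrite ev_nrm gevZ.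
      by rewrite ger0_norm ?(ismom_ge0 _ (sm o)) //; exact: (ismom_sqr _ (sm o)).
    rewrite ger0_norm ?pos //.
    have -> : E (xi t) ^+ 4 = (E (xi t) ^+ 2) ^+ 2 by rewrite -exprM.
    apply: le_trans (_ : (2 * E (bil (v t) (X (k.+1 + k.+1)) (v t))) ^+ 2 <= _).
      by rewrite lerXn2r ?nnegrE ?exprn_ge0 ?mulr_ge0 ?pos //; exact: sq.
    rewrite exprMn; have -> : (4 * k.+1 = (k.+1 + k.+1) + (k.+1 + k.+1))%N by lia.
    have -> : 8%:R = 2 ^+ 2 * 2 :> C by ring.
    by rewrite -[leRHS]mulrA ler_wpM2l ?exprn_ge0 //; exact: sq.
  rewrite lerXn2r ?nnegrE ?(ltW t0) //.
  apply: le_trans (opb_form t0 hT _ _) _.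
  by rewrite !av1 -mulrA mulfV ?mulr1 // (_ : 1 + 1 = 2) ?pnatr_eq0.
rewrite (fun_lin_add (@aJ_lin _ _ _ a)) //; [|exact: good_scale|exact: good_cst].
rewrite (fun_lin_scale (@aJ_lin _ _ _ a)) // J_bil.
rewrite (_ : (fun _ : aT a => 8%:R * tau ^+ 4) = fun t => 8%:R * tau ^+ 4 * (fun=> 1) t).
  by rewrite (fun_lin_scale (@aJ_lin _ _ _ a)) ?J1 ?mulr1 //; exact: good_cst.
by apply/funext => t; rewrite mulr1.
Qed.

End Comparison.

(** * Fourth central moment of the normalized traces *)

Section FourthMoment.
Variables (C : numClosedFieldType) (n p : nat) (a : angle C n p) (G : gmat a).
Local Notation A := (gA G).
Local Notation E := (gEx G).
Local Notation star := (gstar G).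
Local Notation ev := (gev G).
Local Notation W := (gW G).
Local Notation Ws := (gWs G).
Local Notation X := (gX G).
Local Notation d := (gd G).
Local Notation db := (gdb G).

Definition trX k : A := n%:R^-1 *: \tr (X k).

Let Wss : map_mx star Ws^T = W.
Proof. by apply/matrixP => i j; rewrite !mxE gstarK. Qed.

Let starM m q r (M : 'M[A]_(m, q)) (N : 'M[A]_(q, r)) :
  map_mx star (M *m N)^T = map_mx star N^T *m map_mx star M^T.
Proof. by rewrite trmx_mul map_mxM. Qed.

Lemma starX k : map_mx star (X k)^T = X k.
Proof.
elim: k => [|k IH]; first by rewrite /gX expr0 trmx1 map_mx1.
rewrite {1}/gX exprS -[_ * _]/(_ *m _) starM -/(X k) IH starM Wss.
by rewrite -/(Ws) [in RHS]/gX exprSr.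
Qed.

Lemma star_trX k : star (trX k) = trX k.
Proof.
rewrite /trX gstarZ fmorphV /= conjC_nat -[in RHS](starX k) /mxtrace rmorph_sum.
by congr (_ *: _); apply: eq_bigr => i _; rewrite !mxE.
Qed.

Let tr_delta m q (M : 'M[A]_(m, q)) i j : \tr (delta_mx i j *m M) = M j i.
Proof.
rewrite /mxtrace (bigD1 i) //= big1 ?addr0 => [|k ki].
  rewrite mxE (bigD1 j) //= big1 ?addr0 => [|l lj].
    by rewrite mxE !eqxx mul1r.
  by rewrite mxE (negbTE lj) andbF mul0r.
by rewrite mxE big1 // => l _; rewrite mxE (negbTE ki) mul0r.
Qed.

Let D_tr (D : {linear A -> A}) m (M : 'M[A]_m) : D (\tr M) = \tr (map_mx D M).
Proof. by rewrite raddf_sum; apply: eq_bigr => i _; rewrite mxE. Qed.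

Lemma d_trX i j k : d i j (trX k.+1) = (k.+1%:R / n%:R) *: (Ws *m X k) j i.
Proof.
rewrite /trX linearZ /= D_tr d_X (big_morph _ (@mxtraceD _ _) (mxtrace0 _ _)).
have -> : \sum_(q < k.+1) \tr (X q *m delta_mx i j *m (Ws *m X (k.+1 - q.+1))) =
    \sum_(q < k.+1) (Ws *m X k) j i.
  apply: eq_bigr => q _; rewrite mxtrace_mulC mulmxA mxtrace_mulC tr_delta.
  by rewrite subSS -mulmxA -XD subnK // -ltnS.
by rewrite sumr_const card_ord -scaler_nat scalerA mulrC.
Qed.

Lemma db_trX i j k : db i j (trX k.+1) = (k.+1%:R / n%:R) *: (X k *m W) i j.
Proof.
rewrite /trX linearZ /= D_tr db_X (big_morph _ (@mxtraceD _ _) (mxtrace0 _ _)).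
have -> : \sum_(q < k.+1) \tr (X q *m W *m delta_mx j i *m X (k.+1 - q.+1)) =
    \sum_(q < k.+1) (X k *m W) i j.
  apply: eq_bigr => q _; rewrite mxtrace_mulC mulmxA mxtrace_mulC tr_delta.
  by rewrite subSS mulmxA -XD subnK // -ltnS.
by rewrite sumr_const card_ord -scaler_nat scalerA mulrC.
Qed.

Let frob m q (M : 'M[A]_(m, q)) : \sum_i \sum_j nrm (M i j) = \tr (M *m map_mx star M^T).
Proof.
by apply: eq_bigr => i _; rewrite mxE; apply: eq_bigr => j _; rewrite !mxE.
Qed.

(** By cyclicity the [k + 1] terms of each derivative coincide, so the squared gradient is again a
    normalized trace. The division by [n] is the gain over quadratic forms. *)
Lemma grad_trX k : \sum_i \sum_j (nrm (d i j (trX k.+1)) + nrm (db i j (trX k.+1))) =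
  (2 * k.+1%:R ^+ 2 / n%:R) *: trX (k + k.+1).
Proof.
have nZ c f : nrm (c *: f) = (c * c^*) *: nrm f :> A.
  by rewrite /nrm gstarZ -scalerAl -scalerAr scalerA.
have cr : (k.+1%:R / n%:R : C)^* = k.+1%:R / n%:R.
  by rewrite fmorph_div /= !conjC_nat.
under eq_bigr do under eq_bigr do rewrite d_trX db_trX !nZ cr -scalerDr.
under eq_bigr do rewrite -scaler_sumr big_split.
rewrite -scaler_sumr big_split /= frob.
have -> : \sum_i \sum_j nrm ((Ws *m X k) j i) = \tr (Ws *m X k *m map_mx star (Ws *m X k)^T).
  by rewrite exchange_big frob.
rewrite !starM !starX Wss mxtrace_mulC mulmxA -mulmxA -[_ *m _ *m (Ws *m _)]mulmxA.
rewrite -XS -XD.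
rewrite /trX -mulr2n -scaler_nat !scalerA; congr (_ *: _).
by field; rewrite pnatr_eq0 -lt0n (an_gt0 a).
Qed.

Definition ctrX k : A := trX k - (mom G k)%:A.

(** With [be = gkap (k+1)^2 / n], the Poincare inequality gives [E f^2 <= 2 be m1] for [f], and
    [E f^4 - (E f^2)^2 <= 8 be E (f^2 trX)] for [f^2], whose gradient is [2 f] times that of [f].
    Young's inequality absorbs half of [E f^4] from the right-hand side; this doubles the constants
    4 and 64. *)
Lemma fourth_moment k :
  E (ctrX k.+1 ^+ 4) <= (gkap G * k.+1%:R ^+ 2 / n%:R) ^+ 2 *
    (8%:R * mom G (k + k.+1) ^+ 2 + 128%:R * mom G ((k + k.+1) + (k + k.+1))).
Proof.
set be := gkap G * _ / _; set f := ctrX k.+1; set m1 := mom G (k + k.+1).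
have mr q : (mom G q)^* = mom G q by apply/CrealP/ger0_real/mom_ge0.
have sf : star f = f by rewrite /f /ctrX rmorphB /= star_trX gstarZ rmorph1 mr.
have be0 : 0 <= be by rewrite divr_ge0 ?mulr_ge0 ?gkap_ge0 ?exprn_ge0.
have evr o : ev o f \is Num.real by apply/CrealP; rewrite -gev_star sf.
have Ef0 : E f = 0 by rewrite /f /ctrX raddfB /= [X in _ - X]EZ gEx1 mulr1 subrr.
have dcst (D : {linear A -> A}) : (forall f g, D (f * g) = D f * g + f * D g) ->
    D f = D (trX k.+1).
  by move=> DM; rewrite /f /ctrX raddfB /= [X in _ - X]linearZ /= (derivation1 DM) scaler0 subr0.
have df i j := dcst (d i j) (@gdM _ _ _ _ G i j).
have dbf i j := dcst (db i j) (@gdbM _ _ _ _ G i j).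
have v1 : E (f ^+ 2) <= 2 * be * m1.
  have := gpoinc f; rewrite Ef0 mul0r subr0 sf -expr2.
  have -> : \sum_i \sum_j (d i j f * star (d i j f) + db i j f * star (db i j f)) =
     (2 * k.+1%:R ^+ 2 / n%:R) *: trX (k + k.+1).
    rewrite -grad_trX; apply: eq_bigr => i _; apply: eq_bigr => j _.
    by rewrite df dbf.
  rewrite EZ -/(mom G _) -/m1 => h; apply: le_trans h _.
  by rewrite le_eqVlt; apply/orP; left; apply/eqP; rewrite /be; ring.
have E2 : 0 <= E (f ^+ 2).
  by apply: gEx_ge0 => o; rewrite rmorphXn real_exprn_even_ge0.
have v2 : E (f ^+ 4) - E (f ^+ 2) ^+ 2 <= 8%:R * be * E (f ^+ 2 * trX (k + k.+1)).
  have := gpoinc (f ^+ 2); rewrite rmorphXn /= sf.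
  rewrite (CrealP (ger0_real E2)) -!expr2 -exprM => h; apply: le_trans h _.
  have -> : \sum_i \sum_j (d i j (f ^+ 2) * star (d i j (f ^+ 2)) +
                           db i j (f ^+ 2) * star (db i j (f ^+ 2))) =
     (4%:R * (2 * k.+1%:R ^+ 2 / n%:R)) *: (f ^+ 2 * trX (k + k.+1)).
    rewrite -scalerA scalerAr -grad_trX mulr_sumr scaler_sumr; apply: eq_bigr => i _.
    rewrite mulr_sumr scaler_sumr; apply: eq_bigr => j _.
    rewrite -df -dbf [f ^+ 2]expr2 gdM gdbM !rmorphD !rmorphM /= sf /nrm scaler_nat.
    by rewrite -mulr_natl; ring.
  rewrite EZ le_eqVlt; apply/orP; left; apply/eqP; rewrite /be; ring.
have v3 : 8%:R * be * E (f ^+ 2 * trX (k + k.+1)) <=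
    E (f ^+ 4) / 2 + 64%:R * be ^+ 2 * mom G ((k + k.+1) + (k + k.+1)).
  rewrite -EZ.
  have -> : E (f ^+ 4) / 2 + 64%:R * be ^+ 2 * mom G ((k + k.+1) + (k + k.+1)) =
      E (2^-1 *: f ^+ 4 + (64%:R * be ^+ 2) *: trX ((k + k.+1) + (k + k.+1))).
    by rewrite raddfD /= (EZ 2^-1) (EZ (64%:R * be ^+ 2)) mulrC.
  apply: E_le => o.
  rewrite !rmorphD (gevZ o (8%:R * be)) (gevZ o 2^-1) (gevZ o (64%:R * be ^+ 2)).
  rewrite rmorphM !rmorphXn /=.
  have sm := tr_state (G := G) o.
  have := ismom_sqr (k + k.+1) sm; rewrite -/(trX _) -/(trX (_ + _)).
  have := ismom_ge0 (k + k.+1) sm; rewrite -/(trX _).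
  set g := ev o (trX _); set g2 := ev o (trX _); set x := ev o f => g0 hg.
  apply: le_trans (_ : 2^-1 * x ^+ 4 + 32%:R * be ^+ 2 * g ^+ 2 <= _).
    rewrite -subr_ge0.
    have -> : 2^-1 * x ^+ 4 + 32%:R * be ^+ 2 * g ^+ 2 - 8%:R * be * (x ^+ 2 * g) =
      (x ^+ 2 - 8%:R * be * g) ^+ 2 / 2 by field.
    rewrite divr_ge0 // real_exprn_even_ge0 // rpredB ?rpredX ?evr //.
    have h8 : 0 <= 8%:R * be * g by rewrite mulr_ge0 // mulr_ge0.
    exact: ger0_real h8.
  rewrite lerD2l; have -> : 64%:R * be ^+ 2 * g2 = 32%:R * be ^+ 2 * (2 * g2) by ring.
  by rewrite ler_wpM2l // mulr_ge0 ?exprn_ge0.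
have m10 : 0 <= m1 by exact: mom_ge0.
have v4 : E (f ^+ 2) ^+ 2 <= 4%:R * be ^+ 2 * m1 ^+ 2.
  apply: le_trans (_ : (2 * be * m1) ^+ 2 <= _).
    have b0 : 0 <= 2 * be * m1 by rewrite mulr_ge0 // mulr_ge0.
    by rewrite lerXn2r // nnegrE.
  by rewrite le_eqVlt; apply/orP; left; apply/eqP; ring.
have := lerD (lerD v2 v3) v4.
set e4 := E (f ^+ 4); set e2 := E (f ^+ 2); set z := E (f ^+ 2 * _).
set m2 := mom G (_ + _) => h.
rewrite -subr_ge0 in h; rewrite -subr_ge0.
have -> : be ^+ 2 * (8%:R * m1 ^+ 2 + 128%:R * m2) - e4 =
  2 * (8%:R * be * z + (e4 / 2 + 64%:R * be ^+ 2 * m2) + 4%:R * be ^+ 2 * m1 ^+ 2 -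
     (e4 - e2 ^+ 2 + 8%:R * be * z + e2 ^+ 2)) by field.
by rewrite mulr_ge0.
Qed.

End FourthMoment.

(* Expansion of the real covariances along d = (dx - i dy)/2 and db = (dx + i dy)/2. *)
Lemma wirtinger_cov (F : fieldType) (I G G' a b c e : F) : 2 != 0 :> F -> I * I = -1 ->
  ((2^-1 * 2^-1) * (G + G')) * a + ((I / 4) * (G - G')) * b
  + (((- I / 4) * (G - G')) * c + ((2^-1 * 2^-1) * (G + G')) * e) =
  G * (4^-1 * (a + I * b - I * c + e)) + G' * (4^-1 * (a - I * b + I * c + e)).
Proof.
move=> n2 II; have n4 : 4 != 0 :> F by rewrite (natrM _ 2 2) mulf_neq0.
by field; rewrite n2 n4.
Qed.

Definition pair_Gam (C : numClosedFieldType) (n p : nat) (a : angle C n p)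
  (q r : 'I_n * 'I_p) : C := Gam a q.1 q.2 r.1 r.2.

(** * From real Gaussian coordinates to circular complex ones *)

Section ComplexCoordinates.
Variables (C : numClosedFieldType) (n p : nat) (a : angle C n p) (kap : C).
Local Notation I2 := ('I_n * 'I_p)%type.
Local Notation V := (I2 * bool)%type.
Local Notation G := (pair_Gam a).
Variables (A : polyAlg C V) (E : gaussFun A).
Local Notation X := (pvar A).
Local Notation D := (pder A).
Local Notation star := (pstar A).
Local Notation ev o := (pev A (gx E o)).
Variable w : I2 -> A.
Local Notation I := ('i : C).
Hypothesis wE : forall q, w q = X (q, false) + I *: X (q, true).
Hypothesis E_ww : forall q r, E (w q * w r) = 0.
Hypothesis E_wsw : forall q r, E (w q * star (w r)) = G q r.
Hypothesis kap_ge0 : 0 <= kap.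
Hypothesis kapP : forall D : I2 -> C,
  \sum_q \sum_r G q r * D q * (D r)^* <= kap * \sum_q D q * (D q)^*.

Let II : I * I = -1. Proof. by rewrite -expr2 sqrCi. Qed.

Let sumV (f : V -> C) : \sum_v f v = \sum_q (f (q, false) + f (q, true)).
Proof.
rewrite (eq_bigr (fun v : V => f (v.1, v.2))) => [|[q b] //].
rewrite -(pair_bigA _ (fun q b => f (q, b))) /=; apply: eq_bigr => q _.
by rewrite big_bool addrC.
Qed.

Let E_star f : E (star f) = (E f)^*. Proof. exact: gE_star. Qed.

Let E_sww q r : E (star (w q) * w r) = (G q r)^*.
Proof. by rewrite -E_wsw -E_star rmorphM /= pstarK. Qed.

Let E_swsw q r : E (star (w q) * star (w r)) = 0.
Proof. by rewrite -rmorphM /= E_star E_ww conjC0. Qed.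

Let starw q : star (w q) = X (q, false) - I *: X (q, true).
Proof.
rewrite wE rmorphD /= pstarZ !pstar_var; congr (_ + _).
by rewrite conjCi scaleNr.
Qed.

Let two : 2 != 0 :> C. Proof. by rewrite pnatr_eq0. Qed.

Let c2 : (2^-1 : C)^* = 2^-1.
Proof. by apply/CrealP; rewrite realV realn. Qed.

Let halfD (y : A) : 2^-1 *: (y + y) = y.
Proof. by rewrite scalerDr -scalerDl (_ : 2^-1 + 2^-1 = 1) ?scale1r //; field. Qed.

Let Xf q : X (q, false) = 2^-1 *: (w q + star (w q)).
Proof.
by rewrite starw wE addrACA subrr addr0 halfD.
Qed.

Let Xt q : X (q, true) = (- I / 2) *: (w q - star (w q)).
Proof.
rewrite starw wE opprB addrC addrA subrK [- I / 2]mulrC -scalerA scalerDr scalerA.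
by rewrite mulNr II opprK scale1r halfD.
Qed.

Let EZ c f : E (c *: f) = c * E f. Proof. exact: gEZ. Qed.

(** Wirtinger derivatives: [c = - 'i] gives the derivative with respect to the entry, [c = 'i] with
    respect to its conjugate. *)
Let wd0 (c : C) q (f : A) : A := 2^-1 *: (D (q, false) f + c *: D (q, true) f).
Let wd0_lin c q : linear (wd0 c q).
Proof.
move=> k f g; rewrite /wd0 !linearP /= !scalerDr !scalerA.
by rewrite [k / 2]mulrC -[2^-1 * k * c]mulrA addrACA.
Qed.
Let wd_ex c q : {F : {linear A -> A} | forall f, F f = wd0 c q f}.
Proof.
pose F : {linear A -> A} := HB.pack (wd0 c q) (GRing.isLinear.Build _ _ _ _ _ (@wd0_lin c q)).
by exists F.
Qed.
Let wd c q : {linear A -> A} := sval (wd_ex c q).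
Let wdE c q f : wd c q f = 2^-1 *: (D (q, false) f + c *: D (q, true) f).
Proof. exact: (svalP (wd_ex c q)). Qed.

Let wdM c q f g : wd c q (f * g) = wd c q f * g + f * wd c q g.
Proof.
rewrite !wdE !pderM -!scalerAl -!scalerAr -scalerDr; congr (_ *: _).
by rewrite !scalerDr mulrDl mulrDr -scalerAl -scalerAr addrACA.
Qed.

Let wd_lin c e q r : wd c q (X (r, false) + e *: X (r, true)) = ((1 + c * e) / 2 * (r == q)%:R)%:A.
Proof.
rewrite wdE !raddfD /= !linearZ /= !pder_var !xpair_eqE /= andbT andbF.
rewrite ?andbT ?andbF ![false%:R]/(0 : A) [q == r]eq_sym !scaler0 addr0 add0r.
case: (r == q); last by rewrite !scaler0 !addr0 mulr0 scale0r.
by rewrite !scalerA -scalerDl; congr (_ *: _); rewrite mulr1; ring.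
Qed.

Let kd (r q : I2) : ((r == q)%:R)%:A = ((r.1 == q.1) && (r.2 == q.2))%:R :> A.
Proof. by case: r q => [i j] [k l]; rewrite xpair_eqE /=; case: (_ && _); rewrite ?scale1r ?scale0r. Qed.

Let wd_w0 q r : wd (- I) q (w r) = ((r.1 == q.1) && (r.2 == q.2))%:R.
Proof. by rewrite wE wd_lin mulNr II opprK -kd divff // mul1r. Qed.
Let wd_sw0 q r : wd (- I) q (star (w r)) = 0.
Proof. by rewrite starw -scaleNr wd_lin mulrNN II subrr !mul0r scale0r. Qed.
Let wdb_w0 q r : wd I q (w r) = 0.
Proof. by rewrite wE wd_lin II subrr !mul0r scale0r. Qed.
Let wdb_sw0 q r : wd I q (star (w r)) = ((r.1 == q.1) && (r.2 == q.2))%:R.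
Proof. by rewrite starw -scaleNr wd_lin mulrN II opprK -kd divff // mul1r. Qed.

Let ibp_w q f : E (w q * f) = \sum_r G q r * E (wd I r f).
Proof.
rewrite {1}wE mulrDl -scalerAl raddfD /= EZ !gE_ibp !sumV mulr_sumr -big_split.
apply: eq_bigr => r _.
have e1 : E (X (q, false) * X (r, false)) + I * E (X (q, true) * X (r, false)) = 2^-1 * G q r.
  rewrite -EZ -raddfD /= scalerAl -mulrDl -wE Xf -scalerAr EZ mulrDr raddfD /=.
  by rewrite E_ww E_wsw add0r.
have e2 : E (X (q, false) * X (r, true)) + I * E (X (q, true) * X (r, true)) = I / 2 * G q r.
  rewrite -EZ -raddfD /= scalerAl -mulrDl -wE Xt -scalerAr EZ mulrBr raddfB /=.
  by rewrite E_ww E_wsw sub0r mulrN mulNr mulNr opprK.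
rewrite wdE EZ raddfD /= EZ.
transitivity ((E (X (q, false) * X (r, false)) + I * E (X (q, true) * X (r, false))) * E (D (r, false) f)
  + (E (X (q, false) * X (r, true)) + I * E (X (q, true) * X (r, true))) * E (D (r, true) f)).
  by ring.
by rewrite e1 e2; ring.
Qed.

Let Istar : I^* = - I.
Proof. exact: conjCi. Qed.

Let star_wd c q f : star (wd c q f) = wd (c^*) q (star f).
Proof.
rewrite !wdE pstarZ rmorphD /= pstarZ !pder_star; congr (_ *: _).
exact: c2.
Qed.

Let ibp_sw q f : E (star (w q) * f) = \sum_r (G q r)^* * E (wd (- I) r f).
Proof.
rewrite -[LHS]conjCK -E_star rmorphM /= pstarK ibp_w rmorph_sum; apply: eq_bigr => r _ /=.
by rewrite rmorphM /= -E_star star_wd Istar pstarK.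
Qed.

(** Circularity, in the form of a vanishing pseudo-covariance, is what removes the terms mixing the
    two kinds of derivatives. *)
Let quad f : \sum_v \sum_u E (X v * X u) * E (D v f * star (D u f)) =
  \sum_q \sum_r (G q r * E (wd (- I) q f * star (wd (- I) r f)) +
                (G q r)^* * E (wd I q f * star (wd I r f))).
Proof.
rewrite sumV; apply: eq_bigr => q _; rewrite !sumV -big_split /=; apply: eq_bigr => r _.
have q4 : (2^-1 * 2^-1 : C) = 4^-1 by rewrite -invfM -natrM.
have EX b c : E ((w q + b *: star (w q)) * (w r + c *: star (w r))) = c * G q r + b * (G q r)^*.
  rewrite mulrDl !mulrDr -!scalerAl -!scalerAr !raddfD /= !EZ.
  by rewrite E_ww E_wsw E_sww E_swsw; ring.
have s1 f1 : (f1 : A) = 1 *: f1 by rewrite scale1r.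
have sN f1 : - (f1 : A) = (-1) *: f1 by rewrite scaleN1r.
have k1 : E (X (q, false) * X (r, false)) = (2^-1 * 2^-1) * (G q r + (G q r)^*).
  rewrite !Xf -scalerAl -scalerAr !EZ [star (w q)]s1 [star (w r)]s1 EX; ring.
have k2 : E (X (q, false) * X (r, true)) = (I / 4) * (G q r - (G q r)^*).
  rewrite Xf Xt -scalerAl -scalerAr !EZ [star (w q)]s1 [- star (w r)]sN EX -q4; ring.
have k3 : E (X (q, true) * X (r, false)) = (- I / 4) * (G q r - (G q r)^*).
  rewrite Xf Xt -scalerAl -scalerAr !EZ [star (w r)]s1 [- star (w q)]sN EX -q4; ring.
have k4 : E (X (q, true) * X (r, true)) = (2^-1 * 2^-1) * (G q r + (G q r)^*).
  rewrite !Xt -scalerAl -scalerAr !EZ ![- star (w _)]sN EX.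
  rewrite (_ : - I / 2 * (- I / 2 * _) = I * I * (2^-1 * 2^-1) * (-1 * G q r + -1 * (G q r)^*)); last by ring.
  by rewrite II; ring.
have ed c : E (wd c q f * star (wd c r f)) = 4^-1 *
   (E (D (q, false) f * star (D (r, false) f)) + c^* * E (D (q, false) f * star (D (r, true) f))
    + c * E (D (q, true) f * star (D (r, false) f)) + c * c^* * E (D (q, true) f * star (D (r, true) f))).
  rewrite !wdE pstarZ c2 rmorphD /= pstarZ -[in LHS]scalerAl -[in LHS]scalerAr scalerA q4.
  rewrite EZ; congr (_ * _).
  by rewrite mulrDl !mulrDr -!scalerAl -!scalerAr scalerA !raddfD /= !EZ; ring.
have cc1 : - I * I = 1 by rewrite mulNr II opprK.
have cc2 : I * - I = 1 by rewrite mulrN II opprK.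
rewrite k1 k2 k3 k4 !ed Istar rmorphN /= Istar opprK cc1 cc2 !mul1r.
by rewrite wirtinger_cov //; ring.
Qed.

Let kap_E (h : I2 -> A) : \sum_q \sum_r G q r * E (h q * star (h r)) <=
  kap * E (\sum_q h q * star (h q)).
Proof.
rewrite -EZ; under eq_bigr do under eq_bigr do rewrite -EZ.
under eq_bigr do rewrite -raddf_sum; rewrite -raddf_sum /=.
apply: gE_le => t; rewrite pevZ !rmorph_sum /=.
under eq_bigr => q _ do rewrite rmorph_sum /=.
have := kapP (fun q => ev t (h q)); congr (_ <= kap * _); apply: eq_bigr => q _.
  by apply: eq_bigr => r _; rewrite pevZ rmorphM /= pev_conj mulrA.
by rewrite rmorphM /= pev_conj.
Qed.

Let poinc f : E (f * star f) - E f * (E f)^* <=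
  kap * E (\sum_i \sum_j (wd (- I) (i, j) f * star (wd (- I) (i, j) f) +
                          wd I (i, j) f * star (wd I (i, j) f))).
Proof.
apply: le_trans (poincare E f) _; rewrite quad.
under eq_bigr do rewrite big_split; rewrite big_split /=.
rewrite (pair_bigA _ (fun i j => wd (- I) (i, j) f * star (wd (- I) (i, j) f) +
   wd I (i, j) f * star (wd I (i, j) f))) /= big_split raddfD /= mulrDr.
have sp (h : I2 -> A) : \sum_(q : 'I_n * 'I_p) h (q.1, q.2) = \sum_q h q.
  by apply: eq_bigr => [[i j]].
apply: lerD.
  by rewrite (sp (fun q => wd (- I) q f * star (wd (- I) q f))); exact: kap_E.
(* This half carries the conjugate covariance, so [kap_E] is applied to the starred derivatives; the
   resulting sum equals its conjugate because it is comparable to a nonnegative number. *)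
rewrite (sp (fun q => wd I q f * star (wd I q f))).
have := kap_E (fun q => star (wd I q f)).
have e q r : E (wd I q f * star (wd I r f)) = (E (star (wd I q f) * star (star (wd I r f))))^*.
  by rewrite -E_star rmorphM /= !pstarK.
have re1 : \sum_q \sum_r (G q r)^* * E (wd I q f * star (wd I r f)) =
   (\sum_q \sum_r G q r * E (star (wd I q f) * star (star (wd I r f))))^*.
  rewrite rmorph_sum; apply: eq_bigr => q _; rewrite rmorph_sum; apply: eq_bigr => r _ /=.
  by rewrite e -(rmorphM Num.conj).
have re2 : E (\sum_q star (wd I q f) * star (star (wd I q f))) = E (\sum_q wd I q f * star (wd I q f)).
  by congr (E _); apply: eq_bigr => q _; rewrite pstarK mulrC.
rewrite re1 re2 => h; rewrite (_ : _^* = \sum_q \sum_r G q r * E (star (wd I q f) * star (star (wd I r f)))) //.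
apply/CrealP; have := ler_real h => ->.
by apply: ger0_real; rewrite mulr_ge0 //; apply: gE_ge0 => t; rewrite rmorph_sum sumr_ge0 // => q _;
  rewrite rmorphM /= pev_conj mul_conjC_ge0.
Qed.

(** Both maps are identities. The existential hides the record, so that later proofs use only the
    listed properties. *)
Lemma gmat_of_gaussFun : exists G : gmat a, exists (phi : gOm E -> gOmega G) (psi : gA G -> A),
  [/\ forall o f, gev G (phi o) f = pev A (gx E o) (psi f), forall i j, psi (gW G i j) = w (i, j),
      forall f, gEx G f = E (psi f) & gkap G = kap].
Proof.
have sp (h : I2 -> C) : \sum_k \sum_l h (k, l) = \sum_q h q.
  by rewrite (pair_bigA _ (fun k l => h (k, l))); apply: eq_bigr => [[i j]].
exists (@Gmat C n p a A star (@pstarK _ _ A) (@pstarZ _ _ A) (gOm E) (fun o => ev o)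
  (fun o c f => pevZ (gx E o) c f) (@pev_conj _ _ _ E) E (gE1 E) (@gE_ge0 _ _ _ E) E_star
  (\matrix_(i, j) w (i, j)) (fun i j => wd (- I) (i, j)) (fun i j => wd I (i, j))
  (fun i j => wdM (- I) (i, j)) (fun i j => wdM I (i, j))
  (fun i j k l => etrans (congr1 _ (mxE _ _ k l)) (wd_w0 (i, j) (k, l)))
  (fun i j k l => etrans (congr1 (fun z => wd _ _ (star z)) (mxE _ _ k l)) (wd_sw0 (i, j) (k, l)))
  (fun i j k l => etrans (congr1 _ (mxE _ _ k l)) (wdb_w0 (i, j) (k, l)))
  (fun i j k l => etrans (congr1 (fun z => wd _ _ (star z)) (mxE _ _ k l)) (wdb_sw0 (i, j) (k, l)))
  (fun i j f => etrans (congr1 (fun z => E (z * f)) (mxE _ _ i j))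
     (etrans (ibp_w (i, j) f) (esym (sp (fun r => G (i, j) r * E (wd I r f))))))
  (fun i j f => etrans (congr1 (fun z => E (star z * f)) (mxE _ _ i j))
     (etrans (ibp_sw (i, j) f) (esym (sp (fun r => (G (i, j) r)^* * E (wd (- I) r f))))))
  kap kap_ge0 poinc), id, id; split=> //= i j; by rewrite mxE.
Qed.
End ComplexCoordinates.

(** * Eigenvalues given as roots of the characteristic polynomial *)

Section Eigen.
Variables (C : numClosedFieldType).

Lemma char_poly_conj n (A P Q : 'M[C]_n) : P *m Q = 1%:M ->
  char_poly (Q *m A *m P) = char_poly A.
Proof.
move=> PQ; have QP : Q *m P = 1%:M by apply: mulmx1C.
rewrite /char_poly /char_poly_mx.
have mPQ : map_mx polyC P *m map_mx polyC Q = 1%:M by rewrite -map_mxM PQ map_mx1.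
have mQP : map_mx polyC Q *m map_mx polyC P = 1%:M by rewrite -map_mxM QP map_mx1.
have -> : 'X%:M - map_mx polyC (Q *m A *m P) =
    map_mx polyC Q *m ('X%:M - map_mx polyC A) *m map_mx polyC P.
  rewrite mulmxBr mulmxBl !map_mxM; congr (_ - _).
  by rewrite mul_mx_scalar -scalemxAl mQP scalemx1.
by rewrite !det_mulmx mulrAC -det_mulmx mQP det1 mul1r.
Qed.

Variables (n p : nat) (B : 'M[C]_(n, p)) (I : finType) (lam : I -> C).
Hypothesis lamE : char_poly (B *m B^t*) = \prod_(k : I) ('X - (lam k)%:P).

(** Unique factorization into linear factors makes the family [lam] a permutation of the values of
    [gram_spectral], whatever its indexing. *)
Lemma gram_eigenvalues : (forall k, 0 <= lam k) /\
  forall k, \tr ((B *m B^t*) ^+ k) = \sum_i lam i ^+ k.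
Proof.
have [P [l [uP l0 HE]]] := gram_spectral B.
have PP : P *m P^t* = 1%:M by apply/unitarymxP.
have pe : perm_eq [seq lam k | k <- index_enum I] [seq l i | i <- index_enum 'I_n].
  apply: prod_XsubC_eq; rewrite !big_map /= -lamE.
  have := HE 1%N; rewrite expr1 => ->; rewrite char_poly_conj //.
  rewrite char_poly_trig ?diag_mx_is_trig //.
  by apply: eq_bigr => i _; rewrite !mxE eqxx mulr1n expr1.
split=> [k|k].
  have : lam k \in [seq l i | i <- index_enum 'I_n].
    by rewrite -(perm_mem pe) map_f // mem_index_enum.
  by move=> /mapP[i _ ->].
rewrite HE mxtrace_mulC mulmxA PP mul1mx mxtrace_diag.
have := perm_big _ pe (op := +%R) (x := 0) (P := xpredT) (F := fun x => x ^+ k).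
rewrite !big_map /= => ->.
by apply: eq_bigr => i _; rewrite mxE.
Qed.
End Eigen.

Lemma inv_sqr_step (F : fieldType) (x : F) : x != 0 -> x + 1 != 0 ->
  2 - (x + 1)^-1 - (2 - x^-1 + ((x + 1) ^+ 2)^-1) = (x * (x + 1) ^+ 2)^-1.
Proof. by move=> x0 x1; field; rewrite x0 x1. Qed.

Lemma inv_sqr_split (F : fieldType) (x y : F) : x != 0 -> y != 0 ->
  2 * (x ^+ 2)^-1 + 2 * (y ^+ 2)^-1 - (x + y) ^+ 2 * (x ^+ 2 * y ^+ 2)^-1 =
  (x^-1 - y^-1) ^+ 2.
Proof. by move=> x0 y0; field; rewrite x0 y0. Qed.

Lemma gbnd_term (F : fieldType) (b u v x y : F) : x != 0 -> y != 0 ->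
  u / x ^+ 2 * b * (v / y ^+ 2) = b * (u * v) * (x ^+ 2 * y ^+ 2)^-1.
Proof. by move=> x0 y0; field; rewrite x0 y0. Qed.

(** * Moments of the limit measure *)

Section OperatorBounds.
Variable C : numClosedFieldType.

Lemma opbD m (A B : 'M[C]_m) a b : 0 < a -> 0 < b -> opb A a -> opb B b -> opb (A + B) (a + b).
Proof.
move=> a0 b0 hA hB; apply: opbP; first exact: addr_gt0.
move=> x y; rewrite mulmxDr mulmxDl mxE; apply: le_trans (ler_normD _ _) _.
by rewrite !mulrDl; apply: lerD; exact: opb_form.
Qed.

Lemma opb_le m (A : 'M[C]_m) a b : 0 <= a -> a <= b -> opb A a -> opb A b.
Proof.
move=> a0 ab hA x; apply: le_trans (hA x) _.
by rewrite ler_wpM2r ?vnorm2_ge0 // lerXn2r ?nnegrE // (le_trans a0).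
Qed.

Lemma opb0 m c : 0 <= c -> opb (0 : 'M[C]_m) c.
Proof.
move=> c0 x; rewrite mul0mx /vnorm2 big1 => [|i _]; last by rewrite mxE mul0r.
by rewrite mulr_ge0 ?exprn_ge0 ?vnorm2_ge0.
Qed.

Lemma opb_sum m k (A : 'I_k -> 'M[C]_m) (a : 'I_k -> C) : (forall i, 0 < a i) ->
  (forall i, opb (A i) (a i)) -> opb (\sum_i A i) (\sum_i a i).
Proof.
move=> a0 hA; elim: k A a a0 hA => [|k IH] A a a0 hA; first by rewrite !big_ord0; exact: opb0.
case: k IH A a a0 hA => [|k] IH A a a0 hA; first by rewrite !big_ord1.
rewrite [\sum_i A i]big_ord_recl [\sum_i a i]big_ord_recl; apply: opbD => //; last exact: IH.
by rewrite big_ord_recl ltr_pwDl // sumr_ge0 // => i _; exact: ltW.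
Qed.

Lemma trC_add m n (A B : 'M[C]_(m, n)) : (A + B)^t* = A^t* + B^t*.
Proof. by apply/matrixP => i j; rewrite !mxE rmorphD. Qed.

Lemma vnorm2_eq0 m (x : 'cV[C]_m) : vnorm2 x = 0 -> x = 0.
Proof.
move=> h; apply/colP => i; rewrite mxE; apply/eqP; rewrite -mul_conjC_eq0.
by have/psumr_eq0P -> // := h => j _; exact: mul_conjC_ge0.
Qed.

Definition psdmx m (A : 'M[C]_m) := forall x : 'cV[C]_m, 0 <= (x^t* *m A *m x) 0 0.

Lemma psdmxZ m (A : 'M[C]_m) c : 0 <= c -> psdmx A -> psdmx (c *: A).
Proof. by move=> c0 hA x; rewrite -scalemxAr -scalemxAl mxE mulr_ge0. Qed.

(** The cross terms of [|x + A x|^2] are [x^H A x] and its conjugate, both nonnegative. Being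
    nonnegative in [C] includes being real, so hermitian symmetry is not a separate hypothesis. *)
Lemma vnorm2_le_psd m (A : 'M[C]_m) : psdmx A -> forall x, vnorm2 x <= vnorm2 ((1%:M + A) *m x).
Proof.
move=> hA x; have h := hA x.
rewrite mulmxDl mul1mx !vnorm2E trC_add mulmxDl !mulmxDr.
have addE (P Q : 'M[C]_1) : (P + Q) 0 0 = P 0 0 + Q 0 0 by rewrite mxE.
rewrite !addE.
rewrite -!addrA lerDl [X in 0 <= X](_ : _ = (x^t* *m A *m x) 0 0 + ((x^t* *m A *m x) 0 0)^* +
   vnorm2 (A *m x)); last first.
  rewrite vnorm2E -addrA -mulmxA; congr (_ + (_ + _)); rewrite ?dot_conj !mxE //.
by rewrite !addr_ge0 ?conjC_ge0 ?vnorm2_ge0.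
Qed.

Lemma psd_unit m (A : 'M[C]_m) : psdmx A -> 1%:M + A \in unitmx.
Proof.
move=> hA; rewrite -unitmx_tr -row_free_unit -kermx_eq0; apply/eqP/row_matrixP => i.
rewrite row0; set r := row i _; have kr : r *m (1%:M + A)^T = 0.
  by rewrite -row_mul mulmx_ker row0.
have e : (1%:M + A) *m r^T = 0 by rewrite -[_ + A]trmxK -trmx_mul kr trmx0.
have : vnorm2 r^T = 0.
  apply/le_anti; rewrite vnorm2_ge0 andbT (le_trans (vnorm2_le_psd hA _)) // e.
  by rewrite /vnorm2 big1 // => j _; rewrite mxE mul0r.
by move/vnorm2_eq0 => /(congr1 trmx); rewrite trmxK trmx0.
Qed.

Lemma psd_inv_opb m (A : 'M[C]_m) : psdmx A -> opb (invmx (1%:M + A)) 1.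
Proof.
move=> hA x; have := vnorm2_le_psd hA (invmx (1%:M + A) *m x).
by rewrite mulmxA mulmxV ?mul1mx ?psd_unit // expr1n mul1r.
Qed.

(* 1/((q+1)(k-q+1)) = (1/(q+1) + 1/(k-q+1))/(k+2) makes the quadratic recursion of
   the bounds solvable by a geometric sequence with a square summable weight. *)
Definition gbnd (K : C) k : C := K ^+ k / k.+1%:R ^+ 2.

Lemma gbnd_gt0 K k : 0 < K -> 0 < gbnd K k.
Proof. by move=> K0; rewrite divr_gt0 ?exprn_gt0 ?ltr0n. Qed.

Lemma gbnd0 K : gbnd K 0 = 1.
Proof. by rewrite /gbnd expr0 expr1n divr1. Qed.

Lemma sum_inv_sqr k : \sum_(q < k.+1) (q.+1%:R ^+ 2)^-1 <= 2 - k.+1%:R^-1 :> C.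
Proof.
elim: k => [|k IH]; first by rewrite big_ord1 expr1n !invr1 lerBrDr.
rewrite big_ord_recr /=; apply: le_trans (lerD IH (lexx _)) _.
have n1 : 0 < k.+1%:R :> C by rewrite ltr0n.
have n2 : 0 < k.+2%:R :> C by rewrite ltr0n.
rewrite -subr_ge0 (_ : _ - _ = (k.+1%:R * k.+2%:R ^+ 2)^-1).
  by rewrite invr_ge0 mulr_ge0 ?exprn_ge0 // ltW.
have e : k.+2%:R = k.+1%:R + 1 :> C by rewrite -natr1.
by rewrite e in n2 *; apply: inv_sqr_step; rewrite gt_eqF.
Qed.

(** Origin of the 8 in [8 * b]: each term is at most [2/x^2 + 2/y^2] with [x + y = k + 2], and the
    inverse squares sum to at most 2. *)
Lemma conv_inv_sqr k : k.+2%:R ^+ 2 * \sum_(q < k.+1) (q.+1%:R ^+ 2 * (k - q).+1%:R ^+ 2)^-1 <= 8 :> C.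
Proof.
have h (q : 'I_k.+1) : k.+2%:R ^+ 2 * (q.+1%:R ^+ 2 * (k - q).+1%:R ^+ 2)^-1 <=
    2 * (q.+1%:R ^+ 2)^-1 + 2 * ((k - q).+1%:R ^+ 2)^-1 :> C.
  have n1 : 0 < q.+1%:R :> C by rewrite ltr0n.
  have n2 : 0 < (k - q).+1%:R :> C by rewrite ltr0n.
  have -> : k.+2%:R = q.+1%:R + (k - q).+1%:R :> C.
    by rewrite -natrD addnS addSn subnKC // -ltnS.
  move: n1 n2; set x := q.+1%:R; set y := (k - q).+1%:R => n1 n2.
  rewrite -subr_ge0 (_ : _ - _ = (x^-1 - y^-1) ^+ 2); last by apply: inv_sqr_split; rewrite gt_eqF.
  by rewrite real_exprn_even_ge0 // rpredB // realV gtr0_real.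
rewrite mulr_sumr; apply: le_trans (ler_sum _ (fun q _ => h q)) _.
rewrite big_split /= -!mulr_sumr.
have -> : \sum_(q < k.+1) ((k - q).+1%:R ^+ 2)^-1 = \sum_(q < k.+1) (q.+1%:R ^+ 2)^-1 :> C.
  rewrite (reindex_inj rev_ord_inj) /=; apply: eq_bigr => q _.
  by rewrite subKn // -ltnS.
have s2 : \sum_(q < k.+1) (q.+1%:R ^+ 2)^-1 <= 2 :> C.
  by apply: le_trans (sum_inv_sqr k) _; rewrite gerBl invr_ge0.
apply: le_trans (_ : 2 * 2 + 2 * 2 <= _); last by rewrite -!natrM -natrD.
by apply: lerD; rewrite ler_wpM2l.
Qed.

Lemma gbnd_rec b k : 0 < b ->
  \sum_(q < k.+1) gbnd (8 * b) q * b * gbnd (8 * b) (k - q) <= gbnd (8 * b) k.+1.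
Proof.
move=> b0; have K0 : 0 < 8 * b by rewrite mulr_gt0.
have n2 : 0 < k.+2%:R ^+ 2 :> C by rewrite exprn_gt0 // ltr0n.
rewrite /gbnd -(ler_pM2l n2) [leRHS]mulrC divfK ?gt_eqF //.
have e (q : 'I_k.+1) : (8 * b) ^+ q / q.+1%:R ^+ 2 * b * ((8 * b) ^+ (k - q) / (k - q).+1%:R ^+ 2) =
    b * (8 * b) ^+ k * (q.+1%:R ^+ 2 * (k - q).+1%:R ^+ 2)^-1.
  rewrite gbnd_term ?pnatr_eq0 // -exprD subnKC // -ltnS; exact: ltn_ord.
rewrite (eq_bigr _ (fun q _ => e q)) -mulr_sumr mulrCA.
rewrite [leRHS](_ : _ = b * (8 * b) ^+ k * 8); last by rewrite exprS; ring.
by rewrite ler_wpM2l ?conv_inv_sqr // mulr_ge0 ?exprn_ge0 // ltW.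
Qed.
End OperatorBounds.

Section MomentRecursion.
Variables (C : numClosedFieldType) (n p : nat).
Variables (S : 'M[C]_p -> 'M[C]_n) (St : 'M[C]_n -> 'M[C]_p).

(** Course-of-values recursion: both sequences call all the previous values of both, so the table up
    to [k] is built jointly. *)
Fixpoint mrec k : nat -> 'M[C]_n * 'M[C]_p :=
  if k is k'.+1 then fun j => if (j <= k')%N then mrec k' j else
    (\sum_(q < k'.+1) S (mrec k' q).2 *m (mrec k' (k' - q)).1,
     \sum_(q < k'.+1) St (mrec k' q).1 *m (mrec k' (k' - q)).2)
  else fun=> (1%:M, 1%:M).

Definition Tmom k := (mrec k k).1.
Definition Ttmom k := (mrec k k).2.

Lemma mrec_stable j k : (j <= k)%N -> mrec k j = mrec j j.
Proof.
elim: k => [|k IH]; first by rewrite leqn0 => /eqP ->.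
rewrite leq_eqVlt => /predU1P[->//|]; rewrite ltnS => jk /=.
by rewrite jk IH.
Qed.

Lemma Tmom0 : Tmom 0 = 1%:M. Proof. by []. Qed.
Lemma Ttmom0 : Ttmom 0 = 1%:M. Proof. by []. Qed.

Lemma Tmom_rec k : Tmom k.+1 = \sum_(q < k.+1) S (Ttmom q) *m Tmom (k - q).
Proof.
rewrite /Tmom /= ltnn /=; apply: eq_bigr => q _.
by rewrite !mrec_stable ?leq_subr // -ltnS.
Qed.

Lemma Ttmom_rec k : Ttmom k.+1 = \sum_(q < k.+1) St (Tmom q) *m Ttmom (k - q).
Proof.
rewrite /Ttmom /= ltnn /=; apply: eq_bigr => q _.
by rewrite !mrec_stable ?leq_subr // -ltnS.
Qed.

Variable b : C.
Hypothesis b0 : 0 < b.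
Hypothesis SB : forall D t, 0 < t -> opb D t -> opb (S D) (t * b).
Hypothesis StB : forall D t, 0 < t -> opb D t -> opb (St D) (t * b).
Local Notation tau := (gbnd (8 * b)).

Let K0 : 0 < 8 * b. Proof. by rewrite mulr_gt0. Qed.
Let tau0 k : 0 < tau k. Proof. exact: gbnd_gt0. Qed.

Lemma conv_opb m1 m2 (F : 'M[C]_m2 -> 'M[C]_m1) (A : nat -> 'M[C]_m2) (B : nat -> 'M[C]_m1) k :
  (forall D t, 0 < t -> opb D t -> opb (F D) (t * b)) ->
  (forall q, (q <= k)%N -> opb (A q) (tau q)) ->
  (forall q, (q <= k)%N -> opb (B q) (tau q)) ->
  opb (\sum_(q < k.+1) F (A q) *m B (k - q)%N) (tau k.+1).
Proof.
move=> FB hA hB.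
have t0 q : 0 < tau q * b * tau (k - q)%N by apply: mulr_gt0; first exact: mulr_gt0.
have h := @opb_sum _ m1 k.+1 (fun q => F (A q) *m B (k - q)%N)
  (fun q => tau q * b * tau (k - q)%N).
apply: opb_le (gbnd_rec k b0) (h _ _).
- by apply: sumr_ge0 => q _; exact/ltW/t0.
- by move=> q; exact: t0.
- move=> q; apply: opbM; first by rewrite mulr_ge0 ?ltW.
    by apply: FB => //; apply: hA; rewrite -ltnS.
  by apply: hB; rewrite leq_subr.
Qed.

Lemma Tmom_opb k : opb (Tmom k) (tau k) /\ opb (Ttmom k) (tau k).
Proof.
elim/ltn_ind: k => -[_|k IH]; first by rewrite gbnd0; split; exact: opb1.
have IHq q : (q <= k)%N -> opb (Tmom q) (tau q) /\ opb (Ttmom q) (tau q) by exact: IH.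
rewrite Tmom_rec Ttmom_rec; split; apply: conv_opb => // q /IHq; by case.
Qed.

Hypothesis S_lin : forall c P Q, S (c *: P + Q) = c *: S P + S Q.
Hypothesis St_lin : forall c P Q, St (c *: P + Q) = c *: St P + St Q.
Variable (y : C) (U : 'M[C]_n) (Ut : 'M[C]_p).

(* With [U = y T(-y)], the [k]-th remainder of the expansion of [U] in powers of
   [-1/y]: [Ty k] tends to [Tmom k] as [y] tends to infinity. *)
Fixpoint Ty k : 'M[C]_n := if k is k'.+1 then y *: (Tmom k' - Ty k') else U.
Fixpoint Tty k : 'M[C]_p := if k is k'.+1 then y *: (Ttmom k' - Tty k') else Ut.

(** The remainders obey the convolution of the moments, except that the right factors are remainders
    and, in the top term, the argument of [F] is one too. Hence [conv_opb] applies to them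
    unchanged. *)
Lemma kernel_expansion m1 m2 (F : 'M[C]_m2 -> 'M[C]_m1)
  (A Ay : nat -> 'M[C]_m2) (B By : nat -> 'M[C]_m1) :
  (forall c P Q, F (c *: P + Q) = c *: F P + F Q) ->
  B 0%N = 1%:M -> (forall k, B k.+1 = \sum_(q < k.+1) F (A q) *m B (k - q)%N) ->
  (forall k, Ay k.+1 = y *: (A k - Ay k)) -> (forall k, By k.+1 = y *: (B k - By k)) ->
  By 1%N = F (Ay 0%N) *m By 0%N ->
  forall k, By k.+1 = \sum_(q < k.+1) F (if q == k :> nat then Ay k else A q) *m By (k - q)%N.
Proof.
move=> Flin B0 Brec AyS ByS By1.
have FZB c P Q : F (c *: (P - Q)) = c *: (F P - F Q).
  have F0 : F 0 = 0 by have := Flin 1 0 0; rewrite !scale1r addr0 => /eqP; rewrite -subr_eq0 opprD addrA subrr sub0r oppr_eq0 => /eqP.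
  by rewrite -[_ *: _]addr0 Flin F0 addr0 [P - Q]addrC -scaleN1r Flin scaleN1r addrC.
elim=> [|k IH]; first by rewrite big_ord1 /= By1.
rewrite ByS {1}Brec IH !big_ord_recr /= eqxx subnn B0 mulmx1 opprD addrACA -sumrB.
have E : y *: \sum_(i < k) (F (A i) *m B (k - i)%N - F (if i == k :> nat then Ay k else A i) *m By (k - i)%N)
   = \sum_(i < k) F (A i) *m By (k.+1 - i)%N.
  rewrite scaler_sumr; apply: eq_bigr => i _; rewrite ltn_eqF // -mulmxBr scalemxAr -ByS.
  by rewrite subSn // ltnW.
have E2 : y *: (F (A k) - F (Ay k) *m By 0%N) = F (A k) *m By 1%N + F (Ay k.+1) *m By 0%N.
  rewrite AyS FZB ByS B0 -scalemxAl -scalemxAr -scalerDr mulmxBr mulmx1 mulmxBl.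
  by rewrite addrA subrK.
rewrite scalerDr E E2 addrA subSn // subnn; congr (_ + _).
  rewrite ltn_eqF //; congr (_ + _); apply: eq_bigr => i _.
  by rewrite ltn_eqF // (ltn_trans (ltn_ord i)).
by rewrite eqxx subnn.
Qed.

Hypothesis y0 : 0 < y.
Hypothesis UE : U = invmx (1%:M + y^-1 *: S Ut).
Hypothesis UtE : Ut = invmx (1%:M + y^-1 *: St U).
Hypothesis S_psd : psdmx (S Ut).
Hypothesis St_psd : psdmx (St U).

Let yV : 0 <= y^-1. Proof. by rewrite invr_ge0 ltW. Qed.

Let inv1 m (A : 'M[C]_m) : psdmx A -> let V := invmx (1%:M + y^-1 *: A) in
  y *: (1%:M - V) = A *m V.
Proof.
move=> hA V; have h : (1%:M + y^-1 *: A) *m V = 1%:M by rewrite mulmxV // psd_unit //; exact: psdmxZ.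
rewrite -h mulmxDl mul1mx addrC addKr -scalemxAl scalerA mulfV ?scale1r //.
by rewrite gt_eqF.
Qed.

(** The bounds are those of the limit moments and do not depend on [y]. As [Tmom k - Ty k] is
    [Ty k.+1 / y], this is a rate of convergence as [y] grows. The start is that the inverse of
    [1 + A] is a contraction for positive [A]. *)
Lemma Ty_opb k : opb (Ty k) (tau k) /\ opb (Tty k) (tau k).
Proof.
elim/ltn_ind: k => -[_|k IH].
  by rewrite gbnd0 /=; split; [rewrite UE|rewrite UtE]; apply: psd_inv_opb; exact: psdmxZ.
have IHq q : (q <= k)%N -> opb (Ty q) (tau q) /\ opb (Tty q) (tau q) by exact: IH.
have h1 : Ty 1 = S (Tty 0) *m Ty 0 by rewrite /= Tmom0 {1}UE inv1 // -UE.
have h2 : Tty 1 = St (Ty 0) *m Tty 0 by rewrite /= Ttmom0 {1}UtE inv1 // -UtE.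
split.
  rewrite (kernel_expansion S_lin Tmom0 Tmom_rec (Ay := Tty) _ _ h1) //.
  apply: (conv_opb (A := fun q => if q == k :> nat then Tty k else Ttmom q)) => // q /IHq[hq hq'] //.
  by case: eqP => [<-//|_]; have [] := Tmom_opb q.
rewrite (kernel_expansion St_lin Ttmom0 Ttmom_rec (Ay := Ty) _ _ h2) //.
apply: (conv_opb (A := fun q => if q == k :> nat then Ty k else Tmom q)) => // q /IHq[hq hq'] //.
by case: eqP => [<-//|_]; have [] := Tmom_opb q.
Qed.

Lemma Ty_cvg_bound k (x : 'cV[C]_n) :
  `|(x^t* *m (Tmom k - Ty k) *m x) 0 0| <= tau k.+1 * vnorm2 x / y.
Proof.
have [h _] := Ty_opb k.+1; have := opb_form (tau0 _) h x x.
rewrite (_ : _ * (_ + _) / 2 = tau k.+1 * vnorm2 x); last by field.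
move=> le.
rewrite ler_pdivlMr // mulrC; apply: le_trans le.
have -> : x^t* *m Ty k.+1 *m x = y *: (x^t* *m (Tmom k - Ty k) *m x).
  by rewrite /= -scalemxAr -scalemxAl.
have zE (Z : 'M[C]_1) : (y *: Z) 0 0 = y * Z 0 0 by rewrite mxE.
by rewrite zE normrM (ger0_norm (ltW y0)).
Qed.
End MomentRecursion.

Section DualDistances.
Variables (C : numClosedFieldType) (n p : nat) (a : angle C n p) (G : gmat a).

Lemma Y_dual k : gY (dualG G) k = gX G k.
Proof. by rewrite /gY W_dual Ws_dual. Qed.

Lemma dist_dual Tt k : dist (dualG G) Tt k = distd G Tt k.
Proof.
rewrite /dist /distd -[LHS]/(aJ a _); congr (aJ a _); apply/funext => t.
by rewrite X_dual.
Qed.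

Lemma distd_dual T k : distd (dualG G) T k = dist G T k.
Proof.
rewrite /dist /distd -[LHS]/(aJ a _); congr (aJ a _); apply/funext => t.
rewrite Y_dual (_ : map_mx Num.conj (au (dualA a) t) = av a t) //.
by apply/matrixP => i j; rewrite !mxE conjCK.
Qed.

Lemma testb_le T k e e' : e <= e' -> testb G T k e -> testb G T k e'.
Proof.
move=> ee h A0 c c0 hA; apply: le_trans (h A0 c c0 hA) _.
by rewrite ler_wpM2l // ltW.
Qed.
End DualDistances.

Lemma mulr_frac_le (F : numFieldType) (x y : F) : 0 <= x -> 0 <= y -> y * (x / (x + 1)) <= y.
Proof.
move=> x0 y0; rewrite ler_piMr // ltW // ltr_pdivrMr ?ltr_wpDl //.
by rewrite mul1r ltrDl.
Qed.

(** * Induction on the order of the moment, uniformly in the model *)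

Section UniformSteps.
Variables (C : numClosedFieldType) (b r : C).
Hypotheses (b0 : 0 < b) (r0 : 0 <= r).
Local Notation tau := (gbnd (8 * b)).
Let tau0 k : 0 < tau k. Proof. by apply: gbnd_gt0; rewrite mulr_gt0. Qed.
Let tau0' k : 0 <= tau k. Proof. exact: ltW. Qed.
Let b0' : 0 <= b. Proof. exact: ltW. Qed.

Lemma testb_uniform k eps : 0 < eps -> exists2 e : C, 0 < e <= eps &
  forall n p (a : angle C n p) (G : gmat a) (T : nat -> 'M[C]_n) (Tt : nat -> 'M[C]_p),
  0 < aB a -> aB a <= b -> n%:R / p%:R <= r ->
  (forall k, T k.+1 = \sum_(q < k.+1) SopC a (Tt q) *m T (k - q)%N) ->
  (forall q, opb (Tt q) (tau q)) ->
  (forall q, (q <= k)%N -> testb G T q e) ->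
  (forall q, (q <= k)%N -> dist (dualG G) Tt q <= e) ->
  testb G T k.+1 eps.
Proof.
move=> eps0.
pose mu q := mbnd b r (q + q).
have mu0 q : 0 <= mu q by apply: mbnd_ge0 => //; exact: ltW.
pose Mu := \sum_(q < k.+1) mu (k - q)%N; have Mu0 : 0 <= Mu by exact: sumr_ge0.
pose Ta := \sum_(q < k.+1) tau q.
have Ta0 : 0 <= Ta by apply: sumr_ge0 => q _; exact: ltW.
(* First [s] is taken so large that the term [s^-1 Mu], which does not become small with [e], costs
   at most [eps / 2]; then [d] makes all the terms proportional to [e = eps / d] cost at most
   [eps / 2]. *)
pose s := 2 * b * (Mu + 1) / eps.
have s0 : 0 < s by rewrite divr_gt0 // mulr_gt0 ?mulr_gt0 // ltr_wpDl.
pose d := 2 * (k.+1%:R * (b * s) + b * Ta + 1).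
have d1 : 1 <= d.
  rewrite /d -[leLHS]mulr1; apply: ler_pM => //; first by rewrite ler1n.
  by rewrite lerDr; apply: addr_ge0; apply: mulr_ge0 => //; apply: mulr_ge0 => //; exact: ltW.
have d0 : 0 < d by exact: lt_le_trans d1.
have e0 : 0 < eps / d by rewrite divr_gt0.
exists (eps / d); first by rewrite e0 ler_pdivrMr // ler_peMr // ltW.
move=> n p a G T Tt B0 Bb nr Trec Ttb htest hdist.
apply: testb_le (testb_step (G := G) Trec (eps := fun=> eps / d) (tau := fun q => tau q)
  (mu := mu) (dl := fun=> eps / d) s0 B0 htest _ _ _).
- rewrite big_split /= -!mulr_sumr big_split /= sumr_const card_ord -mulr_sumr -/Mu.
  rewrite -mulr_suml -mulr_sumr -/Ta -[_ *+ k.+1]mulr_natl.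
  apply: (@le_trans _ _ (b * (k.+1%:R * (s * (eps / d)) + s^-1 * Mu) + b * Ta * (eps / d))).
    apply: lerD; last by rewrite !ler_wpM2r // ltW.
    apply: ler_wpM2r => //; have s0' := ltW s0.
    apply: addr_ge0; last by rewrite mulr_ge0 ?invr_ge0.
    by apply: mulr_ge0 => //; apply: mulr_ge0 => //; exact: ltW.
  have -> : b * (k.+1%:R * (s * (eps / d)) + s^-1 * Mu) + b * Ta * (eps / d) =
     (k.+1%:R * (b * s) + b * Ta) * (eps / d) + b * s^-1 * Mu by ring.
  have h1 : b * s^-1 * Mu <= eps / 2.
    rewrite /s invf_div (_ : _ * _ * Mu = eps / 2 * (Mu / (Mu + 1))); last first.
      by field; rewrite ?gt_eqF // ?ltr_wpDl.
    by apply: mulr_frac_le => //; rewrite divr_ge0 // ltW.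
  have h2 : (k.+1%:R * (b * s) + b * Ta) * (eps / d) <= eps / 2.
    rewrite /d; set Z := k.+1%:R * (b * s) + b * Ta.
    have Z0 : 0 <= Z.
      by apply: addr_ge0; apply: mulr_ge0 => //; apply: mulr_ge0 => //; exact: ltW.
    have Z1 : Z + 1 != 0 by rewrite gt_eqF // ltr_wpDl.
    rewrite (_ : Z * (eps / (2 * (Z + 1))) = eps / 2 * (Z / (Z + 1))); last by field.
    by apply: mulr_frac_le => //; rewrite divr_ge0 // ltW.
  by rewrite [leRHS](_ : _ = eps / 2 + eps / 2); [exact: lerD|field].
- by move=> q _; split.
- by move=> q _; exact: mom_bound.
- by move=> q hq; rewrite -dist_dual; exact: hdist.
Qed.

Lemma dist_uniform k eps : 0 < eps -> exists e D : C, [/\ 0 < e, e <= eps, 0 <= D &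
  forall n p (a : angle C n p) (G : gmat a) (T : nat -> 'M[C]_n),
  aB a <= b -> n%:R / p%:R <= r -> gkap G * D <= 1 ->
  opb (T k.+1) (tau k.+1) -> testb G T k.+1 e -> dist G T k.+1 <= eps].
Proof.
move=> eps0.
have m0 j : 0 <= mbnd b r j by apply: mbnd_ge0 => //; exact: ltW.
pose Q := 64%:R * mbnd b r (4 * k.+1) + 8%:R * tau k.+1 ^+ 4.
have Q0 : 0 <= Q by apply: addr_ge0; apply: mulr_ge0 => //; exact: exprn_ge0.
(* Three errors of [eps / 3]: [K] handles the fourth moments, the tolerance on the traces handles
   the factor [1 + K], and [D] forces the variance term down. *)
pose K := 3 * (Q + 1) / eps.
have K0 : 0 < K by rewrite divr_gt0 // mulr_gt0 // ltr_wpDl.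
pose H := 4%:R * k.+1%:R ^+ 2 * mbnd b r (k + k.+1).
have H0 : 0 <= H by rewrite !mulr_ge0 ?exprn_ge0.
have K1 : 0 < 1 + K by rewrite addr_gt0.
have e0 : 0 < eps / (3 * (1 + K)) by rewrite divr_gt0 // mulr_gt0.
exists (eps / (3 * (1 + K))), (3 * H / eps); split=> //.
- rewrite ler_pdivrMr ?mulr_gt0 // ler_peMr ?(ltW eps0) // mulrDr mulr1.
  by rewrite (le_trans (_ : 1 <= 3)) ?ler1n // lerDl mulr_ge0 // ltW.
- by rewrite divr_ge0 ?mulr_ge0 // ltW.
move=> n p a G T Bb nr hD hT htest.
apply: le_trans (dist_step K0 htest (tau0 _) hT) _.
have h1 : gkap G * (4%:R * k.+1%:R ^+ 2 * mom G (k + k.+1)) <= eps / 3.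
  apply: (@le_trans _ _ (gkap G * H)).
    rewrite ler_wpM2l ?gkap_ge0 // /H ler_wpM2l ?mulr_ge0 ?exprn_ge0 //.
    exact: mom_bound.
  rewrite ler_pdivlMr // -[leLHS](_ : gkap G * (3 * H / eps) * eps = _); last first.
    by field; rewrite gt_eqF.
  by rewrite ler_piMl // ltW.
have h2 : (1 + K) * (eps / (3 * (1 + K))) <= eps / 3.
  by rewrite le_eqVlt; apply/orP; left; apply/eqP; field; rewrite gt_eqF.
have h3 : K^-1 * (64%:R * mom G (4 * k.+1) + 8%:R * tau k.+1 ^+ 4) <= eps / 3.
  apply: (@le_trans _ _ (K^-1 * Q)).
    rewrite ler_wpM2l ?invr_ge0 ?(ltW K0) // lerD2r ler_wpM2l //; exact: mom_bound.
  rewrite /K invf_div (_ : _ * Q = eps / 3 * (Q / (Q + 1))); last first.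
    by field; rewrite ?gt_eqF // ltr_wpDl.
  by apply: mulr_frac_le => //; rewrite divr_ge0 // ltW.
rewrite [leRHS](_ : _ = eps / 3 + (eps / 3 + eps / 3)); last by field.
by apply: lerD => //; apply: lerD.
Qed.

Definition near_limit n p (a : angle C n p) (G : gmat a) T Tt q e :=
  [/\ testb G T q e, dist G T q <= e, testb (dualG G) Tt q e & dist (dualG G) Tt q <= e].

(** [D] is chosen before the model, so the passage to the limit is left to whoever shows that [gkap]
    is small. The model and its dual are carried together: traces at order [k + 1] need the mean
    squares of the dual at lower orders, and the mean squares at order [k + 1] need the traces at
    order [k + 1]. *)
Theorem moments_uniform k eps : 0 < eps -> exists2 D : C, 0 <= D &
  forall n p (a : angle C n p) (G : gmat a) (T : nat -> 'M[C]_n) (Tt : nat -> 'M[C]_p),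
  0 < aB a -> aB a <= b -> aB (dualA a) <= b -> n%:R / p%:R <= r -> p%:R / n%:R <= r ->
  T 0%N = 1%:M -> Tt 0%N = 1%:M ->
  (forall k, T k.+1 = \sum_(q < k.+1) SopC a (Tt q) *m T (k - q)%N) ->
  (forall k, Tt k.+1 = \sum_(q < k.+1) SopC (dualA a) (T q) *m Tt (k - q)%N) ->
  (forall q, opb (T q) (tau q)) -> (forall q, opb (Tt q) (tau q)) ->
  gkap G * D <= 1 -> forall q, (q <= k)%N -> near_limit G T Tt q eps.
Proof.
elim: k eps => [|k IH] eps eps0.
  exists 0 => // n p a G T Tt _ _ _ _ _ T0 Tt0 _ _ _ _ _ q; rewrite leqn0 => /eqP ->.
  split; try (by rewrite dist0 // ltW).
    by apply: testb_le (testb0 G T0); exact: ltW.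
  by apply: testb_le (testb0 (dualG G) Tt0); exact: ltW.
(* Tolerances are chosen backwards: [e1] for the traces at order [k + 1], then [e2] for everything
   below. *)
have [e1 [D1 [e10 e1l D10 h1]]] := dist_uniform k eps0.
have [e2 /andP[e20 e2l] h2] := testb_uniform k e10.
have [D2 D20 h3] := IH e2 e20.
exists (D1 + D2); first exact: addr_ge0.
move=> n p a G T Tt B0 Bb Bb' nr pr T0 Tt0 Trec Ttrec hT hTt hD.
have hD1 : gkap G * D1 <= 1 by apply: le_trans hD; rewrite ler_wpM2l ?gkap_ge0 // lerDl.
have hD2 : gkap G * D2 <= 1 by apply: le_trans hD; rewrite ler_wpM2l ?gkap_ge0 // lerDr.
have {}IH := h3 n p a G T Tt B0 Bb Bb' nr pr T0 Tt0 Trec Ttrec hT hTt hD2.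
have B0' : 0 < aB (dualA a).
  by rewrite mulr_gt0 // divr_gt0 // ltr0n; [exact: an_gt0 a|exact: ap_gt0 a].
have t1 : testb G T k.+1 e1.
  by apply: (h2 _ _ _ _ _ Tt) => // q /IH[].
have t2 : testb (dualG G) Tt k.+1 e1.
  apply: (h2 _ _ _ (dualG G) _ T) => // q /IH[] //.
  by move=> _ h _ _; rewrite dist_dual distd_dual.
have le2 : e2 <= eps by exact: le_trans e1l.
move=> q; rewrite leq_eqVlt => /predU1P[->|]; last first.
  rewrite ltnS => /IH[a1 a2 a3 a4]; split; try exact: le_trans le2.
    exact: testb_le a1.
  exact: testb_le a3.
split; [exact: testb_le t1|exact: (h1 _ _ a)|exact: testb_le t2|exact: (h1 _ _ (dualA a))].
Qed.

End UniformSteps.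

From mathcomp Require Import all_classical all_reals all_analysis measurable_realfun.

Import numFieldNormedType.Exports.

Local Open Scope classical_set_scope.
Local Open Scope ring_scope.

Lemma gauss_deriv_identity (F : fieldType) (s c e a b y k : F) : s != 0 -> 2%:R != 0 :> F ->
  a * (c * (e * (- (s ^+ 2 * 2%:R)^-1 * (2%:R * y)))) + c * e * (k * b) =
  k * (b * (c * e)) - s ^- 2 * (y * a * (c * e)).
Proof. by move=> s0 n2; field; rewrite n2 s0. Qed.

(** * Moments of normal laws *)

Section NormalMoments.
Variables (R : realType) (m s : R).
Hypothesis s0 : s != 0.
Local Notation mu := (@lebesgue_measure R).
Local Notation g := (normal_pdf m s).

Let s2 : 0 < s ^+ 2. Proof. by rewrite exprn_even_gt0. Qed.

(** Exponential tilting only shifts the mean. With [t = 1] and [t = -1], powers times the density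
    are dominated by two normal densities, which yields integrability and boundedness at once. *)
Lemma normal_pdf_tilt t x :
  expR (t * (x - m)) * g x = expR (s ^+ 2 * t ^+ 2 / 2) * normal_pdf (m + t * s ^+ 2) s x.
Proof.
rewrite !normal_pdfE // /normal_fun ![expR _ * (_ * _)]mulrCA -!expRD.
by congr (_ * expR _); field.
Qed.

Lemma normr_expn_le_expR (y : R) k : `|y| ^+ k <= k`!%:R * (expR y + expR (- y)).
Proof.
have h : expR `|y| <= expR y + expR (- y).
  have [y0|y0] := ger0P y; first by rewrite lerDl expR_ge0.
  by rewrite lerDr expR_ge0.
apply: le_trans (_ : k`!%:R * expR `|y| <= _); last by rewrite ler_wpM2l.
case: k => [|k]; first by rewrite expr0 fact0 mul1r -expR0 ler_expR.
rewrite mulrC -ler_pdivrMr ?ltr0n ?fact_gt0 //.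
by apply: le_trans (expR_ge1Dxn k (normr_ge0 y)); rewrite lerDr.
Qed.

Let bound k x : `|(x - m) ^+ k * g x| <= k`!%:R * expR (s ^+ 2 / 2) *
  (normal_pdf (m + s ^+ 2) s x + normal_pdf (m - s ^+ 2) s x).
Proof.
rewrite normrM normrX (ger0_norm (normal_pdf_ge0 _ _ _)).
apply: le_trans (ler_wpM2r (normal_pdf_ge0 _ _ _) (normr_expn_le_expR _ _)) _.
have := normal_pdf_tilt 1 x; have := normal_pdf_tilt (-1) x.
rewrite !mul1r expr1n !mulN1r sqrrN expr1n !mulr1 => h1 h2.
by rewrite -[leLHS]mulrA mulrDl h1 h2 -mulrDr mulrA.
Qed.

Let cont_g : continuous g. Proof. exact: continuous_normal_pdf. Qed.

Let cont_pow k : continuous (fun x : R => (x - m) ^+ k).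
Proof.
move=> x; apply: (@continuous_comp _ _ _ (fun x => x - m) (fun y => y ^+ k)).
  by apply: cvgB; [exact: cvg_id|exact: cvg_cst].
exact: exprn_continuous.
Qed.

Let cont_pg k : continuous (fun x : R => (x - m) ^+ k * g x).
Proof. by move=> x; apply: cvgM; [exact: cont_pow|exact: cont_g]. Qed.

Let meas_pg k : measurable_fun setT (fun x : R => (x - m) ^+ k * g x).
Proof.
apply: measurable_funM; last exact: measurable_normal_pdf.
by apply: measurable_funX; exact: measurable_funB.
Qed.

Lemma integrable_normal_moment k :
  mu.-integrable setT (EFin \o (fun x : R => (x - m) ^+ k * g x)).
Proof.
have ig : mu.-integrable setT (fun x : R => ((k`!%:R * expR (s ^+ 2 / 2))%:E *
  ((normal_pdf (m + s ^+ 2) s x)%:E + (normal_pdf (m - s ^+ 2) s x)%:E))%E).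
  by apply: integrableZl => //; apply: integrableD => //; exact: integrable_normal_pdf.
apply: (le_integrable measurableT _ _ ig).
- by apply/measurable_EFinP; exact: meas_pg.
- move=> x _ /=; rewrite lee_fin.
  by apply: le_trans (bound k x) _; exact: ler_norm.
Qed.

Let pg_ub k : exists2 c : R, 0 <= c & forall x, `|(x - m) ^+ k * g x| <= c.
Proof.
exists (k`!%:R * expR (s ^+ 2 / 2) * (normal_peak s + normal_peak s)).
  by rewrite !mulr_ge0 ?expR_ge0 ?addr_ge0 ?normal_peak_ge0.
move=> x; apply: le_trans (bound k x) _; rewrite ler_wpM2l ?mulr_ge0 ?expR_ge0 //.
by rewrite lerD // normal_pdf_ub.
Qed.

(** Decay comes from boundedness at the next power: [|x - m|] times this function is bounded. *)
Let pg_cvg0 k (e : R) : `|e| = 1 -> (e * n%:R - m) ^+ k * g (e * n%:R) @[n --> \oo] --> (0 : R).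
Proof.
move=> e1; have [c c0 hc] := pg_ub k.+1.
apply/cvgrPdist_le => eps eps0; near=> n.
rewrite sub0r normrN.
have n1 : `|m| + 1 + c / eps <= n%:R by near: n; exact: nbhs_infty_ger.
have h1 : `|m| + 1 <= n%:R by apply: le_trans n1; rewrite lerDl divr_ge0 // ltW.
have h2 : 1 + c / eps <= `|e * n%:R - m|.
  have : `|e * n%:R| - `|m| <= `|e * n%:R - m| by exact: lerB_dist.
  rewrite normrM e1 mul1r normr_nat => h3; apply: le_trans h3.
  by rewrite lerBrDl addrA.
have := hc (e * n%:R); rewrite exprS -mulrA normrM => h4.
have p0 : 0 < `|e * n%:R - m|.
  by apply: lt_le_trans h2; rewrite ltr_pwDl // divr_ge0 // ltW.
rewrite -(ler_pM2l p0); apply: le_trans h4 _.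
rewrite -ler_pdivrMr //; apply: le_trans h2; rewrite lerDr //.
Unshelve. all: by end_near.
Qed.

Let dg k (x : R) : is_derive x 1 (fun x : R => (x - m) ^+ k * g x)
  (k%:R * ((x - m) ^+ k.-1 * g x) - (s ^+ 2)^-1 * ((x - m) ^+ k.+1 * g x)).
Proof.
have E1 : (fun x : R => (x - m) ^+ k * g x) =
   (fun x => (x - m) ^+ k * (normal_peak s * expR (- (s ^+ 2 *+ 2)^-1 * (x - m) ^+ 2))).
  apply/funext => y; rewrite normal_pdfE // /normal_fun; congr (_ * (_ * expR _)).
  by rewrite mulrC mulrN mulNr.
have gE : g x = normal_peak s * expR (- (s ^+ 2 *+ 2)^-1 * (x - m) ^+ 2).
  rewrite normal_pdfE // /normal_fun; congr (_ * expR _).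
  by rewrite mulrC mulrN mulNr.
rewrite E1 gE.
set c := - (s ^+ 2 *+ 2)^-1.
have d1 : is_derive x 1 (fun y : R => y - m) (1 - 0) by exact: is_deriveB.
have dk j : is_derive x 1 (fun y : R => (y - m) ^+ j) (j%:R * (x - m) ^+ j.-1 * (1 - 0)).
  by have := is_deriveX j d1; rewrite exprfctE.
have de : is_derive x 1 (fun y : R => expR (c * (y - m) ^+ 2))
    (expR (c * (x - m) ^+ 2) * (c * (2%:R * (x - m) ^+ 1 * (1 - 0)))).
  exact: (@is_derive1_comp R expR (fun y => c * (y - m) ^+ 2) x _ _
    (is_derive_expR _) (is_deriveZ c (dk 2))).
have := is_deriveM (dk k) (is_deriveZ (normal_peak s) de).
move=> h; apply: is_derive_eq.
rewrite /GRing.scale /= subr0 !mulr1 expr1 [(x - m) ^+ k.+1]exprS.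
rewrite /c -[s ^+ 2 *+ 2]mulr_natr.
rewrite ?[_ *: _]/(_ * _); set ex := expR _; set b := (x - m) ^+ k.
set b' := (x - m) ^+ k.-1; set y := x - m.
rewrite [X in X * (k%:R * b')](_ : _ = normal_peak s * ex) //.
by apply: gauss_deriv_identity => //; rewrite pnatr_eq0.
Qed.

(** Stein's identity: the integral of the derivative [dg] of [(x - m)^k g] vanishes. For [k = 0] the
    factor [k] cancels the truncated exponent [k.-1], and the statement says that the mean is
    [m]. *)
Lemma normal_moment_step k :
  k%:R * \int[mu]_x ((x - m) ^+ k.-1 * g x) =
  (s ^+ 2)^-1 * \int[mu]_x ((x - m) ^+ k.+1 * g x).
Proof.
pose h (x : R) := k%:R * ((x - m) ^+ k.-1 * g x) - (s ^+ 2)^-1 * ((x - m) ^+ k.+1 * g x).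
pose F (x : R) := (x - m) ^+ k * g x.
have ih1 : mu.-integrable setT (EFin \o (fun x : R => k%:R * ((x - m) ^+ k.-1 * g x))).
  exact: (integrableZl measurableT k%:R (integrable_normal_moment k.-1)).
have ih2 : mu.-integrable setT (EFin \o (fun x : R => (s ^+ 2)^-1 * ((x - m) ^+ k.+1 * g x))).
  exact: (integrableZl measurableT (s ^+ 2)^-1 (integrable_normal_moment k.+1)).
have ih : mu.-integrable setT (EFin \o h) by exact: (integrableB measurableT ih1 ih2).
apply/eqP; rewrite -subr_eq0 -RintegralZl ?integrable_normal_moment //.
rewrite -RintegralZl ?integrable_normal_moment // -RintegralB //; apply/eqP.
have ch : continuous h.
  by move=> x; apply: cvgB; apply: cvgM; by [exact: cvg_cst|exact: cont_pg].
have FTC (n : nat) : (\int[mu]_(x in `[(- n.+1%:R)%R, n.+1%:R%R]) (h x)%:E =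
    (F n.+1%:R - F (- n.+1%:R))%R%:E)%E.
  rewrite (@continuous_FTC2 _ h F) //.
  - by apply: gtrN; rewrite ltr0n.
  - exact: continuous_subspaceT.
  - split.
    + by move=> x _; have [] := dg k x.
    + exact/cvg_at_right_filter/cont_pg.
    + exact/cvg_at_left_filter/cont_pg.
  - by move=> x _; rewrite derive1E; have [_ ->] := dg k x.
have lim0 : (F n.+1%:R - F (- n.+1%:R) @[n --> \oo] --> (0 : R)).
  rewrite -(subr0 0); apply: cvgB.
    have := @pg_cvg0 k 1 (normr1 _); rewrite -(cvg_shiftS (fun n => _)).
    by under eq_fun do rewrite !mul1r.
  have := @pg_cvg0 k (-1) _; rewrite normrN normr1 => /(_ erefl).
  rewrite -(cvg_shiftS (fun n => _)).
  by under eq_fun do rewrite !mulN1r.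
pose f_ (n : nat) := (EFin \o h) \_ `[- n.+1%:R, n.+1%:R].
have := @dominated_convergence _ _ _ mu setT measurableT f_ (EFin \o h) (abse \o (EFin \o h)).
case.
- move=> n; apply/(measurable_restrictT _ _).1 => //.
  exact/measurable_funTS/measurable_int/ih.
- exact: (measurable_int _ ih).
- apply: aeW => x _; apply: cvg_near_cst; near=> n.
  rewrite /f_ patchE ifT // inE /= in_itv /= -ler_norml.
  apply: le_trans (_ : n%:R <= _); last by rewrite ler_nat.
  by near: n; exact: nbhs_infty_ger.
- exact: integrable_abse.
- apply: aeW => x n _; rewrite /f_ patchE; case: ifP => _ //=.
  by rewrite normr0 lee_fin.
move=> _ _ lim.
have lim' : (F n.+1%:R - F (- n.+1%:R))%:E @[n --> \oo] --> (0 : R)%:E.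
  by apply: cvg_EFin => //; exact: nearW.
have E1 : [sequence (\int[mu]_x f_ n x)%E]_n = (fun n => (F n.+1%:R - F (- n.+1%:R))%:E).
  by apply/funext => n; rewrite /= /f_ -integral_mkcond -FTC.
rewrite E1 in lim.
have U : (\int[mu]_x (EFin \o h) x)%E = 0%:E by apply: (cvg_unique _ lim lim').
by rewrite /Rintegral -[X in fine X]/(\int[mu]_x (EFin \o h) x)%E U.
Unshelve. all: by end_near.
Qed.

End NormalMoments.

(** The Radon-Nikodym derivative agrees almost everywhere with [normal_pdf], as both have the same
    integral over every measurable set. *)
Lemma ge0_integral_normal_prob (R : realType) (m s : R) (f : R -> \bar R) :
  measurable_fun setT f -> (forall x, 0 <= f x)%E ->
  (\int[normal_prob m s]_x f x =
   \int[lebesgue_measure]_x (f x * (normal_pdf m s x)%:E))%E.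
Proof.
move=> mf f0; have dom := @normal_prob_dominates R m s.
rewrite -(Radon_Nikodym_SigmaFinite.change_of_variables dom) //.
have mpdf : measurable_fun setT (fun x : R => (normal_pdf m s x)%:E).
  by apply/measurable_EFinP; exact: measurable_normal_pdf.
apply: ae_eq_integral => //.
- apply: emeasurable_funM => //; apply: (measurable_int lebesgue_measure).
  exact: Radon_Nikodym_SigmaFinite.f_integrable.
- exact: emeasurable_funM.
- apply: ae_eqe_mul2l => /=.
  apply: integral_ae_eq => //=.
  + exact: Radon_Nikodym_SigmaFinite.f_integrable.
  + by move=> E _ mE; rewrite -Radon_Nikodym_SigmaFinite.f_integral.
Qed.

Lemma normal_prob_integral (R : realType) (m s : R) (f : R -> R) :
  measurable_fun setT f ->
  (@lebesgue_measure R).-integrable setT (EFin \o (fun x => f x * normal_pdf m s x)) ->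
  (normal_prob m s).-integrable setT (EFin \o f) /\
  \int[normal_prob m s]_x f x = \int[lebesgue_measure]_x (f x * normal_pdf m s x).
Proof.
move=> mf fi.
have mf' : measurable_fun setT (EFin \o f) by exact/measurable_EFinP.
have ifN : (normal_prob m s).-integrable setT (EFin \o f).
  apply/integrableP; split => //.
  rewrite ge0_integral_normal_prob //; last exact: measurableT_comp.
  have /integrableP[_] := fi; congr (_ < _)%E.
  apply: eq_integral => x _ /=; rewrite normrM EFinM.
  by rewrite [in X in (_ * X)%E]ger0_norm // normal_pdf_ge0.
split=> //; rewrite /Rintegral; congr fine.
rewrite integralE [RHS]integralE.
rewrite !ge0_integral_normal_prob //; [|exact: measurable_funeneg|exact: measurable_funepos].
congr (_ - _)%E; apply: eq_integral => x _.
  rewrite !funeposE /= -!EFin_max -EFinM; congr EFin.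
  have g0 := normal_pdf_ge0 m s x.
  by rewrite maxr_pMl // mul0r.
rewrite !funenegE /= -!EFin_max -EFinM; congr EFin.
have g0 := normal_pdf_ge0 m s x.
by rewrite maxr_pMl // mul0r mulNr.
Qed.

Section GaussianRV.
Context (R : realType) (d : measure_display) (T : measurableType d) (P : probability T R).

Lemma Rintegral_law (N : {measure set (measurableTypeR R) -> \bar R}) (X : T -> R) (f : R -> R) :
  measurable_fun setT (X : T -> measurableTypeR R) ->
  (forall A : set (measurableTypeR R), measurable A -> P (X @^-1` A) = N A) ->
  measurable_fun setT f -> N.-integrable setT (EFin \o f) ->
  P.-integrable setT (EFin \o (f \o X)) /\
  \int[P]_t f (X t) = \int[N]_x f x.
Proof.
move=> mX law mf fi.
have mf' : measurable_fun setT (EFin \o f) by exact/measurable_EFinP.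
pose mixX := isMeasurableFun.Build _ _ _ _ _ mX.
pose X' : {mfun T >-> measurableTypeR R} := HB.pack X mixX.
have lawi (h : R -> \bar R) : (\int[N]_x h x = \int[pushforward P X']_x h x)%E.
  by apply: eq_measure_integral => A mA _; rewrite -law.
have iX : P.-integrable setT (EFin \o (f \o X)).
  apply/integrableP; split.
    by apply/measurable_EFinP; exact: measurableT_comp mf mX.
  have /integrableP[_] := fi; rewrite lawi ge0_integral_pushforward //.
  exact: measurableT_comp.
split=> //; rewrite /Rintegral lawi; congr fine.
by rewrite (@integral_pushforward _ _ _ _ _ _ mX P setT (EFin \o f)).
Qed.

(** Centered at the parameter [m] of the law, which is not yet known to be the mean. Dirac masses
    obey the same recursion, their centered moments being [0 ^+ k]. *)
Lemma gaussian_centered_moments (X : T -> R) : gaussian_rv P X ->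
  exists m : R, [/\
    forall k, P.-integrable setT (EFin \o (fun t => (X t - m) ^+ k)),
    \int[P]_t (X t - m) = 0 &
    forall k, \int[P]_t ((X t - m) ^+ k.+2) =
      k.+1%:R * \int[P]_t ((X t - m) ^+ 2) * \int[P]_t ((X t - m) ^+ k)].
Proof.
move=> [mX [m [s law]]]; exists m.
have mp k : measurable_fun setT (fun x : R => (x - m) ^+ k).
  by apply: measurable_funX; exact: measurable_funB.
have mpE k : measurable_fun setT (EFin \o (fun x : R => (x - m) ^+ k)).
  exact/measurable_EFinP.
have intc : \int[P]_t (1 : R) = 1.
  by rewrite /Rintegral integral_cst //= probability_setT mule1.
have [s0|s0] := eqVneq s 0.
  have law' (A : set (measurableTypeR R)) : measurable A ->
      P (X @^-1` A) = (@dirac _ (measurableTypeR R) m R) A.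
    by move=> mA; rewrite law // s0 eqxx.
  have di k : (@dirac _ (measurableTypeR R) m R).-integrable setT
      (EFin \o (fun x : R => (x - m) ^+ k)).
    apply/integrableP; split; first exact: (mpE k).
    rewrite integral_dirac //; last exact: measurableT_comp (mpE k).
    by rewrite diracE in_setT mul1e ltry.
  have h k := Rintegral_law mX law' (mp k) (di k).
  have e k : \int[P]_t ((X t - m) ^+ k) = 0 ^+ k.
    rewrite (h k).2 /Rintegral integral_dirac //; last exact: (mpE k).
    by rewrite diracE in_setT mul1e /= subrr.
  split=> [k|//|k]; first exact: (h k).1.
    by have := e 1%N; under [in LHS]eq_Rintegral do rewrite expr1; rewrite expr1.
  by rewrite !e !exprS !mul0r mulr0 mul0r.
have law' (A : set (measurableTypeR R)) : measurable A ->
    P (X @^-1` A) = normal_prob m s A.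
  by move=> mA; rewrite law // (negbTE s0).
have h1 k := normal_prob_integral (mp k) (integrable_normal_moment m s0 k).
have h k := Rintegral_law mX law' (mp k) (h1 k).1.
pose Mo k := \int[P]_t ((X t - m) ^+ k).
have rec k : k%:R * Mo k.-1 = (s ^+ 2)^-1 * Mo k.+1.
  by rewrite /Mo !(h _).2 !(h1 _).2 normal_moment_step.
have s2 : s ^+ 2 != 0 by rewrite expf_neq0.
have Mo0 : Mo 0%N = 1 by rewrite /Mo; under eq_Rintegral do rewrite expr0.
have recM k : Mo k.+2 = s ^+ 2 * (k.+1%:R * Mo k) by rewrite rec mulVKf.
split=> [k||k]; first exact: (h k).1.
  have := rec 0%N; rewrite mul0r => /esym/eqP.
  rewrite mulf_eq0 invr_eq0 (negbTE s2) /= => /eqP.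
  by rewrite /Mo; under [in LHS]eq_Rintegral do rewrite expr1.
rewrite -!/(Mo _) !recM Mo0; ring.
Qed.

Lemma gaussian_moments (X : T -> R) : gaussian_rv P X -> \int[P]_t X t = 0 ->
  (forall k, P.-integrable setT (EFin \o (fun t => X t ^+ k))) /\
  forall k, \int[P]_t (X t ^+ k.+2) = k.+1%:R * \int[P]_t (X t ^+ 2) * \int[P]_t (X t ^+ k).
Proof.
move=> gX X0; have [m [im cm rec]] := gaussian_centered_moments gX.
have i1 : P.-integrable setT (EFin \o (fun t => X t - m)).
  by have := im 1%N; under eq_fun do rewrite expr1.
have ic : P.-integrable setT (EFin \o (fun _ : T => m)).
  exact: finite_measure_integrable_cst.
have iX : P.-integrable setT (EFin \o X).
  have := integrableD measurableT i1 ic; congr (integrable _ _ _).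
  by apply/funext => t /=; rewrite -EFinD subrK.
have m0 : m = 0.
  move: cm; rewrite RintegralB // X0 /Rintegral integral_cst //= probability_setT mule1 /=.
  by rewrite sub0r => /eqP; rewrite oppr_eq0 => /eqP.
rewrite {}m0 in im rec.
split=> k.
  by have := im k; congr (integrable _ _ _); apply/funext => t /=; rewrite subr0.
have := rec k.
have E j : \int[P]_t (X t - 0) ^+ j = \int[P]_t (X t ^+ j).
  by apply: eq_Rintegral => t _; rewrite subr0.
by rewrite !E.
Qed.
End GaussianRV.

(** * Moments of a measure from its Stieltjes transform on the negative half-line *)

Section StieltjesMoments.
Context (R : realType) (m : {measure set (measurableTypeR R) -> \bar R}).
Local Notation D := (@nnegR R).
Variables (A : nat -> R) (B : R -> nat -> R) (c : nat -> R).
Hypothesis mass : m D = (A 0%N)%:E.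
Hypothesis B0 : forall y, 0 < y -> y * \int[m]_(x in D) (x + y)^-1 = B y 0%N.
Hypothesis BS : forall y k, 0 < y -> B y k.+1 = y * (A k - B y k).
Hypothesis Bc : forall y k, 0 < y -> `|A k - B y k| <= c k / y.

Let mD : measurable D. Proof. exact: measurable_itv. Qed.

Let nonneg x : D x -> 0 <= x. Proof. by rewrite /nnegR /= in_itv /= andbT. Qed.

Let meas_inv (y : R) : 0 < y -> measurable_fun D (fun x : R => (x + y)^-1).
Proof.
move=> y0; apply: (@subspace_continuous_measurable_fun _ _ _ mD) => /=.
apply: continuous_in_subspaceT => x /set_mem Dx; apply: cvgV.
  by rewrite gt_eqF // ltr_wpDl // nonneg.
by apply: cvgD; [exact: cvg_id|exact: cvg_cst].
Qed.

Let meas k : measurable_fun D (EFin \o (fun x : R => x ^+ k)).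
Proof. by apply/measurable_EFinP; apply: measurable_funX; exact: measurable_id. Qed.

Let f y k (x : R) := x ^+ k * (y * (x + y)^-1).

Let f_ge0 y k x : 0 < y -> D x -> 0 <= f y k x.
Proof.
move=> y0 Dx; have x0 := nonneg Dx.
by rewrite /f mulr_ge0 ?exprn_ge0 // mulr_ge0 ?invr_ge0 ?addr_ge0 // ltW.
Qed.

Let meas_f y k : 0 < y -> measurable_fun D (EFin \o f y k).
Proof.
move=> y0; apply/measurable_EFinP; apply: measurable_funM.
  by apply: measurable_funX; exact: measurable_id.
by apply: measurable_funM; [exact: measurable_cst|exact: meas_inv].
Qed.

Let fS y k x : 0 < y -> D x -> y * x ^+ k = f y k.+1 x + y * f y k x.
Proof.
move=> y0 /nonneg x0; rewrite /f exprS; field.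
by rewrite gt_eqF // ltr_wpDl.
Qed.

Let step y k : 0 < y -> (\int[m]_(x in D) (x ^+ k)%:E = (A k)%:E)%E ->
  (\int[m]_(x in D) (f y k x)%:E = (B y k)%:E)%E ->
  (\int[m]_(x in D) (f y k.+1 x)%:E = (B y k.+1)%:E)%E.
Proof.
move=> y0 hA hB; have y1 := ltW y0.
have : (\int[m]_(x in D) (y * x ^+ k)%:E = (y * A k)%:E)%E.
  under eq_integral do rewrite EFinM.
  rewrite ge0_integralZl //; first by rewrite hA.
    exact: meas.
  by move=> x /nonneg x0; rewrite lee_fin exprn_ge0.
have -> : (\int[m]_(x in D) (y * x ^+ k)%:E =
   \int[m]_(x in D) ((f y k.+1 x)%:E + y%:E * (f y k x)%:E))%E.
  by apply: eq_integral => x /set_mem Dx; rewrite (fS k y0 Dx).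
rewrite ge0_integralD //=; last first.
- by apply: emeasurable_funM; [exact: measurable_cst|exact: meas_f].
- by move=> x Dx; rewrite -EFinM lee_fin mulr_ge0 // f_ge0.
- exact: meas_f.
- by move=> x Dx; rewrite lee_fin f_ge0.
rewrite ge0_integralZl //=; last first.
- by move=> x Dx; rewrite lee_fin f_ge0.
- exact: meas_f.
rewrite hB BS //; case: (integral _ _ _) => [r| |] //=.
by rewrite -EFinM -EFinD => -[e]; congr EFin; rewrite mulrBr -e addrK.
Qed.

(** Finiteness of the moments is part of the conclusion. The kernels [f y k = x^k y / (x + y)]
    satisfy [y x^k = f y k.+1 + y f y k], the relation [BS] of the [B y k]; so a finite moment of
    order [k] makes the next kernel integrable with integral [B y k.+1]. As [y] grows this kernel
    increases to [x^(k+1)] while [B y k.+1] tends to [A k.+1]. *)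
Lemma stieltjes_moments k : (\int[m]_(x in D) (x ^+ k)%:E = (A k)%:E)%E.
Proof.
suff [] : (\int[m]_(x in D) (x ^+ k)%:E = (A k)%:E)%E /\
  forall y, 0 < y -> (\int[m]_(x in D) (f y k x)%:E = (B y k)%:E)%E by [].
elim: k => [|k [IH1 IH2]].
  split=> [|y y0].
    under eq_integral do rewrite expr0.
    by rewrite integral_cst // mul1e mass.
  (* [B0] speaks of the real-valued integral, which takes the default value 0 when the integral is
     infinite; integrability has to be known before it can be used. *)
  have i1 : m.-integrable D (EFin \o (fun x => (x + y)^-1)).
    apply: measurable_bounded_integrable => //.
    - by rewrite mass ltry.
    - exact: meas_inv.
    exists y^-1; split=> [|z yz x Dx /=]; first exact: num_real.
    have x0 := nonneg Dx.
    rewrite ger0_norm ?invr_ge0 ?addr_ge0 ?(ltW y0) //.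
    apply: le_trans (ltW yz); rewrite lef_pV2 ?posrE ?ltr_wpDl //.
    by rewrite lerDr.
  rewrite -B0 // EFinM fineK; last exact: integrable_fin_num.
  rewrite -integralZl //; apply: eq_integral => x _.
  by rewrite /f expr0 mul1r.
have IH y : 0 < y -> (\int[m]_(x in D) (f y k.+1 x)%:E = (B y k.+1)%:E)%E.
  by move=> y0; apply: step => //; exact: IH2.
split=> //.
pose g (n : nat) (x : R) := (f n.+1%:R k.+1 x)%:E.
have n0 (n : nat) : 0 < n.+1%:R :> R by [].
have mono x : D x -> {homo g ^~ x : n p / (n <= p)%N >-> (n <= p)%E}.
  move=> Dx n p np; have x0 := nonneg Dx; rewrite /g lee_fin /f ler_wpM2l ?exprn_ge0 //.
  rewrite -[_ / _]invrK -[leRHS]invrK lef_pV2 ?posrE ?invr_gt0 ?divr_gt0 ?ltr_wpDl //.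
  rewrite !invfM !invrK mulrC [leRHS]mulrC !mulrDl !mulfV ?gt_eqF // lerD2r.
  by rewrite ler_wpM2l // lef_pV2 ?posrE // ler_nat.
have lim x : D x -> g n x @[n --> \oo] --> (x ^+ k.+1)%:E.
  move=> Dx; have x0 := nonneg Dx; apply: cvg_EFin; first exact: nearW.
  rewrite (_ : _ \o _ = fun n : nat => x ^+ k.+1 * (1 - x * (x + n.+1%:R)^-1)); last first.
    apply/funext => n /=; rewrite /f; congr (_ * _); field.
    by rewrite gt_eqF // ltr_wpDl.
  rewrite -[X in _ --> X]mulr1; apply: cvgM; first exact: cvg_cst.
  rewrite -[X in _ --> X]subr0; apply: cvgB; first exact: cvg_cst.
  rewrite -(mulr0 x); apply: cvgM; first exact: cvg_cst.
  have hb : n.+1%:R^-1 @[n --> \oo] --> (0 : R) by exact: (cvg_harmonic (R := R)).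
  apply: (squeeze_cvgr _ (cvg_cst (0 : R)) hb); near=> n.
  by rewrite invr_ge0 addr_ge0 //= lef_pV2 ?posrE ?ltr_wpDl // lerDr.
have mc := monotone_convergence m mD (fun n => meas_f k.+1 (n0 n))
  (fun n x Dx => f_ge0 k.+1 (n0 n) Dx : (0 <= g n x)%E) mono.
have -> : (\int[m]_(x in D) (x ^+ k.+1)%:E = \int[m]_(x in D) limn (g ^~ x))%E.
  by apply: eq_integral => x /set_mem Dx; apply/esym/cvg_lim => //; exact: lim.
rewrite mc; apply/cvg_lim => //.
rewrite (_ : (fun n => _) = EFin \o (fun n => B n.+1%:R k.+1)); last first.
  by apply/funext => n /=; rewrite -IH.
apply: cvg_EFin; first exact: nearW.
have cn : c k.+1 / n.+1%:R @[n --> \oo] --> (0 : R).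
  rewrite -(mulr0 (c k.+1)); apply: cvgM; first exact: cvg_cst.
  exact: (cvg_harmonic (R := R)).
apply/cvgrPdist_le => e e0; near=> n => /=.
apply: le_trans (Bc k.+1 (n0 n)) _; apply: le_trans (ler_norm _) _.
rewrite -[_ / _]subr0 -normrN opprB; near: n.
by move/cvgrPdist_le: cn => /(_ _ e0).
Unshelve. all: by end_near.
Qed.
End StieltjesMoments.

Lemma diag_identity (F : comRingType) (k n x X Y c c' : F) : n * c = k * c' ->
  k * (x * X * Y * c') = n * x * (X * Y * c).
Proof.
move=> h; transitivity (x * X * Y * (k * c')); first by ring.
by rewrite -h; ring.
Qed.

(** * From moments to weak convergence *)

Section Bernstein.
Variable R : realFieldType.
Implicit Types x : R.

Definition bern n k x : R := x ^+ k * (1 - x) ^+ (n - k) *+ 'C(n, k).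

Lemma bern_ge0 n k x : 0 <= x <= 1 -> 0 <= bern n k x.
Proof.
move=> /andP[x0 x1]; rewrite /bern mulrn_wge0 // mulr_ge0 ?exprn_ge0 //.
by rewrite subr_ge0.
Qed.

Lemma bern_sum n x : \sum_(k < n.+1) bern n k x = 1.
Proof.
have := exprDn (1 - x) x n; rewrite subrK expr1n => ->.
by apply: eq_bigr => k _; rewrite /bern mulrC.
Qed.

Lemma bern_diag n k x : k.+1%:R * bern n.+1 k.+1 x = n.+1%:R * x * bern n k x.
Proof.
have bE i j : bern i j x = x ^+ j * (1 - x) ^+ (i - j) * 'C(i, j)%:R by rewrite mulr_natr.
rewrite !bE subSS exprS; apply: diag_identity.
by rewrite -!natrM mul_bin_diag.
Qed.

Lemma bern_mean n x : \sum_(k < n.+1) k%:R * bern n k x = n%:R * x.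
Proof.
case: n => [|n]; first by rewrite big_ord1 !mul0r.
transitivity (n.+1%:R * x * \sum_(k < n.+1) bern n k x); last by rewrite bern_sum mulr1.
rewrite big_ord_recl mul0r add0r mulr_sumr.
by apply: eq_bigr => k _; exact: bern_diag.
Qed.

Lemma bern_fact2 n x :
  \sum_(k < n.+1) k%:R * (k%:R - 1) * bern n k x = n%:R * (n%:R - 1) * x ^+ 2.
Proof.
case: n => [|n]; first by rewrite big_ord1 !mul0r.
rewrite big_ord_recl !mul0r add0r.
have p1 m : m.+1%:R - 1 = m%:R :> R by rewrite -natr1 addrK.
transitivity (\sum_(k < n.+1) n.+1%:R * x * (k%:R * bern n k x)).
  apply: eq_bigr => k _; rewrite -[RHS]mulrCA -bern_diag lift0 p1.
  by rewrite mulrAC mulrC.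
rewrite -mulr_sumr bern_mean p1 expr2.
by move: (n.+1%:R) (n%:R) => u v; ring.
Qed.

Lemma bern_var n x :
  \sum_(k < n.+1) (k%:R - n%:R * x) ^+ 2 * bern n k x = n%:R * (x * (1 - x)).
Proof.
have E (k : nat) : (k%:R - n%:R * x) ^+ 2 * bern n k x = k%:R * (k%:R - 1) * bern n k x +
   ((1 - 2 * (n%:R * x)) * (k%:R * bern n k x) + (n%:R * x) ^+ 2 * bern n k x).
  by move: (bern n k x) (n%:R) (k%:R) => u v z; ring.
under eq_bigr do rewrite E.
rewrite !big_split /= -!mulr_sumr bern_fact2 bern_mean bern_sum.
by move: (n%:R) => u; ring.
Qed.
End Bernstein.

Section Weierstrass.
Variable R : realType.

Definition bernstein (f : R -> R) n : {poly R} :=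
  \sum_(k < n.+1) (f (k%:R / n%:R) *+ 'C(n, k)) *: ('X ^+ k * (1 - 'X) ^+ (n - k)).

Lemma bernsteinE f n x : (bernstein f n).[x] = \sum_(k < n.+1) f (k%:R / n%:R) * bern n k x.
Proof.
rewrite horner_sum; apply: eq_bigr => k _; rewrite !hornerE /bern.
by rewrite -[LHS]/(_ *+ _ * _ * _) !mulrnAl mulrnAr mulrA.
Qed.

Lemma weierstrass01 (f : R -> R) (e : R) : {within `[0, 1], continuous f} -> 0 < e ->
  exists p : {poly R}, forall x, 0 <= x <= 1 -> `|f x - p.[x]| <= e.
Proof.
move=> cf e0.
have [F F0 fF] : exists2 F, 0 < F & forall x, 0 <= x <= 1 -> `|f x| <= F.
  have := continuous_compact cf (@segment_compact _ 0 1) => /compact_bounded [K [Kr hK]].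
  exists (Num.max 1 (K + 1)); first by rewrite lt_max ltr01.
  move=> x x01; apply: (hK (Num.max 1 (K + 1))); first by rewrite lt_max ltrDl ltr01 orbT.
  by exists x => //=; rewrite in_itv.
(* Uniform continuity on the segment, from its near-covering property. *)
have [d d0 uc] : exists2 d, 0 < d & forall x y, 0 <= x <= 1 -> 0 <= y <= 1 ->
    `|x - y| < d -> `|f x - f y| <= e / 2.
  have /compact_near_coveringP/near_covering_withinP nc := @segment_compact R 0 1.
  have := nc R (0^'+) (fun d x => forall y, 0 <= y <= 1 -> `|x - y| < d ->
    `|f x - f y| <= e / 2) _.
  case=> [x x01|d /= d0 hd].
    have e4 : 0 < e / 4 by rewrite divr_gt0.
    move/subspace_continuousP: cf => /(_ x x01) /cvgrPdist_le /(_ _ e4).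
    rewrite near_withinE => -[eta /= eta0 heta].
    near=> x' d => x'01 y y01 lt.
    have hx' : `|x - x'| < eta / 2 by near: x'; apply: nbhsx_ballx; rewrite divr_gt0.
    have hd : d < eta / 2 by near: d; apply: nbhs_right_lt; rewrite divr_gt0.
    have l1 : `|f x - f x'| <= e / 4.
      by apply: heta => //=; rewrite (lt_trans hx') // ltr_pdivrMr // ltr_pMr // ltr1n.
    have l2 : `|f x - f y| <= e / 4.
      apply: heta => /=; last by rewrite in_itv.
      rewrite (_ : x - y = (x - x') + (x' - y)); last by ring.
      apply: le_lt_trans (ler_normD _ _) _; rewrite [ltRHS]splitr.
      by apply: ltrD => //; exact: lt_trans lt hd.
    rewrite (_ : f x' - f y = (f x - f y) - (f x - f x')); last by ring.
    apply: le_trans (ler_normB _ _) _; rewrite (_ : e / 2 = e / 4 + e / 4); last by field.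
    exact: lerD.
  exists (d / 2); first by rewrite divr_gt0.
  move=> x y x01 y01 lt.
  have h1 : `|0 - d / 2| < d.
    by rewrite sub0r normrN gtr0_norm ?divr_gt0 // ltr_pdivrMr // ltr_pMr // ltr1n.
  have h2 : 0 < d / 2 by rewrite divr_gt0.
  by apply: (hd _ h1 h2 x) => //=; rewrite in_itv.
(* Chebyshev: nodes further than [d] from [x] contribute at most [2 F / (n d)^2] times the variance
   [n x (1 - x)], which is at most [e / 2] for this [n]. *)
pose n := (Num.truncn (4 * F / (e * d ^+ 2))).+1.
exists (bernstein f n) => x x01; rewrite bernsteinE.
have n0 : 0 < n%:R :> R by rewrite ltr0n.
have -> : f x = \sum_(k < n.+1) f x * bern n k x by rewrite -mulr_sumr bern_sum mulr1.
rewrite -sumrB.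
apply: le_trans (ler_norm_sum _ _ _) _.
have h (k : 'I_n.+1) : `|f x * bern n k x - f (k%:R / n%:R) * bern n k x| <=
    e / 2 * bern n k x + (2 * F / (n%:R * d) ^+ 2) * ((k%:R - n%:R * x) ^+ 2 * bern n k x).
  have b0 := bern_ge0 n k x01.
  have k01 : 0 <= (k%:R / n%:R : R) <= 1.
    apply/andP; split; first by rewrite divr_ge0.
    by rewrite ler_pdivrMr // mul1r ler_nat -ltnS.
  rewrite -mulrBl normrM (ger0_norm b0) mulrA -mulrDl ler_wpM2r //.
  have [lt|ge] := ltP `|x - k%:R / n%:R| d.
    apply: le_trans (uc _ _ x01 k01 lt) _; rewrite lerDl mulr_ge0 ?sqr_ge0 //.
    by rewrite divr_ge0 ?sqr_ge0 // mulr_ge0 // ltW.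
  apply: (@le_trans _ _ (2 * F)).
    apply: le_trans (ler_normB _ _) _; rewrite [2 * F]mulrDl mul1r.
    by apply: lerD; exact: fF.
  apply: (@le_trans _ _ (2 * F / (n%:R * d) ^+ 2 * (k%:R - n%:R * x) ^+ 2)); last first.
    by rewrite lerDr divr_ge0 // ltW.
  rewrite -[leRHS]mulrA ler_peMr ?mulr_ge0 ?(ltW F0) //.
  rewrite mulrC ler_pdivlMr ?exprn_gt0 ?mulr_gt0 // mul1r.
  rewrite -[leRHS]real_normK ?num_real // lerXn2r ?nnegrE ?mulr_ge0 ?(ltW n0) ?(ltW d0) //.
  rewrite (_ : k%:R - n%:R * x = - (n%:R * (x - k%:R / n%:R))); last first.
    by move: n0; move: (n%:R) (k%:R) => u v u0; field; rewrite gt_eqF.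
  by rewrite normrN normrM (gtr0_norm n0) ler_wpM2l // ltW.
apply: le_trans (ler_sum _ (fun k _ => h k)) _.
rewrite big_split /= -!mulr_sumr bern_sum bern_var mulr1.
have v : x * (1 - x) <= 1.
  by move: x01 => /andP[x0 x1]; rewrite mulr_ile1 // ?subr_ge0 // gerBl.
rewrite [leRHS](splitr e) lerD2l.
apply: (@le_trans _ _ (2 * F / (n%:R * d) ^+ 2 * n%:R)).
  by rewrite ler_wpM2l ?divr_ge0 ?sqr_ge0 ?mulr_ge0 ?(ltW F0) // ler_piMr // ltW.
have nb : 4 * F / (e * d ^+ 2) <= n%:R.
  by apply: ltW; rewrite /n; have := truncnS_gt (4 * F / (e * d ^+ 2)).
rewrite (_ : _ * n%:R = (4 * F / (e * d ^+ 2)) / n%:R * (e / 2)); last first.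
  by move: n0; move: (n%:R) => u u0; field; rewrite !gt_eqF.
by rewrite ler_piMl ?divr_ge0 ?(ltW e0) // ler_pdivrMr // mul1r.
Unshelve. all: by end_near.
Qed.
End Weierstrass.

Section MomentsToWeak.
Variable R : realType.

Lemma poly_bound (p : {poly R}) (b : R) : 0 < b -> exists2 D, 0 <= D &
  (forall k x, (size p <= k)%N -> b <= x -> `|p.[x]| <= D * (x / b) ^+ k).
Proof.
move=> b0; exists (\sum_(i < size p) `|p`_i| * b ^+ i).
  by apply: sumr_ge0 => i _; apply: mulr_ge0 => //; rewrite exprn_ge0 // ltW.
move=> k x sk bx; rewrite horner_coef; apply: le_trans (ler_norm_sum _ _ _) _.
rewrite mulr_suml; apply: ler_sum => i _.
have x1 : 1 <= x / b by rewrite ler_pdivlMr // mul1r.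
rewrite normrM -mulrA ler_wpM2l // normrX ger0_norm ?(le_trans (ltW b0)) //.
have -> : x ^+ i = b ^+ i * (x / b) ^+ i by rewrite -exprMn mulrC divfK // gt_eqF.
rewrite ler_wpM2l ?exprn_ge0 ?(ltW b0) // ler_weXn2l //.
by rewrite (leq_trans _ sk) // ltnW.
Qed.

Variable phi : R -> R.
Hypothesis phi_cont : {within `[0, +oo[, continuous phi}.
Variable F : R.
Hypothesis phi_bnd : forall x, 0 <= x -> `|phi x| <= F.

(** [D] does not depend on [k]: beyond [b] both [phi] and [p] are dominated by any power of [x / b]
    that is at least the size of [p]. This leaves [k] free to be taken large when moments grow more
    slowly than [b^k]. *)
Lemma weierstrass_halfline (b e : R) : 0 < b -> 0 < e -> exists (p : {poly R}) (D : R),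
  0 <= D /\ (forall k x, (size p <= k)%N -> 0 <= x -> `|phi x - p.[x]| <= e + D * (x / b) ^+ k).
Proof.
move=> b0 e0.
have F0 : 0 <= F by apply: le_trans (phi_bnd (lexx 0)).
have cphib : {within `[0, 1], continuous (fun x => phi (b * x))}.
  apply/subspace_continuousP => x /=; rewrite in_itv /= => /andP[x0 x1].
  move/subspace_continuousP: phi_cont => /(_ (b * x)).
  rewrite /= in_itv /= mulr_ge0 ?(ltW b0) // => /(_ isT) /cvgrPdist_le cp.
  apply/cvgrPdist_le => eps eps0; have := cp _ eps0; rewrite !near_withinE => -[d /= d0 hd].
  exists (d / b); first by rewrite /= divr_gt0.
  move=> y /= xy; rewrite in_itv /= => /andP[y0 y1]; apply: hd => /=.
    by rewrite -mulrBr normrM gtr0_norm // mulrC -ltr_pdivlMr.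
  by rewrite in_itv /= mulr_ge0 // ltW.
have [q hq] := weierstrass01 cphib e0.
pose p := q \Po (b^-1 *: 'X).
have hp x : 0 <= x -> x <= b -> `|phi x - p.[x]| <= e.
  move=> x0 xb; have := hq (b^-1 * x); rewrite mulrA mulfV ?gt_eqF // mul1r.
  rewrite horner_comp hornerZ hornerX; apply.
  by rewrite mulr_ge0 ?invr_ge0 ?(ltW b0) //= mulrC ler_pdivrMr // mul1r.
have [D D0 hD] := poly_bound p b0.
exists p, (F + D); split; first exact: addr_ge0.
move=> k x sk x0; have xk : 0 <= (x / b) ^+ k by rewrite exprn_ge0 // divr_ge0 // ltW.
have [xb|bx] := leP x b.
  apply: le_trans (hp x x0 xb) _; rewrite lerDl; apply: mulr_ge0 => //; exact: addr_ge0.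
apply: le_trans (ler_normB _ _) _; apply: ler_wpDl; first exact: ltW.
rewrite mulrDl; apply: lerD; last by apply: hD => //; exact: ltW.
apply: le_trans (phi_bnd x0) _; rewrite ler_peMr // exprn_ege1 //.
by rewrite ler_pdivlMr // mul1r ltW.
Qed.

Let D : set (measurableTypeR R) := `[0, +oo[.

Let mD : measurable D.
Proof. exact: measurable_itv. Qed.

Section Measure.
Variables (nu : {measure set (measurableTypeR R) -> \bar R}) (mm : nat -> R).
Hypothesis nu1 : nu D = 1%E.
Hypothesis nu_mm : forall k, (\int[nu]_(x in D) (x ^+ k)%:E = (mm k)%:E)%E.

Let D_ge0 x : D x -> 0 <= x.
Proof. by rewrite /D /= in_itv /= andbT. Qed.

Let mpow k : measurable_fun D (fun x : measurableTypeR R => x ^+ k : measurableTypeR R).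
Proof. exact: measurable_funX. Qed.

Let int_pow k : nu.-integrable D (EFin \o (fun x => x ^+ k)).
Proof.
apply/integrableP; split; first by apply/measurable_EFinP; exact: mpow.
under eq_integral => x.
  rewrite inE => /D_ge0 x0; rewrite /= ger0_norm ?exprn_ge0 //; over.
by rewrite nu_mm ltry.
Qed.

Let Rint_sum (a : nat -> R) n :
  nu.-integrable D (EFin \o (fun x => \sum_(i < n) a i * x ^+ i)) /\
  \int[nu]_(x in D) (\sum_(i < n) a i * x ^+ i) = \sum_(i < n) a i * mm i.
Proof.
elim: n => [|n [IHi IH]].
  split.
    rewrite (_ : _ \o _ = cst 0%E); first exact: integrable0.
    by apply/funext => x /=; rewrite big_ord0.
  rewrite big_ord0; under eq_Rintegral do rewrite big_ord0.
  by rewrite Rintegral_cst // mul0r.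
have iz : nu.-integrable D (EFin \o (fun x => a n * x ^+ n)).
  by have := integrableZl mD (a n) (int_pow n); apply: eq_integrable => // x _.
split.
  have := integrableD mD IHi iz; apply: eq_integrable => // x _ /=.
  by rewrite big_ord_recr.
rewrite big_ord_recr /= -IH.
have -> : a n * mm n = \int[nu]_(x in D) (a n * x ^+ n).
  by rewrite RintegralZl // /Rintegral nu_mm.
rewrite -RintegralD //; apply: eq_Rintegral => x _.
by rewrite big_ord_recr.
Qed.

Let int_phi : nu.-integrable D (EFin \o phi).
Proof.
apply: measurable_bounded_integrable => //.
- by rewrite nu1 ltry.
- exact: subspace_continuous_measurable_fun.
- exists F; split; rewrite ?num_real // => x Fx y /D_ge0 y0.
  by rewrite /= (le_trans (phi_bnd y0)) // ltW.
Qed.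

Lemma integral_poly_approx (p : {poly R}) e c k :
  (forall x, 0 <= x -> `|phi x - p.[x]| <= e + c * x ^+ k) ->
  `|\int[nu]_(x in D) phi x - \sum_(i < size p) p`_i * mm i| <= e + c * mm k.
Proof.
move=> h; have [ip Rp] := Rint_sum (fun i => p`_i) (size p).
have ib : nu.-integrable D (EFin \o (fun x => phi x - \sum_(i < size p) p`_i * x ^+ i)).
  by have := integrableB mD int_phi ip; apply: eq_integrable.
have [ic Rc] := Rint_sum (fun i => if i == 0%N then e else 0) 1.
have ie : nu.-integrable D (EFin \o cst e).
  by move: ic; apply: eq_integrable => // x _ /=; rewrite big_ord1 /= expr0 mulr1.
have iz : nu.-integrable D (EFin \o (fun x => c * x ^+ k)).
  by have := integrableZl mD c (int_pow k); apply: eq_integrable.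
rewrite -Rp -RintegralB //.
apply: le_trans (le_normr_Rintegral _ _) _ => //.
have -> : e + c * mm k = \int[nu]_(x in D) (e + c * x ^+ k).
  rewrite RintegralD // Rintegral_cst // nu1 mulr1 RintegralZl //.
  by rewrite /Rintegral nu_mm.
apply: le_Rintegral => //.
- by have := integrable_abse ib; apply: eq_integrable.
- by have := integrableD mD ie iz; apply: eq_integrable.
- by move=> x /D_ge0 x0; rewrite -horner_coef; exact: h.
Qed.
End Measure.

Lemma average_poly_approx n (lam : 'I_n -> R) (p : {poly R}) e c k :
  (0 < n)%N -> (forall i, 0 <= lam i) ->
  (forall x, 0 <= x -> `|phi x - p.[x]| <= e + c * x ^+ k) ->
  `|n%:R^-1 * \sum_i phi (lam i) -
    \sum_(i < size p) p`_i * (n%:R^-1 * \sum_j lam j ^+ i)| <=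
  e + c * (n%:R^-1 * \sum_j lam j ^+ k).
Proof.
move=> n0 l0 h.
have -> : \sum_(i < size p) p`_i * (n%:R^-1 * \sum_j lam j ^+ i) =
    n%:R^-1 * \sum_j p.[lam j].
  under [in RHS]eq_bigr do rewrite horner_coef.
  rewrite exchange_big mulr_sumr; apply: eq_bigr => i _ /=.
  by rewrite mulrCA mulr_sumr.
have -> : e + c * (n%:R^-1 * \sum_j lam j ^+ k) = n%:R^-1 * \sum_j (e + c * lam j ^+ k).
  rewrite big_split /= sumr_const card_ord -mulr_sumr mulrDr [in RHS]mulrCA.
  by rewrite -[e *+ n]mulr_natl [n%:R^-1 * (_ * e)]mulrA mulVf ?mul1r // pnatr_eq0 -lt0n.
rewrite -mulrBr -sumrB normrM ger0_norm ?invr_ge0 // ler_wpM2l ?invr_ge0 //.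
apply: le_trans (ler_norm_sum _ _ _) _; apply: ler_sum => i _; exact: h.
Qed.

Lemma cvg_sum0 n (u : 'I_n -> nat -> R) :
  (forall i, u i N @[N --> \oo] --> 0) -> \sum_(i < n) u i N @[N --> \oo] --> 0.
Proof.
elim: n u => [|n IH] u h; first by under eq_fun do rewrite big_ord0; exact: cvg_cst.
under eq_fun do rewrite big_ord_recl.
have : u ord0 N + \sum_(i < n) u (lift ord0 i) N @[N --> \oo] --> 0 + 0.
  by apply: cvgD; [exact: h|apply: IH => i; exact: h].
by rewrite addr0.
Qed.

Lemma cvgM0 (c : R) (u : nat -> R) :
  u N @[N --> \oo] --> 0 -> c * u N @[N --> \oo] --> 0.
Proof.
move=> h; have : c * u N @[N --> \oo] --> c * 0 by apply: cvgMr.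
by rewrite mulr0.
Qed.

Lemma moments_cvg_weak (n : nat -> nat) (lam : forall N, 'I_(n N) -> R)
    (nu : nat -> {measure set (measurableTypeR R) -> \bar R}) (mm : nat -> nat -> R) (K : R) :
  0 < K ->
  (\forall N \near \oo, [/\ (0 < n N)%N, forall i, 0 <= lam N i, nu N D = 1%E,
     forall k, (\int[nu N]_(x in D) (x ^+ k)%:E = (mm N k)%:E)%E &
     forall k, mm N k <= K ^+ k]) ->
  (forall k, (n N)%:R^-1 * \sum_i lam N i ^+ k - mm N k @[N --> \oo] --> 0) ->
  (n N)%:R^-1 * \sum_i phi (lam N i) - \int[nu N]_(x in D) phi x @[N --> \oo] --> 0.
Proof.
move=> K0 ev cv; apply/cvgrPdist_le => e e0.
(* With [b = 2 K] and moments at most [K^k], the tail term is at most [c / 2^k], and [k] is then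
   chosen to make it small. *)
have b0 : 0 < 2 * K by rewrite mulr_gt0.
(* Six errors: two for the approximation of [phi] by [p], one for the polynomial average, one for
   the tail of [nu N], and two for the tail of the eigenvalues, compared with that of [nu N]. *)
have e4 : 0 < e / 6 by rewrite divr_gt0.
have [p [c [c0 hp]]] := weierstrass_halfline b0 e4.
pose k := maxn (size p) (Num.truncn (c / (e / 6))).+1.
have ck : c <= e / 6 * 2 ^+ k.
  rewrite -ler_pdivrMl // mulrC; apply: le_trans (ltW (truncnS_gt _)) _.
  apply: (@le_trans _ _ k%:R); first by rewrite ler_nat leq_maxr.
  by rewrite -natrX ler_nat ltnW // ltn_expl.
pose c' := c / (2 * K) ^+ k.
have c'K : c' * K ^+ k <= e / 6.
  rewrite /c' exprMn invfM mulrA divfK ?expf_neq0 ?gt_eqF //.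
  by rewrite ler_pdivrMr ?exprn_gt0.
have c'0 : 0 <= c' by rewrite divr_ge0 // exprn_ge0 // ltW.
have hp' x : 0 <= x -> `|phi x - p.[x]| <= e / 6 + c' * x ^+ k.
  move=> x0; apply: le_trans (hp k x _ x0) _; first exact: leq_maxl.
  by rewrite lerD2l expr_div_n mulrA mulrAC.
have cs : \sum_(i < size p) p`_i * ((n N)%:R^-1 * \sum_j lam N j ^+ i - mm N i)
    @[N --> \oo] --> 0.
  by apply: cvg_sum0 => i; apply: cvgM0; exact: cv.
have ck' : c' * ((n N)%:R^-1 * \sum_j lam N j ^+ k - mm N k) @[N --> \oo] --> 0.
  by apply: cvgM0; exact: cv.
move/cvgrPdist_le: cs => /(_ _ e4) cs; move/cvgrPdist_le: ck' => /(_ _ e4) ck'.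
near=> N.
have [n0 l0 nu1 num mK] : [/\ (0 < n N)%N, forall i, 0 <= lam N i, nu N D = 1%E,
     forall k, (\int[nu N]_(x in D) (x ^+ k)%:E = (mm N k)%:E)%E &
     forall k, mm N k <= K ^+ k] by near: N.
have h1 := average_poly_approx n0 l0 hp'.
have h2 := integral_poly_approx nu1 num hp'.
have h3 : `|0 - \sum_(i < size p) p`_i * ((n N)%:R^-1 * \sum_j lam N j ^+ i - mm N i)| <= e / 6.
  by near: N.
have h4 : `|0 - c' * ((n N)%:R^-1 * \sum_j lam N j ^+ k - mm N k)| <= e / 6 by near: N.
have h5 : c' * mm N k <= e / 6 by apply: le_trans c'K; exact: ler_wpM2l.
have h6 : \sum_(i < size p) p`_i * ((n N)%:R^-1 * \sum_j lam N j ^+ i - mm N i) =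
    \sum_(i < size p) p`_i * ((n N)%:R^-1 * \sum_j lam N j ^+ i) -
    \sum_(i < size p) p`_i * mm N i.
  by rewrite -sumrB; apply: eq_bigr => i _; rewrite mulrBr.
move: h1 h2 h3 h4; rewrite h6 mulrBr !ler_norml.
move: (\int[nu N]_(x in D) phi x) => I.
move: (\sum_(i < size p) p`_i * mm N i) (c' * mm N k) h5 => U V h5.
move: (c' * _) (_ * \sum_i phi (lam N i)) (\sum_(i < size p) _) => W X Y.
move=> /andP[? ?] /andP[? ?] /andP[? ?] /andP[? ?]; apply/andP; split; lra.
Unshelve. all: by end_near.
Qed.

End MomentsToWeak.

(** * Almost sure convergence from fourth moments *)

Section AlmostSure.
Variables (R : realType) (d : measure_display) (Omega : measurableType d).
Variable P : probability Omega R.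

Lemma sum_inv_sqr_le (n : nat) : \sum_(i < n) (i.+1%:R ^+ 2)^-1 <= 2 * (1 - n.+1%:R^-1) :> R.
Proof.
elim: n => [|n IH]; first by rewrite big_ord0 invr1; lra.
rewrite big_ord_recr /=; apply: le_trans (lerD IH (lexx _)) _.
rewrite -[n.+2%:R]natr1; have : (1 : R) <= n.+1%:R by rewrite ler1n.
move: (n.+1%:R : R) => x x1; have x0 : 0 < x by lra.
have x10 : 0 < x + 1 by lra.
rewrite -subr_ge0 (_ : _ - _ = (x - 1) / (x ^+ 2 * (x + 1))).
  by apply: divr_ge0; [lra|apply: mulr_ge0; [exact: sqr_ge0|lra]].
by field; rewrite !gt_eqF.
Qed.

(** The sum of the fourth powers has a finite integral, hence is almost everywhere finite, and its
    terms tend to 0; this takes the place of Markov's inequality and Borel-Cantelli. *)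
Lemma fourth_moment_ae (f : nat -> Omega -> R) (c : R) (N0 : nat) : 0 <= c ->
  (forall N, (N0 <= N)%N -> measurable_fun setT (f N)) ->
  (forall N, (N0 <= N)%N -> (\int[P]_t (f N t ^+ 4)%:E <= (c / N.+1%:R ^+ 2)%:E)%E) ->
  {ae P, forall t, f N t @[N --> \oo] --> 0}.
Proof.
move=> c0 mf hf.
pose u m t := (f (m + N0)%N t ^+ 4)%:E.
have u0 m t : (0 <= u m t)%E by rewrite lee_fin (_ : 4 = 2 * 2)%N // exprM sqr_ge0.
have mu m : measurable_fun setT (u m).
  by apply/measurable_EFinP; apply: measurable_funX; apply: mf; exact: leq_addl.
have mS : measurable_fun setT (fun t => \sum_(m <oo) u m t)%E.
  by apply: ge0_emeasurable_sum => // *; exact: u0.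
have iS : P.-integrable setT (fun t => \sum_(m <oo) u m t)%E.
  apply/integrableP; split => //.
  under eq_integral => t _ do rewrite gee0_abs ?nneseries_ge0 //.
  rewrite integral_nneseries //.
  apply: (@le_lt_trans _ _ (c * 2)%:E); last exact: ltry.
  apply: lime_le.
    by apply: is_cvg_ereal_nneg_natsum => m _; apply: integral_ge0 => *; exact: u0.
  near=> n; rewrite big_mkord.
  apply: (@le_trans _ _ (\sum_(i < n) (c * (i.+1%:R ^+ 2)^-1)%:E)%E).
    apply: lee_sum => i _; apply: le_trans (hf _ (leq_addl _ _)) _.
    rewrite lee_fin ler_wpM2l // lef_pV2 ?posrE ?exprn_gt0 ?ltr0n //.
    by rewrite lerXn2r ?nnegrE // ler_nat ltnS leq_addr.
  rewrite sumEFin lee_fin -mulr_sumr ler_wpM2l //.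
  apply: le_trans (sum_inv_sqr_le n) _.
  by rewrite ler_piMr // gerBl invr_ge0.
have := integrable_ae measurableT iS; apply: filterS => t /(_ I) fin.
rewrite -(cvg_shiftn N0); apply/cvgrPdist_le => e e0.
have Sfin : (\sum_(m <oo) u m t < +oo)%E.
  by move: fin; rewrite fin_numE => /andP[_]; rewrite -ltey.
have tl := nneseries_tail_cvg Sfin (fun k _ => u0 k t).
have u_cvg : u m t @[m --> \oo] --> 0%E.
  apply: (squeeze_cvge _ (cvg_cst 0%E) tl).
  near=> m; rewrite u0 /=.
  rewrite (nneseries_split m 1); last by move=> *; exact: u0.
  by rewrite addn1 big_nat1 leeDl // nneseries_ge0.
have e4 : 0 < e ^+ 4 by rewrite exprn_gt0.
have /fine_cvgP[_ /cvgrPdist_le/(_ _ e4)] := u_cvg; apply: filterS => m /=.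
rewrite !sub0r !normrN normrX => h.
by move: h; rewrite ler_pXn2r ?nnegrE // ltW.
Unshelve. all: by end_near.
Qed.
End AlmostSure.

Local Open Scope sesquilinear_scope.
Local Open Scope complex_scope.

Module GaussianModel.

Local Notation Re := complex.Re.
Local Notation Im := complex.Im.
Local Notation "z ^*" := (Num.conj z) : complex_scope.

Lemma cReM (R : rcfType) (x y : R[i]) : Re (x * y) = Re x * Re y - Im x * Im y.
Proof. by case: x; case: y. Qed.
Lemma cImM (R : rcfType) (x y : R[i]) : Im (x * y) = Re x * Im y + Im x * Re y.
Proof. by case: x; case: y. Qed.
Lemma cReD (R : rcfType) (x y : R[i]) : Re (x + y) = Re x + Re y.
Proof. by case: x; case: y. Qed.
Lemma cImD (R : rcfType) (x y : R[i]) : Im (x + y) = Im x + Im y.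
Proof. by case: x; case: y. Qed.
Lemma conjC_complex (R : rcfType) (x y : R) : (x +i* y)^* = x +i* (- y).
Proof. by []. Qed.
Lemma cRe_conj (R : rcfType) (x : R[i]) : Re (x^*) = Re x.
Proof. by case: x. Qed.
Lemma cIm_conj (R : rcfType) (x : R[i]) : Im (x^*) = - Im x.
Proof. by case: x. Qed.

(** * Circular Gaussian vectors *)

Section ComplexIntegral.
Context (R : realType) (d : measure_display) (T : measurableType d).
Variables (mu : {measure set T -> \bar R}) (D : set T) (mD : measurable D).
Implicit Types f g : T -> R[i].

Definition cintegrable f :=
  mu.-integrable D (EFin \o (fun t => Re (f t))) /\
  mu.-integrable D (EFin \o (fun t => Im (f t))).

Lemma cintegrable_lin c f g : cintegrable f -> cintegrable g ->
  cintegrable (fun t => c * f t + g t).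
Proof.
move=> [rf iF] [rg ig]; split.
  have h := integrableD mD (integrableB mD (integrableZl mD (Re c) rf)
    (integrableZl mD (Im c) iF)) rg.
  apply: eq_integrable h => // t _ /=.
  by rewrite cReD cReM.
have h := integrableD mD (integrableD mD (integrableZl mD (Re c) iF)
    (integrableZl mD (Im c) rf)) ig.
apply: eq_integrable h => // t _ /=.
by rewrite cImD cImM.
Qed.

Lemma cintegral_lin c f g : cintegrable f -> cintegrable g ->
  cintegral mu D (fun t => c * f t + g t) = c * cintegral mu D f + cintegral mu D g.
Proof.
move=> [rf iF] [rg ig]; rewrite /cintegral.
have E1 : \int[mu]_(x in D) Re (c * f x + g x) =
   Re c * \int[mu]_(x in D) Re (f x) - Im c * \int[mu]_(x in D) Im (f x)
    + \int[mu]_(x in D) Re (g x).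
  have i1 := integrableZl mD (Re c) rf; have i2 := integrableZl mD (Im c) iF.
  rewrite -!RintegralZl // -RintegralB //.
  rewrite -RintegralD //; last first.
    exact: (integrableB mD (integrableZl mD (Re c) rf) (integrableZl mD (Im c) iF)).
  by apply: eq_Rintegral => t _; rewrite cReD cReM.
have E2 : \int[mu]_(x in D) Im (c * f x + g x) =
   Re c * \int[mu]_(x in D) Im (f x) + Im c * \int[mu]_(x in D) Re (f x)
    + \int[mu]_(x in D) Im (g x).
  have i1 := integrableZl mD (Re c) iF; have i2 := integrableZl mD (Im c) rf.
  rewrite -!RintegralZl // -RintegralD //.
  rewrite -RintegralD //; last first.
    exact: (integrableD mD (integrableZl mD (Re c) iF) (integrableZl mD (Im c) rf)).
  by apply: eq_Rintegral => t _; rewrite cImD cImM.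
by rewrite E1 E2; case: c {E1 E2} => a b; apply/eqP; rewrite eq_complex /= !eqxx.
Qed.

Lemma cintegral_conj f : cintegrable f ->
  cintegral mu D (fun t => (f t)^*) = (cintegral mu D f)^*.
Proof.
move=> [rf iF]; rewrite /cintegral conjC_complex; congr (_ +i* _).
  by apply: eq_Rintegral => t _; rewrite cRe_conj.
by rewrite -mulN1r -RintegralZl //; apply: eq_Rintegral => t _; rewrite cIm_conj mulN1r.
Qed.

Lemma cintegralZ c f : cintegrable f ->
  cintegral mu D (fun t => c * f t) = c * cintegral mu D f.
Proof.
move=> fi; have i0 : cintegrable (fun=> 0) by split; exact: integrable0.
transitivity (cintegral mu D (fun t => c * f t + 0)).
  by congr cintegral; apply/funext => t; rewrite addr0.
rewrite cintegral_lin // (_ : cintegral mu D (fun=> 0) = 0) ?addr0 //.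
by rewrite /cintegral /Rintegral /= integral0.
Qed.

Lemma cintegral_real (f : T -> R) :
  cintegral mu D (fun t => (f t)%:C) = (\int[mu]_(x in D) f x)%:C.
Proof.
by rewrite /cintegral /= /Rintegral integral0.
Qed.

Lemma cintegrable_real (f : T -> R) : mu.-integrable D (EFin \o f) ->
  cintegrable (fun t => (f t)%:C).
Proof. by move=> h; split=> //=; exact: integrable0. Qed.

Lemma cintegral_ge0 f : (forall t, D t -> 0 <= f t) -> 0 <= cintegral mu D f.
Proof.
move=> f0; have E t : D t -> f t = (Re (f t))%:C.
  by move=> Dt; have := f0 t Dt; rewrite lecE => /andP[/eqP h _];
     apply/eqP; rewrite eq_complex /= eqxx h /=.
rewrite (_ : cintegral mu D f = (\int[mu]_(x in D) Re (f x))%:C).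
  rewrite lecE /= eqxx /=; apply: Rintegral_ge0 => t Dt.
  by have := f0 t Dt; rewrite lecE => /andP[].
rewrite -cintegral_real /cintegral; congr (_ +i* _).
by apply: eq_Rintegral => t /set_mem Dt; rewrite {1}E.
Qed.

End ComplexIntegral.

Lemma poly_nat_eq0 (C : numFieldType) (p : {poly C}) :
  (forall t : nat, p.[t%:R] = 0) -> p = 0.
Proof.
move=> h; apply/eqP; apply: contraT => p0.
have u : uniq [seq (i%:R : C) | i <- iota 0 (size p)].
  rewrite map_inj_uniq ?iota_uniq // => i j /eqP.
  by rewrite eqr_nat => /eqP.
have r : all (root p) [seq (i%:R : C) | i <- iota 0 (size p)].
  by apply/allP => x /mapP[i _ ->]; rewrite /root h.
by have := max_poly_roots p0 r u; rewrite size_map size_iota ltnn.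
Qed.

Lemma mulr_le_sqrD (R : realFieldType) (a b : R) : a * b <= a ^+ 2 + b ^+ 2.
Proof. by have := sqr_ge0 (a - b); have := sqr_ge0 a; have := sqr_ge0 b; lra. Qed.

(** * From one-dimensional Gaussian laws to joint integration by parts *)

Section LinearPolarize.
Variables (C : numClosedFieldType) (A : comAlgType C) (F : {linear A -> C^o}).

(** The polynomial [t -> F ((l + t x)^n)]; its coefficient of degree 1 polarizes powers of [l]. *)
Definition lin_poly (l x : A) n : {poly C} :=
  \sum_(i < n.+1) (F (l ^+ (n - i) * x ^+ i) *+ 'C(n, i)) *: 'X^i.

Lemma lin_polyE l x n t : (lin_poly l x n).[t] = F ((l + t *: x) ^+ n).
Proof.
rewrite /lin_poly horner_sum exprDn linear_sum; apply: eq_bigr => i _.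
rewrite linearMn hornerZ hornerXn exprZn -scalerAr linearZ /=.
by rewrite -[_ *: (_ : C^o)]/(_ * _) -mulrnAr [LHS]mulrC.
Qed.

Lemma lin_poly0 l x n : (lin_poly l x n)`_0 = F (l ^+ n).
Proof.
by rewrite -horner_coef0 lin_polyE scale0r addr0.
Qed.

Lemma lin_poly1 l x n : (lin_poly l x n.+1)`_1 = n.+1%:R * F (l ^+ n * x).
Proof.
rewrite /lin_poly coef_sum (bigD1 (@Ordinal n.+2 1 isT)) //= big1; last first.
  by move=> i ni; rewrite coefZ coefXn; case: eqP => [e|_]; rewrite ?mulr0 //;
     case/eqP: ni; apply: val_inj.
by rewrite addr0 coefZ coefXn eqxx mulr1 subn1 expr1 bin1 mulr_natl.
Qed.

Lemma lin_polarize l x n : (forall t : nat, F ((l + t%:R *: x) ^+ n.+1) = 0) ->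
  F (l ^+ n * x) = 0.
Proof.
move=> h; have := @poly_nat_eq0 _ (lin_poly l x n.+1).
move=> /(_ (fun t => etrans (lin_polyE _ _ _ _) (h t))) e.
have := lin_poly1 l x n; rewrite e coef0 => /esym/eqP.
by rewrite mulf_eq0 pnatr_eq0 /= => /eqP.
Qed.
End LinearPolarize.

Section GaussianFunctional.
Context (R : realType) (d : measure_display) (T : measurableType d) (P : probability T R).
Context (V : finType) (x : T -> V -> R).
Hypothesis x_gauss : forall a : V -> R, gaussian_rv P (fun t => \sum_v a v * x t v).
Hypothesis x_mean : forall v, \int[P]_t x t v = 0.
Local Notation C := R[i].
Variable A : polyAlg C V.
Local Notation X := (pvar A).
Local Notation D := (pder A).
Local Notation ev t := (pev A (fun v => (x t v)%:C)).

Let lf t (a : V -> R) := \sum_v a v * x t v.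

Let sum_delta t v : lf t (fun u => (u == v)%:R) = x t v.
Proof.
rewrite /lf (bigD1 v) //= eqxx mul1r big1 ?addr0 // => u /negPf ->.
by rewrite mul0r.
Qed.

Let x_gauss1 v : gaussian_rv P (fun t => x t v).
Proof.
have := x_gauss (fun u => (u == v)%:R); congr (gaussian_rv P _).
by apply/funext => t; exact: sum_delta.
Qed.

Let x_mom v : forall k, P.-integrable setT (EFin \o (fun t => x t v ^+ k)).
Proof. exact: (gaussian_moments (x_gauss1 v) (x_mean v)).1. Qed.

Let x_int v : P.-integrable setT (EFin \o (fun t => x t v)).
Proof. exact: (x_mom v 1). Qed.

Let lf_mean a : \int[P]_t lf t a = 0.
Proof.
rewrite /lf.
have h (s : seq V) : P.-integrable setT (EFin \o (fun t => \sum_(v <- s) a v * x t v)) /\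
    \int[P]_t (\sum_(v <- s) a v * x t v) = 0.
  elim: s => [|v s [ih1 ih2]].
    rewrite (_ : (fun t => \sum_(v <- [::]) a v * x t v) = (fun _ => 0)); last first.
      by apply/funext => t; rewrite big_nil.
    by split; [exact: integrable0|rewrite /Rintegral integral0].
  have i1 : P.-integrable setT (EFin \o (fun t => a v * x t v)).
    exact: (integrableZl measurableT (a v) (x_int v)).
  split.
    have := integrableD measurableT i1 ih1; apply: eq_integrable => // t _ /=.
    by rewrite big_cons.
  under eq_Rintegral do rewrite big_cons.
  by rewrite RintegralD // ih2 RintegralZl // x_mean mulr0 addr0.
by have [_] := h (index_enum V).
Qed.

Let prod_int (s : seq V) k : P.-integrable setT (EFin \o (fun t => (\prod_(v <- s) x t v) ^+ k)).
Proof.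
elim: s k => [|v s IH] k.
  apply: (@eq_integrable _ _ _ _ _ _ (fun _ => 1%:E)) => //.
    by move=> t _ /=; rewrite big_nil expr1n.
  exact: finite_measure_integrable_cst.
(* Products are dominated through [|a b| <= a^2 + b^2], which doubles the exponent; this is why the
   induction is over all powers [k]. *)
have i1 := integrableD measurableT (x_mom v (2 * k)) (IH (2 * k)%N).
apply: (le_integrable measurableT) i1.
  have h1 := measurable_int _ (x_int v); have h2 := measurable_int _ (IH 1%N).
  apply/measurable_EFinP; apply: measurable_funX.
  move/measurable_EFinP in h1; move/measurable_EFinP in h2.
  have := measurable_funM h1 h2; congr measurable_fun.
  by apply/funext => t /=; rewrite big_cons expr1.
move=> t _ /=; rewrite lee_fin big_cons exprMn ![(2 * k)%N]mulnC !exprM normrM.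
set a := x t v ^+ k; set b := (\prod_(j <- s) x t j) ^+ k.
rewrite -[a ^+ 2]real_normK ?num_real // -[b ^+ 2]real_normK ?num_real //.
rewrite [leRHS]ger0_norm ?addr_ge0 ?sqr_ge0 //.
exact: mulr_le_sqrD.
Qed.

Lemma cintegrable_pev f : cintegrable P setT (fun t => ev t f).
Proof.
move: f; apply: pind_prod => [s|c f g hf hg].
  rewrite (_ : (fun t => _) = fun t => (\prod_(v <- s) x t v)%:C).
    by apply: cintegrable_real; exact: (prod_int s 1).
  apply/funext => t; rewrite !rmorph_prod; apply: eq_bigr => v _.
  by rewrite pev_var.
rewrite (_ : (fun t => _) = fun t => c * ev t f + ev t g).
  exact: cintegrable_lin.
by apply/funext => t; rewrite rmorphD /= pevZ.
Qed.

Let E0 (f : A) : C^o := cexpectation P (fun t => ev t f).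

Let E0_lin : linear E0.
Proof.
move=> c f g; rewrite /E0 /cexpectation -[in RHS]/(c * _ + _).
rewrite -cintegral_lin //; try exact: cintegrable_pev.
by congr cintegral; apply/funext => t; rewrite rmorphD /= pevZ.
Qed.

Let E_ex : {F : {linear A -> C^o} | forall f, F f = E0 f}.
Proof.
pose F : {linear A -> C^o} := HB.pack E0 (GRing.isLinear.Build _ _ _ _ E0 E0_lin).
by exists F.
Qed.

Let E : {linear A -> C^o} := sval E_ex.

Let EE f : E f = cexpectation P (fun t => ev t f).
Proof. exact: (svalP E_ex). Qed.

Let E1 : E 1 = 1.
Proof.
rewrite EE /cexpectation (_ : (fun t => _) = fun t => (1 : R)%:C).
  by rewrite cintegral_real /Rintegral integral_cst //= probability_setT mule1.
by apply/funext => t; rewrite rmorph1.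
Qed.

Let real_ev t v : (x t v)%:C \is Num.real.
Proof. by rewrite complex_real. Qed.

Let lin (a : V -> R) : A := \sum_v (a v)%:C *: X v.

Let ev_lin t a : ev t (lin a) = (lf t a)%:C.
Proof.
rewrite /lin /lf !rmorph_sum /=; apply: eq_bigr => v _.
by rewrite pevZ pev_var rmorphM.
Qed.

Let E_lin_mom a k : E (lin a ^+ k.+2) = k.+1%:R * E (lin a ^+ 2) * E (lin a ^+ k).
Proof.
have e j : E (lin a ^+ j) = (\int[P]_t (lf t a ^+ j))%:C.
  rewrite EE /cexpectation -cintegral_real; congr cintegral.
  by apply/funext => t; rewrite !rmorphXn /= ev_lin.
rewrite !e (gaussian_moments (x_gauss a) (lf_mean a)).2 !rmorphM /=.
by rewrite rmorph_nat.
Qed.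

Let E_lin a : E (lin a) = 0.
Proof.
rewrite EE /cexpectation (_ : (fun t => _) = fun t => (lf t a)%:C).
  by rewrite cintegral_real lf_mean.
by apply/funext => t; rewrite ev_lin.
Qed.

Let linD a v (t : R) : lin a + t%:C *: X v = lin (fun u => a u + t * (u == v)%:R).
Proof.
rewrite /lin; under [RHS]eq_bigr do rewrite rmorphD /= scalerDl.
rewrite big_split /=; congr (_ + _); rewrite (bigD1 v) //= eqxx mulr1 big1 ?addr0 //.
by move=> u /negPf ->; rewrite mulr0 scale0r.
Qed.

(** The moment recursion of the Gaussian variables [lin a + t X_v] is an identity of polynomials in
    [t], as it holds at all naturals. Comparing the coefficients of [t] relates orders two apart,
    hence the two-step induction. *)
Let E_lin_var a v n : E (lin a ^+ n.+1 * X v) = n.+1%:R * E (lin a * X v) * E (lin a ^+ n).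
Proof.
pose p j := lin_poly E (lin a) (X v) j.
have h k : p k.+2 = (k.+1%:R *: p 2%N) * p k.
  apply/eqP; rewrite -subr_eq0; apply/eqP; apply: poly_nat_eq0 => t.
  rewrite !hornerE !lin_polyE.
  have -> : (t%:R : C) = (t%:R : R)%:C by rewrite rmorph_nat.
  by rewrite linD E_lin_mom subrr.
have hc k : k.+2%:R * E (lin a ^+ k.+1 * X v) =
    k.+1%:R * (E (lin a ^+ 2) * (p k)`_1 + 2 * E (lin a * X v) * E (lin a ^+ k)).
  have := congr1 (fun q : {poly C} => q`_1) (h k).
  rewrite /p lin_poly1 coefM big_ord_recl big_ord1 /= !coefZ !lin_poly0 lin_poly1 expr1.
  by move=> ->; ring.
suff H : E (lin a ^+ n.+1 * X v) = n.+1%:R * E (lin a * X v) * E (lin a ^+ n) /\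
    E (lin a ^+ n.+2 * X v) = n.+2%:R * E (lin a * X v) * E (lin a ^+ n.+1) by case: H.
have n0 k : k.+1%:R != 0 :> C by rewrite pnatr_eq0.
elim: n => [|n [IH1 IH2]].
  split.
    apply: (mulfI (n0 1%N)); rewrite hc /p /lin_poly big_ord1 coefZ coefXn /=.
    by rewrite !mulr0 expr0 E1; ring.
  apply: (mulfI (n0 2%N)); rewrite hc /p lin_poly1 expr0 mul1r expr1 E_lin.
  have -> : E (X v) = 0.
    rewrite -[RHS](E_lin (fun u => (u == v)%:R)) /lin (bigD1 v) //= eqxx scale1r.
    by rewrite big1 ?addr0 // => u /negPf ->; rewrite scale0r.
  by ring.
split=> //; apply: (mulfI (n0 n.+3)); rewrite hc /p lin_poly1 IH1 [E (lin a ^+ n.+2)]E_lin_mom.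
by rewrite -[n.+4]addn2 -[n.+3]addn1 !natrD; ring.
Qed.

(** The defect [F] is linear and vanishes on powers of linear forms. [lin_polarize] turns such a
    power into a lower one times a variable, so it also vanishes on monomials times powers;
    therefore the induction on the monomial quantifies over [a] and [n]. *)
Let ibp v f : E (X v * f) = \sum_w E (X v * X w) * E (D w f).
Proof.
pose F0 (g : A) : C^o := E (X v * g) - \sum_w E (X v * X w) * E (D w g).
have F0_lin : linear F0.
  move=> c g h; rewrite /F0 mulrDr -scalerAr !linearP /=.
  under eq_bigr do rewrite !linearP /= mulrDr.
  rewrite big_split /= [X in _ - (X + _)](_ : _ = c * \sum_w E (X v * X w) * E (D w g)).
    by rewrite -![_ *: (_ : C^o)]/(_ * _); ring.
  by rewrite mulr_sumr; apply: eq_bigr => w _; rewrite -[_ *: (_ : C^o)]/(_ * _) mulrCA.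
pose F : {linear A -> C^o} := HB.pack F0 (GRing.isLinear.Build _ _ _ _ F0 F0_lin).
suff F0z g : F g = 0 by apply/eqP; rewrite -subr_eq0; apply/eqP; exact: F0z.
have D_lin w a : D w (lin a) = (a w)%:C%:A.
  rewrite /lin linear_sum (bigD1 w) //= linearZ /= pder_var eqxx big1 ?addr0 //.
  by move=> u /negPf nu; rewrite linearZ /= pder_var eq_sym nu scaler0.
have D_exp w a n : D w (lin a ^+ n.+1) = (n.+1%:R * (a w)%:C) *: lin a ^+ n.
  elim: n => [|n IH]; first by rewrite expr1 D_lin expr0 mul1r.
  rewrite exprS pderM IH D_lin -scalerAr -exprS -scalerAl mul1r -scalerDl.
  by congr (_ *: _); rewrite -[n.+2]add1n natrD; ring.
have Fl a n : F (lin a ^+ n) = 0.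
  rewrite /= /F0; case: n => [|n].
    rewrite big1 => [|w _]; last by rewrite pder1 linear0 mulr0.
    rewrite mulr1 subr0.
    rewrite -[RHS](E_lin (fun u => (u == v)%:R)) /lin (bigD1 v) //= eqxx scale1r.
    by rewrite big1 ?addr0 // => u /negPf ->; rewrite scale0r.
  rewrite mulrC E_lin_var; apply/eqP; rewrite subr_eq0; apply/eqP.
  under eq_bigr do rewrite D_exp linearZ /=.
  rewrite /lin mulr_suml linear_sum /= mulr_sumr mulr_suml; apply: eq_bigr => w _.
  have -> : E ((a w)%:C *: X w * X v) = (a w)%:C * E (X v * X w).
    by rewrite -scalerAl linearZ /= mulrC.
  by rewrite -![_ *: (_ : C^o)]/(_ * _); ring.
move: g; apply: pind_prod => [s|c g h Fg Fh]; last by rewrite linearP Fg Fh scaler0 addr0.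
suff H : forall a n, F (\prod_(u <- s) X u * lin a ^+ n) = 0.
  by have := H (fun _ => 0) 0%N; rewrite mulr1.
elim: s => [|u s IH] a n; first by rewrite big_nil mul1r Fl.
pose Fs0 (g : A) : C^o := F (\prod_(u <- s) X u * g).
have Fs0_lin : linear Fs0 by move=> c g h; rewrite /Fs0 mulrDr -scalerAr linearP.
pose Fs : {linear A -> C^o} := HB.pack Fs0 (GRing.isLinear.Build _ _ _ _ Fs0 Fs0_lin).
have := @lin_polarize _ _ Fs (lin a) (X u) n.
rewrite big_cons /= /Fs0 => <-.
  by congr (F _); ring.
move=> t; have -> : (t%:R : C) = (t%:R : R)%:C by rewrite rmorph_nat.
by rewrite linD IH.
Qed.

Let E_ge0 f : (forall t, 0 <= ev t f) -> 0 <= E f.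
Proof. by move=> h; rewrite EE; apply: cintegral_ge0 => t _; exact: h. Qed.

Definition gaussian_functional : gaussFun A :=
  @GaussFun C V A T (fun t v => (x t v)%:C) real_ev E E1 E_ge0 ibp.

Lemma gaussian_functionalE f :
  gaussian_functional f = cexpectation P (fun t => ev t f).
Proof. exact: EE. Qed.
End GaussianFunctional.

Section GaussianMatrix.
Context (R : realType) (d : measure_display) (T : measurableType d) (P : probability T R).
Local Notation C := R[i].
Context (n p : nat) (a : angle C n p) (W : T -> 'M[C]_(n, p)) (kap : C).
Local Notation I2 := ('I_n * 'I_p)%type.
Local Notation G := (pair_Gam a).
Hypothesis W_gauss : forall b c : I2 -> R, gaussian_rv P
  (fun t => \sum_q (b q * Re (W t q.1 q.2) + c q * Im (W t q.1 q.2))).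
Hypothesis W_mean : forall i j, cexpectation P (fun t => W t i j) = 0.
Hypothesis W_pseudo : forall i j k l, cexpectation P (fun t => W t i j * W t k l) = 0.
Hypothesis W_cov : forall i j k l,
  cexpectation P (fun t => W t i j * (W t k l)^*) = Gam a i j k l.
Hypothesis kap_ge0 : 0 <= kap.
Hypothesis kapP : forall D : I2 -> C,
  \sum_q \sum_r G q r * D q * (D r)^* <= kap * \sum_q D q * (D q)^*.

Let V : finType := (I2 * bool)%type.
Let x t (v : V) : R := if v.2 then Im (W t v.1.1 v.1.2) else Re (W t v.1.1 v.1.2).
Let A := polyAlg_exists C V.
Local Notation X := (pvar A).
Local Notation D := (pder A).
Local Notation star := (pstar A).
Local Notation ev t := (pev A (fun v => (x t v)%:C)).
Local Notation I := ('i : C).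

Let sumV (f : V -> C^o) : \sum_v f v = \sum_q (f (q, false) + f (q, true)).
Proof.
rewrite (eq_bigr (fun v : V => f (v.1, v.2))) => [|[q b] //].
rewrite -(pair_bigA _ (fun q b => f (q, b))) /=; apply: eq_bigr => q _.
by rewrite big_bool addrC.
Qed.

Let x_gauss (b : V -> R) : gaussian_rv P (fun t => \sum_v b v * x t v).
Proof.
have := W_gauss (fun q => b (q, false)) (fun q => b (q, true)).
congr (gaussian_rv P _); apply/funext => t.
rewrite [RHS](eq_bigr (fun v : V => b (v.1, v.2) * x t (v.1, v.2))) => [|[q e] //].
rewrite -(pair_bigA _ (fun q e => b (q, e) * x t (q, e))) /=; apply: eq_bigr => q _.
by rewrite big_bool addrC.
Qed.

Let x_mean v : \int[P]_t x t v = 0.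
Proof.
case: v => [[i j] b]; have := W_mean i j; rewrite /cexpectation /cintegral.
by move=> /eqP; rewrite eq_complex /= => /andP[/eqP h1 /eqP h2]; case: b.
Qed.

Let E := gaussian_functional x_gauss x_mean A.
Let EE f : E f = cexpectation P (fun t => ev t f).
Proof. exact: gaussian_functionalE. Qed.

Let w (q : I2) : A := X (q, false) + I *: X (q, true).

Let ev_w t q : ev t (w q) = W t q.1 q.2.
Proof.
rewrite /w rmorphD /= pevZ !pev_var /x /=.
case: (W t q.1 q.2) => u v /=; apply/eqP; rewrite eq_complex /=.
by rewrite !mul0r !mul1r subr0 !add0r addr0 !eqxx.
Qed.

Let ev_star t f : ev t (star f) = (ev t f)^*.
Proof. by apply: pev_star => v; rewrite complex_real. Qed.

Let E_ww q r : E (w q * w r) = 0.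
Proof.
rewrite EE -[RHS](W_pseudo q.1 q.2 r.1 r.2); congr cintegral.
by apply/funext => t; rewrite rmorphM /= !ev_w.
Qed.

Let E_wsw q r : E (w q * star (w r)) = G q r.
Proof.
rewrite EE -[RHS]W_cov; congr cintegral.
by apply/funext => t; rewrite rmorphM /= ev_star !ev_w.
Qed.

Lemma gmat_exists : exists (G : gmat a) (phi : T -> gOmega G),
  [/\ forall t i j, gev G (phi t) (gW G i j) = W t i j,
      forall f, cintegrable P setT (fun t => gev G (phi t) f),
      forall f, gEx G f = cexpectation P (fun t => gev G (phi t) f) &
      gkap G = kap].
Proof.
have wE q : w q = X (q, false) + 'i *: X (q, true) by [].
have [G' [phi [psi [h1 h2 h3 h4]]]] := gmat_of_gaussFun wE E_ww E_wsw kap_ge0 kapP.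
exists G', phi; split=> [t i j|f|f|//].
- by rewrite h1 h2; exact: ev_w.
- under eq_fun do rewrite h1; exact: cintegrable_pev.
- by rewrite h3 EE; congr cintegral; apply/funext => t; rewrite h1.
Qed.
End GaussianMatrix.

(** * The spectral covariance of block-Hankel matrices *)

Section ContinuousComplex.
Context (R : realType).
Local Notation C := R[i].
Local Notation leb := (@lebesgue_measure R).
Implicit Types f g : R -> C.

Definition ccont f := continuous (fun x => Re (f x)) /\ continuous (fun x => Im (f x)).

Lemma ccont_cst c : ccont (fun=> c).
Proof. by split=> x; exact: cvg_cst. Qed.

Lemma ccont_mul f g : ccont f -> ccont g -> ccont (fun x => f x * g x).
Proof.
move=> [rf jf] [rg jg]; split=> x.
  under eq_fun do rewrite cReM.
  by apply: cvgB; apply: cvgM; [exact: rf|exact: rg|exact: jf|exact: jg].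
under eq_fun do rewrite cImM.
by apply: cvgD; apply: cvgM; [exact: rf|exact: jg|exact: jf|exact: rg].
Qed.

Lemma ccont_add f g : ccont f -> ccont g -> ccont (fun x => f x + g x).
Proof.
move=> [rf jf] [rg jg]; split=> x.
  by under eq_fun do rewrite cReD; apply: cvgD; [exact: rf|exact: rg].
by under eq_fun do rewrite cImD; apply: cvgD; [exact: jf|exact: jg].
Qed.

Lemma ccont_conj f : ccont f -> ccont (fun x => (f x)^*).
Proof.
move=> [rf jf]; split=> x.
  by under eq_fun do rewrite cRe_conj; exact: rf.
by under eq_fun do rewrite cIm_conj; apply: cvgN; exact: jf.
Qed.

Lemma mul_conj_complex (z : C) : z * z^* = (Re z ^+ 2 + Im z ^+ 2)%:C.
Proof.
case: z => x y; apply/eqP; rewrite conjC_complex eq_complex /=.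
by apply/andP; split; apply/eqP; ring.
Qed.

Lemma ccont_real (h : R -> R) : continuous h -> ccont (fun x => (h x)%:C).
Proof. by move=> hc; split=> x /=; [exact: hc|exact: cvg_cst]. Qed.

Lemma ccont_inv f : ccont f -> ccont (fun x => (1 + f x * (f x)^*)^-1).
Proof.
move=> [rf jf].
rewrite (_ : (fun x => _) = fun x => ((1 + (Re (f x) ^+ 2 + Im (f x) ^+ 2))^-1)%:C); last first.
  by apply/funext => x; rewrite mul_conj_complex -[1]/((1 : R)%:C) -rmorphD -fmorphV.
apply: ccont_real => x; apply: cvgV.
  by rewrite gt_eqF // ltr_pwDl // addr_ge0 ?sqr_ge0.
apply: cvgD; first exact: cvg_cst.
under eq_fun do rewrite !expr2.
by apply: cvgD; apply: cvgM; [exact: rf..|exact: jf|exact: jf].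
Qed.

Lemma ccont_cexp (a : R) : ccont (fun x => cexp (a * x)).
Proof.
have ca : continuous (fun x : R => a * x).
  by move=> x; apply: cvgM; [exact: cvg_cst|exact: cvg_id].
split=> x /=.
  by apply: continuous_comp; [exact: ca|exact: continuous_cos].
by apply: continuous_comp; [exact: ca|exact: continuous_sin].
Qed.

Lemma continuous_integrable01 (h : R -> R) : continuous h ->
  leb.-integrable `[0, 1] (EFin \o h).
Proof.
move=> hc; apply: continuous_compact_integrable; first exact: segment_compact.
exact: continuous_subspaceT.
Qed.

Lemma continuous_bounded01 (h : R -> R) : continuous h -> [bounded h x | x in `[0, 1]].
Proof.
move=> hc; have := @continuous_compact _ _ h `[0, 1] (continuous_subspaceT hc) (@segment_compact _ 0 1).
move=> /compact_bounded [K [Kr hK]]; exists K; split=> // y Ky x x01.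
by apply: (hK y Ky); exists x.
Qed.

Lemma integrable01_weight (s h : R -> R) : leb.-integrable `[0, 1] (EFin \o s) ->
  continuous h -> leb.-integrable `[0, 1] (EFin \o (fun x => s x * h x)).
Proof.
move=> si hc; apply: eq_integrable (integrableMl _ si _ (continuous_bounded01 hc)) => //.
by apply: measurable_funTS; exact: continuous_measurable_fun.
Qed.

Lemma cintegrable01 f : ccont f -> cintegrable leb `[0, 1] f.
Proof. by move=> [rf jf]; split; exact: continuous_integrable01. Qed.

Lemma cintegrable01_weight (s : R -> R) f : leb.-integrable `[0, 1] (EFin \o s) ->
  ccont f -> cintegrable leb `[0, 1] (fun x => (s x)%:C * f x).
Proof.
move=> si [rf jf]; split.
  apply: eq_integrable (integrable01_weight si rf) => // x _ /=.
  by rewrite cReM /= mul0r subr0.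
apply: eq_integrable (integrable01_weight si jf) => // x _ /=.
by rewrite cImM /= mul0r addr0.
Qed.

Lemma cexpD (x y : R) : cexp (x + y) = cexp x * cexp y.
Proof.
apply/eqP; rewrite /cexp cosD sinD eq_complex /=; apply/andP; split; apply/eqP; ring.
Qed.

Lemma cexpN (x : R) : cexp (- x) = (cexp x)^*.
Proof. by rewrite /cexp cosN sinN. Qed.

Lemma cexp0 : cexp (0 : R) = 1.
Proof. by rewrite /cexp cos0 sin0. Qed.

Lemma cexp_2pi_nat (k : nat) : cexp (2 * pi * k%:R : R) = 1.
Proof.
elim: k => [|k IH]; first by rewrite mulr0 cexp0.
rewrite -[k.+1]addn1 natrD mulrDr cexpD IH mul1r mulr1 /cexp mulr_natl.
by rewrite cos2pi sin2pi.
Qed.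

Lemma cexp_int (i k : nat) : cexp (2 * pi * (i%:R - k%:R) : R) = 1.
Proof.
by rewrite mulrBr cexpD cexpN !cexp_2pi_nat mul1r conjC1.
Qed.

Lemma Rintegral_deriv01 (F h : R -> R) : continuous h ->
  (forall x : R, is_derive x 1 F (h x)) -> \int[leb]_(x in `[0, 1]) h x = F 1 - F 0.
Proof.
move=> hc dF; rewrite /Rintegral (@continuous_FTC2 _ h F) //.
- exact: continuous_subspaceT.
- have cF : continuous F.
    by move=> x; apply/differentiable_continuous/derivable1_diffP; have [] := dF x.
  split; first by move=> x _; have [] := dF x.
    exact/cvg_at_right_filter/cF.
  exact/cvg_at_left_filter/cF.
- by move=> x _; rewrite derive1E; have [_ ->] := dF x.
Qed.

Lemma cintegral_cexp (i k : nat) :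
  cintegral leb `[0, 1] (fun x => cexp (2 * pi * (i%:R - k%:R) * x)) = (i == k)%:R.
Proof.
have [->|ik] := eqVneq i k.
  rewrite (_ : (fun x => _) = fun=> (1 : R)%:C); last first.
    by apply/funext => x; rewrite subrr mulr0 mul0r cexp0.
  rewrite cintegral_real /Rintegral integral_cst //= lebesgue_measure_itv /= lte_fin ltr01.
  by rewrite sube0 mule1 /=.
set a : R := 2 * pi * (i%:R - k%:R).
have a0 : a != 0.
  by rewrite !mulf_eq0 pnatr_eq0 /= (gt_eqF (pi_gt0 R)) subr_eq0 eqr_nat.
have da (x : R) : is_derive x 1 (fun y : R => a * y) a.
  have := @is_deriveZ _ _ _ id a x 1 1 (is_derive_id _ _).
  by rewrite /GRing.scale /= mulr1.
have [ca cb] := ccont_cexp a.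
have := cexp_int i k; rewrite -/a => /eqP; rewrite eq_complex /= => /andP[/eqP c1 /eqP s1].
have d1 (x : R) : is_derive x 1 (fun y : R => a^-1 * sin (a * y)) (cos (a * x)).
  have := is_deriveZ a^-1 (is_derive1_comp (is_derive_sin (a * x)) (da x)).
  by rewrite /GRing.scale /= mulrC mulfK.
have d2 (x : R) : is_derive x 1 (fun y : R => - a^-1 * cos (a * y)) (sin (a * x)).
  have := is_deriveZ (- a^-1) (is_derive1_comp (is_derive_cos (a * x)) (da x)).
  by rewrite /GRing.scale /= mulrC mulrN !mulNr opprK mulfK.
rewrite /cintegral; apply/eqP; rewrite eq_complex /=.
rewrite (Rintegral_deriv01 ca d1) (Rintegral_deriv01 cb d2).
by rewrite mulr1 mulr0 s1 c1 sin0 cos0 !mulr0 !subrr !eqxx.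
Qed.

End ContinuousComplex.

Section SpectralAngle.
Context (R : realType).
Local Notation C := R[i].
Local Notation leb := (@lebesgue_measure R).
Variables (M L N : nat) (S : 'I_M -> R -> R) (B : R).
Hypotheses (M0 : (0 < M)%N) (L0 : (0 < L)%N) (N0 : (0 < N)%N).
Hypothesis S_int : forall m, leb.-integrable `[0, 1] (EFin \o S m).
Hypothesis S_ge0 : forall m x, x \in `[0, 1] -> 0 <= S m x.
Hypothesis S_le : forall m x, x \in `[0, 1] -> S m x <= B.
Local Notation n := (blockdim M L).
Local Notation aT := ('I_M * R)%type.

Lemma sum_blockdim (V : nmodType) (F : 'I_M -> 'I_L -> V) :
  \sum_(s < n) F (tagnat.sig1 s) (tagnat.sig2 s) = \sum_m \sum_l F m l.
Proof.
rewrite (@sig_big_dep _ _ _ 'I_M (fun=> 'I_L) predT (fun _ => predT) F) /=.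
by rewrite (reindex (@tagnat.sig M (fun=> L))) //; exact: tagnat.sig_bij_on.
Qed.

Lemma avecE K (x : R) (k : 'I_K) : avec K x k 0 =
  (Num.sqrt K%:R)^-1%:C * cexp (2 * pi * k%:R * x).
Proof. by rewrite /avec /dvec !mxE. Qed.

Lemma avec_prod K (x : R) (i k : 'I_K) : (0 < K)%N ->
  avec K x i 0 * (avec K x k 0)^* = K%:R^-1 * cexp (2 * pi * (i%:R - k%:R) * x).
Proof.
move=> K0; rewrite !avecE rmorphM /= -cexpN.
have -> : ((Num.sqrt K%:R)^-1%:C : C)^* = (Num.sqrt K%:R)^-1%:C.
  by apply/CrealP; rewrite complex_real.
rewrite mulrACA -rmorphM -invfM -expr2 sqr_sqrtr ?ler0n // -cexpD fmorphV rmorph_nat.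
by congr (_ * cexp _); ring.
Qed.

Lemma ccont_avec K (k : 'I_K) : ccont (fun x : R => avec K x k 0).
Proof.
rewrite (_ : (fun x => _) = fun x => (Num.sqrt K%:R)^-1%:C * cexp (2 * pi * k%:R * x)).
  by apply: ccont_mul; [exact: ccont_cst|exact: ccont_cexp].
by apply/funext => x; rewrite avecE.
Qed.

Lemma avec_norm K (x : R) : (0 < K)%N -> vnorm2 (avec K x) = 1.
Proof.
move=> K0; rewrite /vnorm2; under eq_bigr do rewrite avec_prod // subrr mulr0 mul0r cexp0 mulr1.
by rewrite sumr_const card_ord -[LHS]mulr_natr mulVf // pnatr_eq0 -lt0n.
Qed.

Lemma cintegral_avec K (i k : 'I_K) : (0 < K)%N ->
  cintegral leb `[0, 1] (fun x => avec K x i 0 * (avec K x k 0)^*) = (i == k)%:R / K%:R.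
Proof.
move=> K0.
rewrite (_ : (fun x => _) = fun x => K%:R^-1 * cexp (2 * pi * (i%:R - k%:R) * x) + (0 : R)%:C); last first.
  by apply/funext => x; rewrite avec_prod // addr0.
rewrite cintegral_lin //; [|exact: cintegrable01 (ccont_cexp _)|exact: cintegrable01 (ccont_cst _)].
by rewrite cintegral_cexp cintegral_real /Rintegral integral0 addr0 mulrC.
Qed.

Definition ang_good (f : aT -> C) := forall m, ccont (fun x => f (m, x)).
Definition ang_v (t : aT) : 'cV[C]_n :=
  \col_i (if tagnat.sig1 i == t.1 then avec L t.2 (tagnat.sig2 i) 0 else 0).
Definition ang_u (t : aT) : 'cV[C]_N := avec N t.2.
Definition ang_J (f : aT -> C) : C :=
  M%:R^-1 * \sum_m cintegral leb `[0, 1] (fun x => f (m, x)).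
(** The density stays inside the functional: [ang_good] means continuity in the frequency, whereas
    [S m] enters here as an integrable bounded weight. *)
Definition ang_Js (f : aT -> C) : C :=
  M%:R^-1 * \sum_m cintegral leb `[0, 1] (fun x => (S m x)%:C * f (m, x)).

Let Mc0 : M%:R != 0 :> C. Proof. by rewrite pnatr_eq0 -lt0n. Qed.

Let B0 : 0 <= B.
Proof.
have h : (0 : R) \in `[0, 1] by rewrite in_itv /= lexx ler01.
exact: le_trans (S_ge0 (Ordinal M0) h) (S_le (Ordinal M0) h).
Qed.

Let Jlin c f g : ang_good f -> ang_good g ->
  ang_J (fun t => c * f t + g t) = c * ang_J f + ang_J g.
Proof.
move=> gf gg; rewrite /ang_J mulrCA -mulrDr; congr (_ * _); rewrite mulr_sumr -big_split.
by apply: eq_bigr => m _; rewrite cintegral_lin //; exact: cintegrable01.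
Qed.

Let Jslin c f g : ang_good f -> ang_good g ->
  ang_Js (fun t => c * f t + g t) = c * ang_Js f + ang_Js g.
Proof.
move=> gf gg; rewrite /ang_Js mulrCA -mulrDr; congr (_ * _); rewrite mulr_sumr -big_split.
apply: eq_bigr => m _; rewrite -[RHS]/(_ + _) -cintegral_lin //; try exact: cintegrable01_weight.
by congr cintegral; apply/funext => x; rewrite mulrDr mulrCA.
Qed.

Let S01 m x : `[0, 1]%classic x -> 0 <= S m x <= B.
Proof. by move=> hx; rewrite S_ge0 // S_le. Qed.

Let Js_le f : ang_good f -> (forall t, 0 <= f t) -> ang_Js f <= B%:C * ang_J f.
Proof.
move=> gf f0; rewrite /ang_J mulrCA; apply: ler_wpM2l; first by rewrite invr_ge0.
rewrite mulr_sumr; apply: ler_sum => m _; rewrite -subr_ge0.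
have i0 := cintegrable01 (ccont_cst (0 : C)).
have i1 := cintegrable01 (gf m); have i2 := cintegrable01_weight (S_int m) (gf m).
rewrite -[X in _ <= X](_ : cintegral leb `[0, 1] (fun x => -1 * ((S m x)%:C * f (m, x)) + B%:C * f (m, x)) = _).
  apply: cintegral_ge0 => x x01; rewrite mulN1r addrC -mulrBl -rmorphB.
  by rewrite mulr_ge0 // ler0c subr_ge0; have /andP[] := S01 m x01.
have i3 : cintegrable leb `[0, 1] (fun x => B%:C * f (m, x)).
  by apply: cintegrable01; apply: ccont_mul; [exact: ccont_cst|exact: gf].
rewrite cintegral_lin // mulN1r addrC; congr (_ - _).
transitivity (cintegral leb `[0, 1] (fun x => B%:C * f (m, x) + 0)).
  by congr cintegral; apply/funext => x; rewrite addr0.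
rewrite cintegral_lin // (_ : (fun=> 0) = fun=> (0 : R)%:C) //.
by rewrite cintegral_real /Rintegral integral0 addr0.
Qed.

Let Js_conj f : ang_good f -> ang_Js (fun t => (f t)^*) = (ang_Js f)^*.
Proof.
move=> gf; rewrite /ang_Js rmorphM /= fmorphV rmorph_nat rmorph_sum; congr (_ * _).
apply: eq_bigr => m _ /=; rewrite -cintegral_conj //; last exact: cintegrable01_weight.
congr cintegral; apply/funext => x; rewrite rmorphM /=; congr (_ * _).
by apply/esym/CrealP; rewrite complex_real.
Qed.

Let sigE (i k : 'I_n) : (i == k) = (tagnat.sig1 i == tagnat.sig1 k) && (tagnat.sig2 i == tagnat.sig2 k :> nat).
Proof.
apply/idP/idP => [/eqP ->|]; first by rewrite !eqxx.
move=> /andP[/eqP h1 /eqP h2]; apply/eqP.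
rewrite -(tagnat.sig2K i) -(tagnat.sig2K k).
move: (tagnat.sig2 i) (tagnat.sig2 k) h2; rewrite h1 => a b h2.
by congr tagnat.Rank; apply: val_inj.
Qed.

Let vv i k : ang_J (fun t => ang_v t i 0 * (ang_v t k 0)^*) = (i == k)%:R / n%:R.
Proof.
rewrite /ang_J (bigD1 (tagnat.sig1 i)) //= [X in _ * (_ + X)]big1; last first.
  move=> m /negPf ni; rewrite (_ : (fun x => _) = fun=> (0 : R)%:C).
    by rewrite cintegral_real /Rintegral integral0.
  by apply/funext => x; rewrite /ang_v !mxE /= eq_sym ni mul0r.
rewrite addr0 sigE; have [e|ne] := boolP (tagnat.sig1 i == tagnat.sig1 k); last first.
  rewrite mul0r (_ : (fun x => _) = fun=> (0 : R)%:C).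
    by rewrite cintegral_real /Rintegral integral0 mulr0.
  by apply/funext => x; rewrite /ang_v !mxE /= eqxx eq_sym (negPf ne) conjC0 mulr0.
rewrite (_ : (fun x => _) = (fun x => avec L x (tagnat.sig2 i) 0 *
   (avec L x (tagnat.sig2 k) 0)^*)); last first.
  by apply/funext => x; rewrite /ang_v !mxE /= eqxx eq_sym e.
rewrite cintegral_avec // -val_eqE /= blockdimE natrM invfM; ring.
Qed.

Let uu i k : ang_J (fun t => ang_u t i 0 * (ang_u t k 0)^*) = (i == k)%:R / N%:R.
Proof.
rewrite /ang_J /ang_u /=; under eq_bigr do rewrite cintegral_avec //.
by rewrite sumr_const card_ord -[X in _ * X]mulr_natl mulrA mulVf // mul1r.
Qed.

Let v1 t : vnorm2 (ang_v t) = 1.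
Proof.
rewrite -(avec_norm t.2 L0) /vnorm2.
pose F m l : C := (if m == t.1 then avec L t.2 l 0 else 0) * (if m == t.1 then avec L t.2 l 0 else 0)^*.
transitivity (\sum_m \sum_l F m l).
  by rewrite -sum_blockdim; apply: eq_bigr => s _; rewrite /ang_v mxE.
rewrite (bigD1 t.1) //= [X in _ + X]big1 ?addr0 => [|m /negPf nm].
  by apply: eq_bigr => l _; rewrite /F eqxx.
by rewrite big1 // => l _; rewrite /F nm mul0r.
Qed.

Definition spectral_angle : angle C n N.
Proof.
refine (@Angle C n N _ N0 aT ang_good _ _ _ _ _ ang_v ang_u _ _ ang_J ang_Js B%:C
  _ Jlin Jslin _ _ Js_le Js_conj vv uu v1 _).
- by rewrite blockdimE muln_gt0 M0.
- by move=> c m; exact: ccont_cst.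
- move=> c f g gf gg m; apply: ccont_add => //.
  by apply: ccont_mul => //; exact: ccont_cst.
- by move=> f g gf gg m; exact: ccont_mul.
- by move=> f gf m; exact: ccont_conj.
- by move=> f gf m; exact: ccont_inv.
- move=> i m; rewrite /ang_v; under eq_fun do rewrite mxE /=.
  by case: (_ == _); [exact: ccont_avec|exact: ccont_cst].
- by move=> j m; exact: ccont_avec.
- by rewrite ler0c.
- move=> f gf f0; rewrite mulr_ge0 ?invr_ge0 // sumr_ge0 // => m _.
  by apply: cintegral_ge0.
- move=> f gf f0; rewrite mulr_ge0 ?invr_ge0 // sumr_ge0 // => m _.
  apply: cintegral_ge0 => x x01; rewrite mulr_ge0 // ler0c.
  by have /andP[] := S01 m x01.
- by move=> t; exact: avec_norm.
Defined.
End SpectralAngle.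

Section SpectralAngleLinks.
Context (R : realType).
Local Notation C := R[i].
Local Notation leb := (@lebesgue_measure R).
Variables (M L N : nat) (S : 'I_M -> R -> R) (B : R).
Hypotheses (M0 : (0 < M)%N) (L0 : (0 < L)%N) (N0 : (0 < N)%N).
Hypothesis S_int : forall m, leb.-integrable `[0, 1] (EFin \o S m).
Hypothesis S_ge0 : forall m x, x \in `[0, 1] -> 0 <= S m x.
Hypothesis S_le : forall m x, x \in `[0, 1] -> S m x <= B.
Local Notation n := (blockdim M L).
Local Notation a := (spectral_angle M0 L0 N0 S_int S_ge0 S_le).

Let nE : n%:R = M%:R * L%:R :> C. Proof. by rewrite blockdimE natrM. Qed.
Let Mc0 : M%:R != 0 :> C. Proof. by rewrite pnatr_eq0 -lt0n. Qed.
Let Lc0 : L%:R != 0 :> C. Proof. by rewrite pnatr_eq0 -lt0n. Qed.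
Let Nc0 : N%:R != 0 :> C. Proof. by rewrite pnatr_eq0 -lt0n. Qed.

Lemma dvec_prod K (x : R) (i k : 'I_K) : (0 < K)%N ->
  (dvec K x *m (dvec K x)^t*) i k = K%:R * (avec K x i 0 * (avec K x k 0)^*).
Proof.
move=> K0; rewrite avec_prod // mulrA mulfV ?mul1r ?pnatr_eq0 -?lt0n //.
rewrite mxE big_ord1 !mxE -cexpN -cexpD; congr cexp; ring.
Qed.

Lemma qformE_sum K (D : 'M[C]_K) (x : 'cV[C]_K) :
  qform D x = \sum_i \sum_k (x i 0)^* * D i k * x k 0.
Proof.
rewrite /qform mxE exchange_big; apply: eq_bigr => k _.
by rewrite !mxE mulr_suml; apply: eq_bigr => i _; rewrite !mxE.
Qed.

Lemma qform_tr_conj K (D : 'M[C]_K) (x : 'cV[C]_K) :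
  ((map_mx Num.conj x)^t* *m D *m map_mx Num.conj x) 0 0 = qform D^T x.
Proof.
rewrite -[LHS]/(qform D (map_mx Num.conj x)) !qformE_sum exchange_big; apply: eq_bigr => k _.
by apply: eq_bigr => i _; rewrite !mxE conjCK; ring.
Qed.

Let sum1 (m : 'I_M) (F : 'I_M -> C) : (forall m', m' != m -> F m' = 0) ->
  \sum_m' F m' = F m.
Proof. by move=> h; rewrite (bigD1 m) //= big1 ?addr0 // => m' /h. Qed.

Let cint0 : cintegral leb `[0, 1] (fun=> 0) = 0 :> C.
Proof. by rewrite (_ : (fun=> 0) = fun=> (0 : R)%:C) // cintegral_real /Rintegral integral0. Qed.

Let Psi1E K m (Q : nat) (D : 'M[C]_Q) i k : (0 < K)%N ->
  ccont (fun x => qform D (avec Q x)) ->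
  Psi1 (S m) K D i k = K%:R * cintegral leb `[0, 1] (fun x =>
     (S m x)%:C * (qform D (avec Q x) * (avec K x i 0 * (avec K x k 0)^*))).
Proof.
move=> K0 gD; rewrite mxE -cintegralZ //; last first.
  apply: cintegrable01_weight => //; apply: ccont_mul => //.
  by apply: ccont_mul; [exact: ccont_avec|apply: ccont_conj; exact: ccont_avec].
by congr cintegral; apply/funext => x; rewrite dvec_prod //; ring.
Qed.

Let ccont_qform Q (D : 'M[C]_Q) : ccont (fun x : R => qform D (avec Q x)).
Proof.
have h (I : finType) (F : I -> R -> C) : (forall i, ccont (F i)) -> ccont (fun x => \sum_i F i x).
  move=> hF; elim: (index_enum I) => [|i s IH].
    by under eq_fun do rewrite big_nil; exact: ccont_cst.
  by under eq_fun do rewrite big_cons; apply: ccont_add.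
rewrite (_ : (fun x => _) = fun x => \sum_i \sum_k (avec Q x i 0)^* * D i k * avec Q x k 0).
  apply: (h _ (fun i x => \sum_k (avec Q x i 0)^* * D i k * avec Q x k 0)) => i.
  apply: (h _ (fun k x => (avec Q x i 0)^* * D i k * avec Q x k 0)) => k.
  apply: ccont_mul; last exact: ccont_avec.
  by apply: ccont_mul; [apply: ccont_conj; exact: ccont_avec|exact: ccont_cst].
by apply/funext => x; rewrite qformE_sum.
Qed.

Let Js_block (phi : 'I_M * R -> C) (i k : 'I_n) :
  ang_Js S (fun t => phi t * (ang_v L t i 0 * (ang_v L t k 0)^*)) =
  M%:R^-1 * ((tagnat.sig1 i == tagnat.sig1 k)%:R * cintegral leb `[0, 1] (fun x =>
     (S (tagnat.sig1 i) x)%:C * (phi (tagnat.sig1 i, x) *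
       (avec L x (tagnat.sig2 i) 0 * (avec L x (tagnat.sig2 k) 0)^*)))).
Proof.
rewrite /ang_Js; congr (_ * _); rewrite (sum1 (m := tagnat.sig1 i)); last first.
  move=> m /negPf nm; rewrite (_ : (fun x => _) = fun=> 0) //.
  by apply/funext => x; rewrite /ang_v !mxE /= eq_sym nm !mul0r !mulr0.
have [e|ne] := boolP (tagnat.sig1 i == tagnat.sig1 k).
  rewrite mul1r; congr cintegral; apply/funext => x.
  by rewrite /ang_v !mxE /= eqxx eq_sym e.
rewrite mul0r (_ : (fun x => _) = fun=> 0) //; apply/funext => x.
by rewrite /ang_v !mxE /= eqxx [tagnat.sig1 k == _]eq_sym (negPf ne) conjC0 !mulr0.
Qed.

(** The transpose comes from the conjugated vectors in [SopC]: the form of [D] at the conjugate of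
    [x] is the form of [D^T] at [x]. *)
Lemma SopC_Psi (D : 'M[C]_N) : SopC a D = Psi L S D^T.
Proof.
apply/matrixP => i k; rewrite [LHS]mxE.
have -> : aJs a (fun t => (((map_mx Num.conj (au a t))^t* *m D *m map_mx Num.conj (au a t)) 0 0) *
    (av a t i 0 * (av a t k 0)^*)) = ang_Js S (fun t => qform D^T (ang_u N t) *
    (ang_v L t i 0 * (ang_v L t k 0)^*)).
  rewrite -[LHS]/(ang_Js S _); congr ang_Js; apply/funext => t.
  by rewrite qform_tr_conj.
rewrite Js_block [RHS]mxE nE.
have [e|ne] := eqVneq (tagnat.sig1 i) (tagnat.sig1 k); last first.
  by rewrite [RHS]mxE mul0r !mulr0.
rewrite conform_mx_id Psi1E // mul1r mulrA; congr (_ * _).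
by rewrite mulrAC mulfV // mul1r.
Qed.

(** Conjugating twice restores [v], so [D] is not transposed; the outer transpose comes from the
    conjugated [u], and [c_N] is the weight [n/p] of [dualA]. *)
Lemma SopC_dual_Psibar (D : 'M[C]_n) :
  SopC (dualA a) D = ((M * L)%:R / N%:R) *: (Psibar N S D)^T.
Proof.
apply/matrixP => j l; rewrite [LHS]mxE.
pose F t := qform D (ang_v L t) * (avec N t.2 l 0 * (avec N t.2 j 0)^*).
rewrite [X in _ * X](_ : _ = n%:R / N%:R * ang_Js S F); last first.
  rewrite -[LHS]/(n%:R / N%:R * ang_Js S _); congr (_ * ang_Js S _); apply/funext => t.
  rewrite -[LHS]/(qform D (map_mx Num.conj (map_mx Num.conj (ang_v L t))) *
    (map_mx Num.conj (avec N t.2) j 0 * (map_mx Num.conj (avec N t.2) l 0)^*)).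
  rewrite [map_mx _ (avec _ _) j 0]mxE [map_mx _ (avec _ _) l 0]mxE conjCK.
  rewrite [(avec N t.2 j 0)^* * _]mulrC; congr (qform D _ * _).
  by apply/matrixP => s z; rewrite !mxE conjCK.
rewrite !mxE summxE -blockdimE mulrCA; congr (_ * _).
rewrite /ang_Js mulrCA; congr (_ * _); rewrite !mulr_sumr; apply: eq_bigr => m _.
rewrite Psi1E //; congr (_ * _); congr cintegral; apply/funext => x.
rewrite /F /=; congr (_ * (_ * _)).
rewrite !qformE_sum.
pose H m1 (l1 : 'I_L) m2 (l2 : 'I_L) : C :=
  (if m1 == m then avec L x l1 0 else 0)^* * submxblock D m1 m2 l1 l2 *
  (if m2 == m then avec L x l2 0 else 0).
transitivity (\sum_(s < n) \sum_(t < n) H (tagnat.sig1 s) (tagnat.sig2 s) (tagnat.sig1 t) (tagnat.sig2 t)).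
  apply: eq_bigr => s _; apply: eq_bigr => t _.
  by rewrite /H /ang_v !mxE /= !tagnat.sig2K.
transitivity (\sum_(s < n) \sum_m2 \sum_l2 H (tagnat.sig1 s) (tagnat.sig2 s) m2 l2).
  by apply: eq_bigr => s _; exact: sum_blockdim.
rewrite (sum_blockdim (fun m1 l1 => \sum_m2 \sum_l2 H m1 l1 m2 l2)).
rewrite (sum1 (m := m)); last first.
  by move=> m1 /negPf h; rewrite !big1 // => l1 _; rewrite !big1 // => m2 _; rewrite !big1 // => l2 _;
     rewrite /H h conjC0 !mul0r.
apply: eq_bigr => l1 _; rewrite (sum1 (m := m)); last first.
  by move=> m2 /negPf h; rewrite !big1 // => l2 _; rewrite /H h mulr0.
by apply: eq_bigr => l2 _; rewrite /H eqxx.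
Qed.

(** The entries of [v] and [u] at positions [i] and [j] multiply to the frequency [i + j]: the
    covariance depends on antidiagonals only, which is the Hankel structure. The normalizations
    combine to [M L / (M L N) = 1 / N]. *)
Lemma Gam_autocov (i k : 'I_n) (j l : 'I_N) (q q' : nat) :
  q = (tagnat.sig2 i + j).+1 -> q' = (tagnat.sig2 k + l).+1 ->
  Gam a i j k l = autocov (S (tagnat.sig1 i)) (q%:Z - q'%:Z) / N%:R
    * (tagnat.sig1 i == tagnat.sig1 k)%:R.
Proof.
move=> -> ->; rewrite /Gam.
have -> : aJs a (fun t => av a t i 0 * au a t j 0 * (av a t k 0 * au a t l 0)^*) =
    ang_Js S (fun t => (avec N t.2 j 0 * (avec N t.2 l 0)^*) * (ang_v L t i 0 * (ang_v L t k 0)^*)).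
  rewrite -[LHS]/(ang_Js S _); congr ang_Js; apply/funext => t.
  by rewrite rmorphM /=; rewrite mulrACA mulrC.
rewrite Js_block (_ : cintegral _ _ _ = (L%:R * N%:R)^-1 *
    autocov (S (tagnat.sig1 i)) ((tagnat.sig2 i + j).+1%:Z - (tagnat.sig2 k + l).+1%:Z)).
  by rewrite nE; field; rewrite Mc0 Lc0 Nc0.
rewrite /autocov -cintegralZ //; last first.
  apply: cintegrable01_weight => //.
  set z := _%:~R; rewrite (_ : (fun x => _) = fun x => cexp ((2 * pi * z) * x)).
    exact: ccont_cexp.
  by apply/funext => x; rewrite mulrAC.
congr cintegral; apply/funext => x /=; rewrite !avec_prod //.
have -> : cexp (2 * pi * x * ((tagnat.sig2 i + j).+1%:Z - (tagnat.sig2 k + l).+1%:Z)%:~R) =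
   cexp (2 * pi * (j%:R - l%:R) * x) * cexp (2 * pi * ((tagnat.sig2 i)%:R - (tagnat.sig2 k)%:R) * x) :> C.
  rewrite -cexpD; congr cexp; rewrite rmorphB /= -!pmulrn -![(_ + _).+1]addn1 !natrD; ring.
by rewrite invfM; ring.
Qed.

(** Cauchy-Schwarz over the rows, keeping the indicator [I s] that row [s] lies in the block
    selected by [t]. Averaging this indicator over the blocks gains [1/M], so the constant is
    [B L / N] and not [B M L / N]. *)
Lemma Gam_form_le (D : 'I_n * 'I_N -> C) :
  \sum_q \sum_r pair_Gam a q r * D q * (D r)^* <=
  (B%:C * L%:R / N%:R) * \sum_q D q * (D q)^*.
Proof.
pose vu t (q : 'I_n * 'I_N) := av a t q.1 0 * au a t q.2 0.
have gvu q : good a (fun t => vu t q) by apply: good_mul; [exact: good_av|exact: good_au].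
pose z t := \sum_q D q * vu t q.
have gz : good a z by apply: good_sum => q; exact: good_scale.
pose f t := z t * (z t)^*.
have gf : good a f by apply: good_mul => //; exact: good_conj.
have -> : \sum_q \sum_r pair_Gam a q r * D q * (D r)^* = n%:R * aJs a f.
  have fE : f = fun t => \sum_q \sum_r (D q * (D r)^*) * (vu t q * (vu t r)^*).
    apply/funext => t; rewrite /f {1}/z mulr_suml; apply: eq_bigr => q _.
    rewrite rmorph_sum mulr_sumr; apply: eq_bigr => r _ /=.
    by rewrite rmorphM /=; ring.
  have gr q r : good a (fun t => (D q * (D r)^*) * (vu t q * (vu t r)^*)).
    by apply: good_scale; apply: good_mul => //; exact: good_conj.
  rewrite fE (fun_lin_sum (@aJs_lin _ _ _ a)); last by move=> q; exact: good_sum.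
  rewrite mulr_sumr; apply: eq_bigr => q _.
  rewrite (fun_lin_sum (@aJs_lin _ _ _ a)) // mulr_sumr; apply: eq_bigr => r _.
  rewrite (fun_lin_scale (@aJs_lin _ _ _ a)); last by apply: good_mul => //; exact: good_conj.
  rewrite mulrCA -mulrA mulrC; congr (_ * _).
have f0 t : 0 <= f t by exact: mul_conjC_ge0.
pose y t s := \sum_j D (s, j) * au a t j 0.
have gy s : good a (fun t => y t s) by apply: good_sum => j; apply: good_scale; exact: good_au.
pose I (s : 'I_n) (t : aT a) : C := (tagnat.sig1 s == t.1)%:R.
have gI s : good a (I s) by move=> m; exact: (ccont_cst ((tagnat.sig1 s == m)%:R : C)).
pose g t := \sum_s I s t * (y t s * (y t s)^*).
have gyy s : good a (fun t => I s t * (y t s * (y t s)^*)).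
  by apply: good_mul => //; apply: good_mul => //; exact: good_conj.
have gg : good a g by exact: good_sum.
have fg t : f t <= g t.
  have := cauchy_schwarz (map_mx Num.conj (av a t)) (\col_s (I s t * y t s)).
  rewrite vnorm2_conj av1 mul1r.
  have -> : ((map_mx Num.conj (av a t))^t* *m \col_s (I s t * y t s)) 0 0 = z t.
    rewrite mxE /z (eq_bigr (fun q => D (q.1, q.2) * vu t (q.1, q.2))) => [|[]//].
    rewrite -(pair_bigA _ (fun s j => D (s, j) * vu t (s, j))) /=; apply: eq_bigr => s _.
    rewrite !mxE conjCK /y !mulr_sumr; apply: eq_bigr => j _; rewrite /vu /= /I.
    by rewrite /ang_v !mxE; case: eqP => _ /=; rewrite ?mul0r ?mulr0 //; ring.
  move=> /le_trans -> //; rewrite le_eqVlt; apply/orP; left; apply/eqP.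
  apply: eq_bigr => s _; rewrite !mxE rmorphM /= /I.
  by case: (_ == _); rewrite ?conjC0 ?conjC1 ?mul1r ?mul0r.
apply: (@le_trans _ _ (n%:R * (B%:C * aJ a g))).
  rewrite ler_wpM2l //; apply: le_trans (aJs_le gf f0) _.
  by rewrite ler_wpM2l ?(aB_ge0 a) //; exact: aJ_le.
have yy s : aJ a (fun t => I s t * (y t s * (y t s)^*)) =
    M%:R^-1 * (N%:R^-1 * \sum_j D (s, j) * (D (s, j))^*).
  pose x : 'cV[C]_N := \col_j D (s, j).
  have h := @parseval _ _ _ (dualA a) x.
  have {h} h : aJ a (fun t => y t s * (y t s)^*) = N%:R^-1 * \sum_j D (s, j) * (D (s, j))^*.
    have -> : \sum_j D (s, j) * (D (s, j))^* = vnorm2 x.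
      by apply: eq_bigr => j _; rewrite !mxE.
    rewrite -h -[RHS]/(aJ a _); congr (aJ a _); apply/funext => t.
    rewrite mulrC; congr (_ * _); last first.
      by rewrite mxE; apply: eq_bigr => j _; rewrite !mxE conjCK mulrC.
    by rewrite mxE rmorph_sum; apply: eq_bigr => j _; rewrite !mxE rmorphM.
  rewrite -h.
  have -> : aJ a (fun t => y t s * (y t s)^*) = cintegral leb `[0, 1]
      (fun x0 => y (tagnat.sig1 s, x0) s * (y (tagnat.sig1 s, x0) s)^*).
    rewrite -[LHS]/(M%:R^-1 * \sum_(m < M) cintegral leb `[0, 1]
      (fun x0 => y (tagnat.sig1 s, x0) s * (y (tagnat.sig1 s, x0) s)^*)).
    by rewrite sumr_const card_ord -[X in _ * X]mulr_natl mulrA mulVf // mul1r.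
  rewrite -[LHS]/(M%:R^-1 * \sum_(m < M) cintegral leb `[0, 1]
      (fun x0 => I s (m, x0) * (y (m, x0) s * (y (m, x0) s)^*))).
  congr (_ * _); rewrite (sum1 (m := tagnat.sig1 s)); last first.
    move=> m /negPf nm; rewrite (_ : (fun x => _) = fun=> 0) //.
    by apply/funext => x0; rewrite /I eq_sym nm mul0r.
  by congr cintegral; apply/funext => x0; rewrite /I /= eqxx mul1r.
pose Sm := \sum_q D q * (D q)^*.
have -> : aJ a g = M%:R^-1 * (N%:R^-1 * Sm).
  rewrite (fun_lin_sum (@aJ_lin _ _ _ a)) //.
  transitivity (\sum_s M%:R^-1 * (N%:R^-1 * \sum_j D (s, j) * (D (s, j))^*)).
    by apply: eq_bigr => s _; exact: yy.
  rewrite -!mulr_sumr (pair_bigA _ (fun s j => D (s, j) * (D (s, j))^*)) /=.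
  by congr (_ * (_ * _)); apply: eq_bigr => [[]].
rewrite -/Sm le_eqVlt; apply/orP; left; apply/eqP.
by rewrite nE; field; rewrite Mc0 Nc0.
Qed.
End SpectralAngleLinks.

Lemma cReZ (R : rcfType) (y : R) (z : R[i]) : Re (y%:C * z) = y * Re z.
Proof. by rewrite cReM mul0r subr0. Qed.

Section SopProperties.
Variables (C : numClosedFieldType) (n p : nat) (a : angle C n p) (G : gmat a).

Lemma SopC_lin c (P Q : 'M[C]_p) : SopC a (c *: P + Q) = c *: SopC a P + SopC a Q.
Proof.
apply/matrixP => i k; rewrite [RHS]mxE [X in _ = X + _]mxE ![SopC _ _ i k]mxE.
have gvv : good a (fun t => av a t i 0 * (av a t k 0)^*).
  by apply: good_mul; [exact: good_av|apply: good_conj; exact: good_av].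
rewrite mulrCA -mulrDr -aJs_lin; try by apply: good_mul => //; exact: (good_uform G).
congr (_ * aJs a _); apply/funext => t; rewrite [in RHS]mulrA -mulrDl; congr (_ * _).
have addE (Z1 Z2 : 'M[C]_1) : (Z1 + Z2) 0 0 = Z1 0 0 + Z2 0 0 by rewrite mxE.
have zE (Z : 'M[C]_1) : (c *: Z) 0 0 = c * Z 0 0 by rewrite mxE.
by rewrite mulmxDr mulmxDl -scalemxAr -scalemxAl addE zE.
Qed.

Lemma SopCZ c (P : 'M[C]_p) : SopC a (c *: P) = c *: SopC a P.
Proof.
have h := SopC_lin (-1) P P.
have S0 : SopC a 0 = 0 by move: h; rewrite !scaleN1r !addNr.
by rewrite -[c *: P]addr0 SopC_lin S0 addr0.
Qed.

Lemma SopC_psd (D : 'M[C]_p) : psdmx D -> psdmx (SopC a D).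
Proof.
move=> hD x; rewrite (quant_form x x (@aJs_lin _ _ _ a) (good_uform G D)).
rewrite mulr_ge0 //; apply: aJs_ge0 => [|t].
  apply: good_mul; first exact: (good_uform G).
  by apply: good_mul; [exact: good_dot|exact: good_dot'].
apply: mulr_ge0; first exact: hD.
by rewrite -[X in _ * X]dot_conj mul_conjC_ge0.
Qed.

Lemma SopC_bound b (D : 'M[C]_p) t : 0 < aB a -> aB a <= b -> 0 < t -> opb D t ->
  opb (SopC a D) (t * b).
Proof.
move=> B0 Bb t0 hD; apply: (opb_le _ _ (SopC_opb G B0 t0 hD)).
  by rewrite mulr_ge0 // ltW.
by rewrite ler_wpM2l // ltW.
Qed.
End SopProperties.

(** * Moments of the normalized trace of the limit measure *)

Section NormalizedTrace.
Context (R : realType) (K : nat) (mu : mxmeasure R K).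
Local Notation C := R[i].

Lemma qform_delta (A : 'M[C]_K) (i : 'I_K) : qform A (delta_mx i ord0) = A i i.
Proof.
rewrite /qform (_ : (delta_mx i ord0)^t* = delta_mx ord0 i).
  by rewrite -rowE -colE !mxE.
by apply/matrixP => u v; rewrite !mxE andbC rmorph_nat.
Qed.

Lemma integral_ntrace (D : set (measurableTypeR R)) (f : measurableTypeR R -> \bar R) :
  measurable D -> measurable_fun D f -> (forall x, D x -> 0 <= f x)%E ->
  (\int[ntrace_measure mu]_(x in D) f x =
   \sum_(i < K) ((K%:R)^-1)%:E * \int[qmeasure mu (delta_mx i ord0)]_(x in D) f x)%E.
Proof.
move=> mD mf f0.
have k0 : 0 <= (K%:R)^-1 :> R by rewrite invr_ge0.
(* [msum] takes a sequence indexed by all naturals; beyond [K] it is completed by the zero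
   measure. *)
pose m_ (j : nat) : {measure set (measurableTypeR R) -> \bar R} :=
  if insub j is Some i then mscale (NngNum k0) (qmeasure mu (delta_mx (i : 'I_K) ord0)) else mzero.
have mE A : ntrace_measure mu A = msum m_ K A.
  rewrite /msum /= /ntrace_measure.
  transitivity (\sum_(i < K) ((K%:R)^-1 * Re (mu A i i))%:E)%E.
    by rewrite sumEFin -mulr_sumr /mxtrace raddf_sum.
  apply: eq_bigr => i _; rewrite /m_ valK.
  rewrite -[RHS]/((K%:R^-1)%:E * (Re (qform (mu A) (delta_mx i ord0)))%:E)%E.
  by rewrite qform_delta EFinM.
transitivity (\int[msum m_ K]_(x in D) f x)%E.
  by apply: eq_measure_integral => A _ _; exact: mE.
rewrite ge0_integral_measure_sum //; apply: eq_bigr => i _.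
by rewrite /m_ valK ge0_integral_mscale.
Qed.
End NormalizedTrace.

Lemma Re_norm_le (R : rcfType) (z w : R[i]) : `|z| <= w -> `|Re z| <= Re w.
Proof. by move=> /(le_trans (normc_ge_Re z)); rewrite lecE => /andP[]. Qed.

Section TraceMoments.
Context (R : realType).
Local Notation C := R[i].
Local Notation leb := (@lebesgue_measure R).
Variables (M L N : nat) (S : 'I_M -> R -> R) (B b : R).
Hypotheses (M0 : (0 < M)%N) (L0 : (0 < L)%N) (N0 : (0 < N)%N).
Hypothesis S_int : forall m, leb.-integrable `[0, 1] (EFin \o S m).
Hypothesis S_ge0 : forall m x, x \in `[0, 1] -> 0 <= S m x.
Hypothesis S_le : forall m x, x \in `[0, 1] -> S m x <= B.
Local Notation n := (blockdim M L).
Local Notation a := (spectral_angle M0 L0 N0 S_int S_ge0 S_le).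
Variable G : gmat a.
Hypotheses (B0 : 0 < B) (Bb : B <= b) (Bb' : n%:R / N%:R * B <= b).

Definition T_ k : 'M[C]_n := Tmom (SopC a) (SopC (dualA a)) k.
Definition Tt_ k : 'M[C]_N := Ttmom (SopC a) (SopC (dualA a)) k.

Let aB0 : 0 < aB a. Proof. by rewrite /= ltcE /= eqxx. Qed.
Let n0 : 0 < n%:R :> C. Proof. by rewrite ltr0n blockdimE muln_gt0 M0. Qed.
Let aB0' : 0 < aB (dualA a).
Proof. by rewrite mulr_gt0 // divr_gt0 // ltr0n. Qed.
Let aBb : aB a <= b%:C. Proof. by rewrite lecR. Qed.
Let aBb' : aB (dualA a) <= b%:C.
Proof.
rewrite (_ : aB _ = (n%:R / N%:R * B)%:C) ?lecR //.
by rewrite rmorphM /= fmorph_div !rmorph_nat.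
Qed.
Let b0 : 0 < b. Proof. exact: lt_le_trans Bb. Qed.
Let bC0 : 0 < b%:C. Proof. by rewrite ltcE /= eqxx. Qed.

Let SB D t : 0 < t -> opb D t -> opb (SopC a D) (t * b%:C).
Proof. by move=> t0 h; exact: SopC_bound. Qed.
Let StB D t : 0 < t -> opb D t -> opb (SopC (dualA a) D) (t * b%:C).
Proof. by move=> t0 h; apply: (SopC_bound (dualG G)). Qed.

Lemma T_opb k : opb (T_ k) (gbnd (8 * b%:C) k) /\ opb (Tt_ k) (gbnd (8 * b%:C) k).
Proof. exact: Tmom_opb. Qed.

Variables (T : C -> 'M[C]_n) (Tt : C -> 'M[C]_N) (mu : mxmeasure R n).
Hypothesis Tt_class : stieltjes_class Tt.
Hypothesis T_eq : forall z : C, ~~ (0 <= z) ->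
  T z = - z^-1 *: invmx (1%:M + Psi L S (Tt z)^T).
Hypothesis Tt_eq : forall z : C, ~~ (0 <= z) ->
  Tt z = - z^-1 *: invmx (1%:M + ((M * L)%:R / N%:R) *: (Psibar N S (T z))^T).
Hypothesis T_mu : stieltjes_repr mu T.

Let neg (y : R) : 0 < y -> ~~ (0 <= (- y%:C : C)).
Proof. by move=> y0; rewrite lecE /= oppr0 eqxx /= oppr_ge0 -ltNge. Qed.

(** At the negative point [- y] the kernel [1 / (l + y)] is positive on the half-line. *)
Let stieltjes_psd K (F : C -> 'M[C]_K) (nu : mxmeasure R K) (y : R) :
  stieltjes_repr nu F -> 0 < y -> psdmx (F (- y%:C)).
Proof.
move=> [_ _ h] y0 x; rewrite -[X in 0 <= X]/(qform _ x) h ?neg //.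
apply: cintegral_ge0 => l; rewrite /nnegR /= in_itv /= andbT => l0.
by rewrite opprK -rmorphD invr_ge0 ler0c addr_ge0 // ltW.
Qed.

Lemma trace_moments k :
  (\int[ntrace_measure mu]_(x in @nnegR R) (x ^+ k)%:E =
   (Re (n%:R^-1 * \tr (T_ k)))%:E)%E.
Proof.
have zE c (Z : 'M[C]_1) : (c *: Z) ord0 ord0 = c * Z ord0 ord0 by rewrite mxE.
have subE (Z1 Z2 : 'M[C]_1) : (Z1 - Z2) ord0 ord0 = Z1 ord0 ord0 - Z2 ord0 ord0.
  by rewrite !mxE.
have mom_form (x : 'cV[C]_n) :
    (\int[qmeasure mu x]_(l in @nnegR R) (l ^+ k)%:E = (Re (qform (T_ k) x))%:E)%E.
  (* At [z = - y] the rescaled pair solves [U = (1 + S(Ut) / y)^-1] and the dual equation, the form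
     under which [Ty_cvg_bound] applies. *)
  pose U (y : R) := y%:C *: T (- y%:C); pose Ut (y : R) := y%:C *: Tt (- y%:C).
  pose Ay (y : R) j := Ty (SopC a) (SopC (dualA a)) y%:C (U y) j.
  apply: (@stieltjes_moments R (qmeasure mu x) (fun j => Re (qform (T_ j) x))
    (fun y j => Re (qform (Ay y j) x))
    (fun j => Re (gbnd (8 * b%:C) j.+1 * vnorm2 x))).
  - case: T_mu => _ h _; rewrite -[LHS]/((Re (qform (mu (@nnegR R)) x))%:E).
    by rewrite h.
  - move=> y y0; case: T_mu => _ _ h.
    have -> : qform (Ay y 0%N) x = y%:C * qform (T (- y%:C)) x.
      by rewrite /Ay /= /U /qform -scalemxAr -scalemxAl mxE.
    rewrite h ?neg // cReZ; congr (_ * _); apply: eq_Rintegral => l _.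
    have -> : l%:C - - y%:C = (l + y)%:C :> C by rewrite opprK rmorphD.
    by rewrite -fmorphV.
  - move=> y j y0; rewrite -[Ay y j.+1]/(y%:C *: (T_ j - Ay y j)).
    rewrite /qform -scalemxAr -scalemxAl mulmxBr mulmxBl.
    set P := x^t* *m T_ j *m x; set Q := x^t* *m Ay y j *m x.
    by rewrite zE subE cReZ raddfB.
  - move=> y j y0.
    have y0C : 0 < y%:C :> C by rewrite ltcE /= eqxx.
    have [nu h] := Tt_class.
    have pU : psdmx (U y) by apply: psdmxZ; [exact: ltW|exact: stieltjes_psd T_mu y0].
    have pUt : psdmx (Ut y) by apply: psdmxZ; [exact: ltW|exact: stieltjes_psd h y0].
    have yn : y%:C != 0 :> C by rewrite gt_eqF.
    have UE : U y = invmx (1%:M + y%:C^-1 *: SopC a (Ut y)).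
      rewrite /U T_eq ?neg // invrN opprK scalerA mulfV // scale1r -(SopC_Psi M0 L0 N0 S_int S_ge0 S_le) /Ut.
      by rewrite (SopCZ G) scalerA mulVf // scale1r.
    have UtE : Ut y = invmx (1%:M + y%:C^-1 *: SopC (dualA a) (U y)).
      rewrite /Ut Tt_eq ?neg // invrN opprK scalerA mulfV // scale1r -(SopC_dual_Psibar M0 L0 N0 S_int S_ge0 S_le) /U.
      by rewrite (SopCZ (dualG G)) scalerA mulVf // scale1r.
    have := @Ty_cvg_bound _ _ _ (SopC a) (SopC (dualA a)) b%:C bC0 SB StB
      (SopC_lin G) (SopC_lin (dualG G)) y%:C (U y) (Ut y) y0C UE UtE
      (SopC_psd G pUt) (SopC_psd (dualG G) pU) j x.
    move=> /Re_norm_le; rewrite mulmxBr mulmxBl.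
    set P := x^t* *m _ *m x; set Q := x^t* *m _ *m x.
    rewrite subE raddfB => le; apply: le_trans le _.
    by rewrite -fmorphV mulrC cReZ mulrC.
have mD : measurable (@nnegR R) by exact: measurable_itv.
rewrite integral_ntrace //; last 2 first.
- by apply/measurable_EFinP; apply: measurable_funX; exact: measurable_id.
- move=> x; rewrite /nnegR /= in_itv /= andbT => x0.
  by rewrite lee_fin exprn_ge0.
under eq_bigr do rewrite mom_form -EFinM.
rewrite sumEFin; congr EFin; rewrite -mulr_sumr.
have -> : n%:R^-1 = (n%:R^-1)%:C :> C by rewrite fmorphV rmorph_nat.
rewrite cReZ; congr (_ * _); transitivity (\sum_(i < n) Re (T_ k i i)).
  by apply: eq_bigr => i _; rewrite qform_delta.
by rewrite /mxtrace [RHS]raddf_sum.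
Qed.
End TraceMoments.

(** * The block-Hankel matrix as a Gaussian model, and its empirical moments *)

Section HankelModel.
Context (R : realType).
Local Notation C := R[i].
Local Notation leb := (@lebesgue_measure R).
Variables (M L N : nat) (S : 'I_M -> R -> R) (B : R).
Hypotheses (M0 : (0 < M)%N) (L0 : (0 < L)%N) (N0 : (0 < N)%N).
Hypothesis S_int : forall m, leb.-integrable `[0, 1] (EFin \o S m).
Hypothesis S_ge0 : forall m x, x \in `[0, 1] -> 0 <= S m x.
Hypothesis S_le : forall m x, x \in `[0, 1] -> S m x <= B.
Local Notation n := (blockdim M L).
Local Notation a := (spectral_angle M0 L0 N0 S_int S_ge0 S_le).
Variables (d : measure_display) (Omega : measurableType d) (P : probability Omega R).
Variable w : 'I_M -> nat -> Omega -> C.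
Hypothesis w_gauss : circular_gaussian P
  (fun p : 'I_M * 'I_(N + L - 1) => w p.1 (p.2).+1).
Hypothesis w_cov : forall (m m' : 'I_M) (k k' : nat),
  (1 <= k <= N + L - 1)%N -> (1 <= k' <= N + L - 1)%N ->
  cexpectation P (fun t => w m k t * (w m' k' t)^*) =
  autocov (S m) (k%:Z - k'%:Z) / N%:R * (m == m')%:R.

Definition hankel_mx t : 'M[C]_(n, N) := block_hankel L N (fun m k => w m k t).

Let idx_lt (q : 'I_n * 'I_N) : (tagnat.sig2 q.1 + q.2 < N + L - 1)%N.
Proof.
have := ltn_ord (tagnat.sig2 q.1); have := ltn_ord q.2.
move: (nat_of_ord q.2) (nat_of_ord (tagnat.sig2 q.1)) => x y xN yL.
by have := leq_add xN yL; rewrite ltn_subRL add1n addSn addnS (addnC x).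
Qed.

Let idx (q : 'I_n * 'I_N) : 'I_M * 'I_(N + L - 1) := (tagnat.sig1 q.1, Ordinal (idx_lt q)).

Let hankel_mxE i j : (fun t => hankel_mx t i j) =
  w (idx (i, j)).1 ((idx (i, j)).2).+1.
Proof. by apply/funext => t; rewrite /hankel_mx !mxE. Qed.

Lemma hankel_gmat : exists (G : gmat a) (phi : Omega -> gOmega G),
  [/\ forall t, map_mx (gev G (phi t)) (gW G) = hankel_mx t,
      forall f, cintegrable P setT (fun t => gev G (phi t) f),
      forall f, gEx G f = cexpectation P (fun t => gev G (phi t) f) &
      gkap G = B%:C * L%:R / N%:R].
Proof.
have [wg wm wp] := w_gauss.
have B0 : 0 <= B.
  have h01 : (0 : R) \in `[0, 1] by rewrite in_itv /= lexx ler01.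
  exact: le_trans (S_ge0 (Ordinal M0) h01) (S_le (Ordinal M0) h01).
have [G [phi [h1 h2 h3 h4]]] : exists (G : gmat a) (phi : Omega -> gOmega G),
  [/\ forall t i j, gev G (phi t) (gW G i j) = hankel_mx t i j,
      forall f, cintegrable P setT (fun t => gev G (phi t) f),
      forall f, gEx G f = cexpectation P (fun t => gev G (phi t) f) &
      gkap G = B%:C * L%:R / N%:R].
  apply: gmat_exists.
  (* Entries on the same antidiagonal of a block are the same variable; [pf] adds up the
     coefficients over the fibres of [idx], giving a combination of distinct variables. *)
  - move=> b c; pose pf (f : 'I_n * 'I_N -> R) x := \sum_(q | idx q == x) f q.
    rewrite (_ : (fun t => _) = (fun t => \sum_(x : 'I_M * 'I_(N + L - 1))
      (pf b x * Re (w x.1 x.2.+1 t) + pf c x * Im (w x.1 x.2.+1 t)))); first exact: wg.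
    apply/funext => t; rewrite (partition_big idx xpredT) //=.
    apply: eq_bigr => x _; rewrite /pf !mulr_suml -big_split /=.
    apply: eq_bigr => -[i j] /eqP <-.
    by rewrite (congr1 (fun f => f t) (hankel_mxE i j)).
  - by move=> i j; rewrite hankel_mxE; exact: (wm (idx (i, j))).
  - move=> i j k l; rewrite -[RHS](wp (idx (i, j)) (idx (k, l))); congr cexpectation.
    by rewrite -!hankel_mxE.
  - move=> i j k l.
    rewrite (Gam_autocov _ _ _ _ _ _ (erefl (tagnat.sig2 i + j).+1) (erefl (tagnat.sig2 k + l).+1)).
    rewrite -(w_cov (tagnat.sig1 i)); last 2 first.
    + by have := idx_lt (i, j).
    + by have := idx_lt (k, l).
    congr cexpectation; apply/funext => t.
    by rewrite (congr1 (fun f => f t) (hankel_mxE i j)) (congr1 (fun f => f t) (hankel_mxE k l)).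
  - by rewrite divr_ge0 // mulr_ge0 // ler0c.
  - exact: Gam_form_le.
exists G, phi; split => // t; apply/matrixP => i j; by rewrite mxE h1.
Qed.

Variable G : gmat a.
Variable phi : Omega -> gOmega G.
Hypothesis phiW : forall t, map_mx (gev G (phi t)) (gW G) = hankel_mx t.
Hypothesis phi_int : forall f, cintegrable P setT (fun t => gev G (phi t) f).
Hypothesis phi_E : forall f, gEx G f = cexpectation P (fun t => gev G (phi t) f).
Hypothesis kapE : gkap G = B%:C * L%:R / N%:R.
Variable lam : Omega -> 'I_(M * L) -> R.
Hypothesis lam_eig : forall t,
  char_poly (hankel_mx t *m (hankel_mx t) ^t*) = \prod_(k < M * L) ('X - ((lam t k)%:C)%:P).

Definition emp_moment k t : R := (M * L)%:R^-1 * \sum_i lam t i ^+ k.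
Definition mean_moment k : R := Re (mom G k).

Lemma eigenvalues_ge0 t i : 0 <= lam t i.
Proof. by have [h _] := gram_eigenvalues (lam_eig t); have := h i; rewrite ler0c. Qed.

Let momE k : mom G k = (mean_moment k)%:C.
Proof.
have := mom_ge0 G k; rewrite /mean_moment; case: (mom G k) => x y.
by rewrite lecE /= => /andP[/eqP -> _].
Qed.

Let ev_trX k t : gev G (phi t) (trX G k) = (emp_moment k t)%:C.
Proof.
rewrite /trX ev_tr evX phiW; have [_ ->] := gram_eigenvalues (lam_eig t).
have -> : n%:R = (M * L)%:R :> C by rewrite blockdimE.
rewrite /emp_moment [RHS]rmorphM /= fmorphV rmorph_nat; congr (_ * _).
rewrite [RHS]raddf_sum.
by apply: eq_bigr => i _; exact: esym (rmorphXn (real_complex R) k (lam t i)).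
Qed.

Let ev_ctrX k t : gev G (phi t) (ctrX G k) = (emp_moment k t - mean_moment k)%:C.
Proof. by rewrite /ctrX rmorphB /= ev_trX gevZ rmorph1 mulr1 momE rmorphB. Qed.

Lemma emp_moment0 t : emp_moment 0 t = mean_moment 0.
Proof.
rewrite /mean_moment mom0 /emp_moment.
under eq_bigr do rewrite expr0.
by rewrite sumr_const card_ord mulVf // pnatr_eq0 -lt0n muln_gt0 M0.
Qed.

Lemma measurable_emp_moment k :
  measurable_fun setT (fun t => emp_moment k t - mean_moment k).
Proof.
have [h _] := phi_int (ctrX G k); have /measurable_int := h.
move/measurable_EFinP; apply: eq_measurable_fun => t _.
by rewrite ev_ctrX.
Qed.

(** The moments of the model are replaced by [mbnd], so that the dimensions appear only in the
    explicit squared factor. *)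
Lemma emp_moment_fourth b r k : B <= b -> n%:R / N%:R <= r :> R ->
  (\int[P]_t ((emp_moment k.+1 t - mean_moment k.+1) ^+ 4)%:E <=
   ((B * L%:R / N%:R * k.+1%:R ^+ 2 / n%:R) ^+ 2 *
    (8 * Re (mbnd b%:C r%:C (k + k.+1)) ^+ 2 +
     128 * Re (mbnd b%:C r%:C (k + k.+1 + (k + k.+1)))))%:E)%E.
Proof.
move=> Bb nr.
have hb k' : mean_moment k' <= Re (mbnd b%:C r%:C k').
  have : mom G k' <= mbnd b%:C r%:C k'.
    apply: mom_bound; first by rewrite /= lecR.
    rewrite (_ : _ / _ = (n%:R / N%:R)%:C) ?lecR //.
    by rewrite rmorphM /= fmorphV !rmorph_nat.
  by rewrite lecE => /andP[].
have m0 k' : 0 <= mean_moment k' by have := mom_ge0 G k'; rewrite momE ler0c.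
have := fourth_moment G k; rewrite phi_E.
have EE t : gev G (phi t) (ctrX G k.+1 ^+ 4) = ((emp_moment k.+1 t - mean_moment k.+1) ^+ 4)%:C.
  by rewrite rmorphXn /= ev_ctrX rmorphXn.
have [ir _] := phi_int (ctrX G k.+1 ^+ 4).
have ir' : P.-integrable setT (EFin \o (fun t => (emp_moment k.+1 t - mean_moment k.+1) ^+ 4)).
  by apply: eq_integrable ir => // t _ /=; rewrite EE.
rewrite (_ : (fun t => _) = (fun t => ((emp_moment k.+1 t - mean_moment k.+1) ^+ 4)%:C)); last first.
  by apply/funext.
rewrite /cexpectation cintegral_real kapE !momE.
set J := \int[P]_(x in setT) _; set U := _ ^+ 2 * _ => h.
have -> : (\int[P]_t ((emp_moment k.+1 t - mean_moment k.+1) ^+ 4)%:E = J%:E)%E.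
  by rewrite /J /Rintegral fineK //; exact: integrable_fin_num.
have UE : U = ((B * L%:R / N%:R * k.+1%:R ^+ 2 / n%:R) ^+ 2 *
   (8 * mean_moment (k + k.+1) ^+ 2 + 128 * mean_moment (k + k.+1 + (k + k.+1))))%:C.
  by rewrite /U !(rmorphM, rmorphD, rmorphXn, fmorphV, rmorph_nat).
move: h; rewrite UE lecR lee_fin => /le_trans; apply.
apply: ler_wpM2l; first exact: sqr_ge0.
apply: lerD; apply: ler_wpM2l => //.
apply: lerXn2r; rewrite ?nnegrE //; exact: le_trans (m0 _) (hb _).
Qed.

End HankelModel.

Lemma norm_trace_opb (C : numClosedFieldType) m (A : 'M[C]_m) c : (0 < m)%N -> 0 < c ->
  opb A c -> `|m%:R^-1 * \tr A| <= c.
Proof.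
move=> m0 c0 hA; rewrite normrM normfV normr_nat ler_pdivrMl ?ltr0n //.
apply: le_trans (ler_norm_sum _ _ _) _.
have -> : m%:R * c = \sum_(i < m) c by rewrite sumr_const card_ord mulr_natl.
apply: ler_sum => i _.
have := opb_form c0 hA (delta_mx i 0) (delta_mx i 0).
have -> : ((delta_mx i 0 : 'cV[C]_m)^t* *m A *m (delta_mx i 0 : 'cV[C]_m)) 0 0 = A i i.
  have -> : (delta_mx i 0 : 'cV[C]_m)^t* = (delta_mx 0 i : 'rV[C]_m).
    by apply/matrixP => x y; rewrite !mxE andbC rmorph_nat.
  by rewrite -rowE -colE !mxE.
have -> : vnorm2 (delta_mx i 0 : 'cV[C]_m) = 1.
  rewrite /vnorm2 (bigD1 i) //= big1 => [|j ne]; first by rewrite !mxE !eqxx rmorph_nat mulr1 addr0.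
  by rewrite !mxE (negPf ne) mul0r.
by rewrite -mulrA divff ?mulr1 // pnatr_eq0.
Qed.

Section Comparison.
Context (R : realType).
Local Notation C := R[i].
Local Notation leb := (@lebesgue_measure R).

Definition limit_moment (M L N : nat) (S : 'I_M -> R -> R) (B : R) M0 L0 N0 S_int S_ge0 S_le k : R :=
  Re ((blockdim M L)%:R^-1 * \tr (@T_ R M L N S B M0 L0 N0 S_int S_ge0 S_le k)).

(** [moments_uniform] tested against the identity matrix, with all quantities brought back to the
    reals. *)
Lemma mean_moment_close (b r eps : R) k : 0 < b -> 0 <= r -> 0 < eps -> exists2 D : R, 0 <= D &
  forall (M L N : nat) (S : 'I_M -> R -> R) (B : R) M0 L0 N0 S_int S_ge0 S_le
    (G : gmat (@spectral_angle R M L N S B M0 L0 N0 S_int S_ge0 S_le)),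
  0 < B -> B <= b -> (blockdim M L)%:R / N%:R * B <= b ->
  (blockdim M L)%:R / N%:R <= r -> N%:R / (blockdim M L)%:R <= r ->
  gkap G = B%:C * L%:R / N%:R -> B * L%:R / N%:R * D <= 1 ->
  `|mean_moment G k - limit_moment M0 L0 N0 S_int S_ge0 S_le k| <= eps.
Proof.
move=> b0 r0 e0.
have bC0 : 0 < b%:C by rewrite ltcR.
have rC0 : 0 <= r%:C by rewrite lecR.
have eC0 : 0 < eps%:C by rewrite ltcR.
have [D0 D00 hD] := moments_uniform bC0 rC0 k eC0.
have D0E : D0 = (Re D0)%:C.
  by move: D00; case: (D0) => x y; rewrite lecE /= => /andP[/eqP -> _].
exists (Re D0) => [|M L N S B M0 L0 N0 S_int S_ge0 S_le G B0 Bb Bb' nr pr kE kD].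
  by move: D00; rewrite {1}D0E lecR.
have cast (x y : nat) : (x%:R / y%:R : C) = (x%:R / y%:R)%:C.
  by rewrite rmorphM /= fmorphV !rmorph_nat.
set n := blockdim M L in nr pr Bb' *.
pose a := spectral_angle M0 L0 N0 S_int S_ge0 S_le.
pose T := T_ M0 L0 N0 S_int S_ge0 S_le; pose Tt := Tt_ M0 L0 N0 S_int S_ge0 S_le.
have [tb _ _ _] : near_limit G T Tt k eps%:C.
  apply: (hD _ _ _ G T Tt) => //.
  - by rewrite /= ltcR.
  - by rewrite /= lecR.
  - by rewrite /= cast -rmorphM lecR.
  - by rewrite cast lecR.
  - by rewrite cast lecR.
  - exact: Tmom_rec.
  - exact: Ttmom_rec.
  - by move=> q; have [] := T_opb G B0 Bb Bb' q.
  - by move=> q; have [] := T_opb G B0 Bb Bb' q.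
  - rewrite kE D0E -mulrA cast -!rmorphM lecR.
    by rewrite mulrA.
have := tb 1%:M 1 ltr01 (@opb1 _ _); rewrite mul1r mul1mx.
have -> : n%:R^-1 * \tr (Delta G T k) = mom G k - n%:R^-1 * \tr (T k).
  rewrite /Delta [\tr _]raddfB mulrBr; congr (_ - _).
  rewrite /mom linearZ /= /mxtrace; congr (_ * _); rewrite [RHS]raddf_sum.
  by apply: eq_bigr => i _; rewrite mxE.
by move=> /Re_norm_le; rewrite raddfB.
Qed.

Lemma limit_moment_le (M L N : nat) (S : 'I_M -> R -> R) (B b : R) M0 L0 N0 S_int S_ge0 S_le
    (G : gmat (@spectral_angle R M L N S B M0 L0 N0 S_int S_ge0 S_le)) k :
  0 < B -> B <= b -> (blockdim M L)%:R / N%:R * B <= b ->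
  limit_moment M0 L0 N0 S_int S_ge0 S_le k <= (8 * b) ^+ k.
Proof.
move=> B0 Bb Bb'; have b0 : 0 < b by exact: lt_le_trans Bb.
have [h _] := T_opb G B0 Bb Bb' k.
have K0 : 0 < 8 * b%:C by rewrite mulr_gt0 // ltcR.
have n0 : (0 < blockdim M L)%N by rewrite blockdimE muln_gt0 M0.
have /Re_norm_le := norm_trace_opb n0 (gbnd_gt0 k K0) h.
move=> /(le_trans (ler_norm _)) /le_trans; apply.
have : gbnd (8 * b%:C) k <= ((8 * b) ^+ k)%:C.
  rewrite rmorphXn rmorphM /= rmorph_nat /gbnd.
  rewrite ler_pdivrMr ?exprn_gt0 ?ltr0n // ler_peMr ?exprn_ge0 ?(ltW K0) //.
  by rewrite exprn_ege1 // ler1n.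
by rewrite lecE => /andP[].
Qed.

End Comparison.

End GaussianModel.
Import GaussianModel.

(** * Application along the sequence of models *)

Theorem mainTheorem2
  (R : realType)
  (M L : nat -> nat) (c : R)
  (M_gt0 : forall N, (0 < N)%N -> (0 < M N)%N)
  (L_gt0 : forall N, (0 < N)%N -> (0 < L N)%N)
  (M_infty : M N @[N --> \oo] --> \oo)
  (c_gt0 : 0 < c)
  (cN_cvg : (M N * L N)%:R / N%:R @[N --> \oo] --> c)
  (S : forall M : nat, 'I_M -> R -> R)
  (S_pos : forall M (m : 'I_M) (nu : R), nu \in `[0, 1] -> 0 < S M m nu)
  (S_int : forall M (m : 'I_M),
     (@lebesgue_measure R).-integrable `[0, 1] (EFin \o S M m))
  (r_summable : exists B : R, forall M, (0 < M)%N ->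
     (\esum_(n in [set: int])
        (Num.sqrt ((M%:R)^-1
           * \sum_(m < M) normc (autocov (S M m) n) ^+ 2))%:E <= B%:E)%E)
  (S_sup : exists B : R, forall M (m : 'I_M) (nu : R),
     nu \in `[0, 1] -> S M m nu <= B)
  (S_inf : exists2 b : R, 0 < b & forall M (m : 'I_M) (nu : R),
     nu \in `[0, 1] -> b <= S M m nu)
  (d : measure_display) (Omega : measurableType d) (P : probability Omega R)
  (w : forall N, 'I_(M N) -> nat -> Omega -> R[i])
  (w_gauss : forall N, (0 < N)%N ->
     circular_gaussian P
       (fun p : 'I_(M N) * 'I_(N + L N - 1) => w N p.1 (p.2).+1))
  (w_cov : forall N, (0 < N)%N -> forall (m m' : 'I_(M N)) (k k' : nat),
     (1 <= k <= N + L N - 1)%N -> (1 <= k' <= N + L N - 1)%N ->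
     cexpectation P (fun omega => w N m k omega * (w N m' k' omega)^*)
     = autocov (S (M N) m) (k%:Z - k'%:Z) / N%:R * (m == m')%:R)
  (T : forall N, R[i] -> 'M[R[i]]_(blockdim (M N) (L N)))
  (Tt : forall N, R[i] -> 'M[R[i]]_N)
  (T_class : forall N, (0 < N)%N -> stieltjes_class (T N))
  (Tt_class : forall N, (0 < N)%N -> stieltjes_class (Tt N))
  (T_eq : forall N, (0 < N)%N -> forall z : R[i], ~~ (0 <= z) ->
     T N z = - z^-1 *: invmx (1%:M + Psi (L N) (S (M N)) (Tt N z)^T))
  (Tt_eq : forall N, (0 < N)%N -> forall z : R[i], ~~ (0 <= z) ->
     Tt N z = - z^-1 *: invmx
       (1%:M + ((M N * L N)%:R / N%:R) *: (Psibar N (S (M N)) (T N z))^T))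
  (mu : forall N, mxmeasure R (blockdim (M N) (L N)))
  (T_mu : forall N, (0 < N)%N -> stieltjes_repr (mu N) (T N))
  (lam : forall N, Omega -> 'I_(M N * L N) -> R)
  (lam_eig : forall N, (0 < N)%N -> forall omega,
     let W := block_hankel (L N) N (fun m n => w N m n omega) in
     char_poly (W *m W ^t*) =
     \prod_(k < M N * L N) ('X - ((lam N omega k)%:C)%:P)) :
  {ae P, forall omega, forall phi : R -> R,
     {within `[0, +oo[, continuous phi} ->
     (exists B : R, forall x : R, 0 <= x -> `|phi x| <= B) ->
     (((M N * L N)%:R)^-1 * \sum_(k < M N * L N) phi (lam N omega k)
        - \int[ntrace_measure (mu N)]_(x in `[0, +oo[) phi x)
       @[N --> \oo] --> (0 : R)}.
Proof.
have [B0 B0_ub] := S_sup.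
(* The maximum makes the common bound positive, as required for the weights of the estimates. *)
pose B := Num.max 1 B0.
have B_gt0 : 0 < B by rewrite lt_max ltr01.
have S_le M' (m : 'I_M') nu : nu \in `[0, 1] -> S M' m nu <= B.
  by move=> h; rewrite le_max (B0_ub _ m nu h) orbT.
have S_ge0 M' (m : 'I_M') nu : nu \in `[0, 1] -> 0 <= S M' m nu.
  by move=> /(S_pos M' m) /ltW.
(* For large N, [c / 2 <= c_N <= c + 1]. So [b] dominates both [B] and its dual value [c_N B], and
   [r] dominates both [c_N] and [1 / c_N]. *)
pose b := B * (c + 2); pose r := c + 1 + 2 / c.
have c2 : 1 <= c + 2 by lra.
have b_gt0 : 0 < b by rewrite mulr_gt0 // (lt_le_trans ltr01).
have Bb : B <= b by rewrite ler_peMr // ltW.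
have r_ge0 : 0 <= r by rewrite addr_ge0 ?divr_ge0 ?(ltW c_gt0) // addr_ge0 // ltW.
have [N0 N0_gt0 cN_bnd] : exists2 N0, (0 < N0)%N & forall N, (N0 <= N)%N ->
    c / 2 <= (M N * L N)%:R / N%:R <= c + 1.
  have c20 : 0 < Num.min (c / 2) 1 by rewrite lt_min ltr01 divr_gt0.
  move/cvgrPdist_le: cN_cvg => /(_ _ c20) [N1 _ h].
  exists N1.+1 => // N /ltnW /h /=; rewrite ler_distlC.
  set x := Num.min _ _ => /andP[].
  have : x <= c / 2 by rewrite ge_min lexx.
  have : x <= 1 by rewrite ge_min lexx orbT.
  by move=> *; apply/andP; split; lra.
have N0P N : (N0 <= N)%N -> (0 < N)%N by exact: leq_trans.
have n_bnd N : (N0 <= N)%N ->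
    [/\ (blockdim (M N) (L N))%:R / N%:R * B <= b,
        (blockdim (M N) (L N))%:R / N%:R <= r &
        N%:R / (blockdim (M N) (L N))%:R <= r].
  move=> hN; have /andP[h1 h2] := cN_bnd N hN; rewrite blockdimE.
  have h3 : 0 < c / 2 by rewrite divr_gt0.
  split.
  - by rewrite mulrC ler_wpM2l ?(ltW B_gt0) // (le_trans h2) //; lra.
  - by rewrite (le_trans h2) // lerDl divr_ge0 // ltW.
  - rewrite -invf_div; apply: (@le_trans _ _ (c / 2)^-1).
      by rewrite lef_pV2 // posrE (lt_le_trans h3).
    by rewrite invf_div lerDr addr_ge0 // ltW.
pose angle_ N (hN : (0 < N)%N) := spectral_angle (M_gt0 N hN) (L_gt0 N hN) hN
  (S_int (M N)) (S_ge0 (M N)) (S_le (M N)).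
pose em k N t : R := (M N * L N)%:R^-1 * \sum_i lam N t i ^+ k.
(* The model and the proof of [0 < N] it depends on exist only for large N. Only their real moment
   sequences are extracted by choice, for all N; the model itself stays behind an existential. *)
pose approx N (mm mt : nat -> R) := [/\ forall t i, 0 <= lam N t i,
      forall t, em 0 N t = mm 0%N,
      forall k, measurable_fun setT (fun t => em k N t - mm k),
      forall k, (\int[P]_t ((em k.+1 N t - mm k.+1) ^+ 4)%:E <=
        ((B * (L N)%:R / N%:R * k.+1%:R ^+ 2 / (blockdim (M N) (L N))%:R) ^+ 2 *
         (8 * complex.Re (mbnd b%:C r%:C (k + k.+1)) ^+ 2 +
          128 * complex.Re (mbnd b%:C r%:C (k + k.+1 + (k + k.+1)))))%:E)%E &
      exists (hN : (0 < N)%N) (G : gmat (angle_ N hN)),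
        [/\ gkap G = B%:C * (L N)%:R / N%:R,
            forall k, mm k = mean_moment G k &
            forall k, mt k = limit_moment (M_gt0 N hN) (L_gt0 N hN) hN
              (S_int (M N)) (S_ge0 (M N)) (S_le (M N)) k]].
have [mm [mt hm]] : exists mm mt : nat -> nat -> R,
    forall N, (N0 <= N)%N -> approx N (mm N) (mt N).
  have : forall N, exists mmt : (nat -> R) * (nat -> R),
      (N0 <= N)%N -> approx N mmt.1 mmt.2.
    move=> N; have [lt|hN] := ltnP N N0; first by exists (fun=> 0, fun=> 0).
    have N1 := N0P N hN; have [_ nr _] := n_bnd N hN.
    have [G [phi [h1 h2 h3 h4]]] := hankel_gmat (M_gt0 N N1) (L_gt0 N N1) N1
      (S_int (M N)) (S_ge0 (M N)) (S_le (M N)) (w_gauss N N1) (w_cov N N1).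
    exists (mean_moment G, limit_moment (M_gt0 N N1) (L_gt0 N N1) N1
              (S_int (M N)) (S_ge0 (M N)) (S_le (M N))) => _; split.
    - exact: (eigenvalues_ge0 (lam_eig N N1)).
    - exact: (emp_moment0 G (lam N)).
    - by move=> k; exact: (measurable_emp_moment h1 h2 (lam_eig N N1)).
    - by move=> k; exact: (emp_moment_fourth h1 h2 h3 h4 (lam_eig N N1)).
    - by exists N1, G.
  move=> /choice[f hf]; exists (fun N => (f N).1), (fun N => (f N).2) => N hN.
  exact: hf.
have mean_cvg k : mm N k - mt N k @[N --> \oo] --> 0.
  apply/cvgrPdist_le => e e0.
  have [D D0 hD] := mean_moment_close k b_gt0 r_ge0 e0.
  (* Here the growth of [M] enters: [gkap] is [B c_N / M], so [gkap * D <= 1] as soon as [M] exceeds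
     [B (c + 1) D]. *)
  have MD : \forall N \near \oo, B * (c + 1) * D <= (M N)%:R.
    move/cvgnyPge: M_infty => /(_ (Num.truncn (B * (c + 1) * D)).+1).
    apply: filterS => N h; apply: le_trans (ltW (truncnS_gt _)) _.
    by rewrite ler_nat.
  near=> N.
  have hN : (N0 <= N)%N by near: N; exact: nbhs_infty_ge.
  have hMD : B * (c + 1) * D <= (M N)%:R by near: N.
  have [n1 n2 n3] := n_bnd N hN; have /andP[_ c1] := cN_bnd N hN.
  have [_ _ _ _ [hN' [G [kG mmE mtE]]]] := hm N hN.
  rewrite sub0r normrN mmE mtE; apply: hD => //.
  have M0 : 0 < (M N)%:R :> R by rewrite ltr0n M_gt0.
  have -> : B * (L N)%:R / N%:R * D = B * ((M N * L N)%:R / N%:R) * D / (M N)%:R.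
    rewrite natrM; move: M0; move: ((M N)%:R : R) (N%:R^-1) => u v u0.
    by field; rewrite gt_eqF.
  rewrite ler_pdivrMr // mul1r; apply: le_trans hMD.
  by rewrite ler_wpM2r // ler_wpM2l // ltW.
have as_cvg k : {ae P, forall t, em k N t - mm N k @[N --> \oo] --> 0}.
  (* At order 0 both moments are 1 and agree exactly; the fourth moment bound concerns the positive
     orders. *)
  case: k => [|k].
    apply: aeW => t; apply/cvgrPdist_le => e e0.
    near=> N; have hN : (N0 <= N)%N by near: N; exact: nbhs_infty_ge.
    by have [_ -> _ _ _] := hm N hN; rewrite subrr subr0 normr0 ltW.
  pose Q : R := 8 * complex.Re (mbnd b%:C r%:C (k + k.+1)) ^+ 2 +
          128 * complex.Re (mbnd b%:C r%:C (k + k.+1 + (k + k.+1))).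
  have Q0 : 0 <= Q.
    have h j : 0 <= complex.Re (mbnd b%:C r%:C j).
      have : 0 <= mbnd b%:C r%:C j by apply: mbnd_ge0; rewrite lecR // ltW.
      by rewrite lecE => /andP[].
    by rewrite addr_ge0 // mulr_ge0 // exprn_ge0.
  pose be := B * k.+1%:R ^+ 2.
  apply: (@fourth_moment_ae _ _ _ P _ (4 * be ^+ 2 * Q) N0).
  - by rewrite mulr_ge0 // mulr_ge0 // sqr_ge0.
  - by move=> N hN; have [_ _ h _ _] := hm N hN; exact: h.
  move=> N hN; have [_ _ _ h _] := hm N hN; apply: le_trans (h k) _.
  rewrite lee_fin -/Q [leRHS]mulrAC; apply: ler_wpM2r => //.
  have N1 := N0P N hN.
  have NR : 1 <= N%:R :> R by rewrite ler1n.
  have M1 : 1 <= (M N)%:R :> R by rewrite ler1n M_gt0.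
  have L1 : 1 <= (L N)%:R :> R by rewrite ler1n L_gt0.
  have be0 : 0 <= be by rewrite mulr_ge0 ?sqr_ge0 // ltW.
  have -> : B * (L N)%:R / N%:R * k.+1%:R ^+ 2 / (blockdim (M N) (L N))%:R =
      be / (N%:R * (M N)%:R).
    rewrite blockdimE natrM /be; move: NR M1 L1.
    move: (N%:R : R) ((M N)%:R : R) ((L N)%:R : R) (k.+1%:R : R) => x y z u x1 y1 z1.
    by field; apply/and3P; split; rewrite gt_eqF //; lra.
  (* The factor before squaring is [be / (N M)], since [n = M L]; with [M >= 1] and [N + 1 <= 2 N]
     it is at most [2 be / (N + 1)], whence the 4. *)
  have -> : 4 * be ^+ 2 / N.+1%:R ^+ 2 = (2 * be / N.+1%:R) ^+ 2.
    by rewrite !exprMn exprVn (_ : 2 ^+ 2 = 4 :> R) //; ring.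
  have N1R : 0 < N.+1%:R :> R by rewrite ltr0n.
  apply: lerXn2r; rewrite ?nnegrE ?divr_ge0 ?mulr_ge0 ?(ltW B_gt0) //.
  rewrite ler_pdivlMr // mulrAC ler_pdivrMr; last by rewrite mulr_gt0 // (lt_le_trans ltr01).
  rewrite [2 * be]mulrC -[leRHS]mulrA ler_wpM2l // -natr1.
  by move: NR M1; move: (N%:R : R) ((M N)%:R : R) => x y x1 y1; nra.
(* Only countably many moments are involved, so one null set serves for every [phi]. *)
have as_all : {ae P, forall t, forall k, em k N t - mm N k @[N --> \oo] --> 0}.
  have : P.-negligible (\bigcup_k [set t | ~ (em k N t - mm N k @[N --> \oo] --> 0)]).
    by apply: negligible_bigcup => k; exact: as_cvg.
  by apply: negligibleS => t /= /existsNP[k hk]; exists k.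
apply: filterS as_all => t ht phi phi_cont [F phi_bnd].
have K0 : 0 < 8 * b by rewrite mulr_gt0.
apply: (moments_cvg_weak (phi := phi) phi_cont phi_bnd (n := fun N => (M N * L N)%N)
  (lam := fun N => lam N t) (nu := fun N => ntrace_measure (mu N)) (mm := mt) K0).
  near=> N.
  have hN : (N0 <= N)%N by near: N; exact: nbhs_infty_ge.
  have N1 := N0P N hN; have [n1 n2 n3] := n_bnd N hN.
  have [l0 _ _ _ [hN' [G [kG mmE mtE]]]] := hm N hN.
  split => //.
  - by rewrite muln_gt0 M_gt0 // L_gt0.
  - have [_ mu1 _] := T_mu N N1; rewrite /= /ntrace_measure -/(@nnegR R) mu1 mxtrace1.
    rewrite raddfMn /= mulVf // pnatr_eq0 blockdimE -lt0n.
    by rewrite muln_gt0 M_gt0 // L_gt0.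
  - move=> k; rewrite mtE.
    exact: (trace_moments G B_gt0 Bb n1 (Tt_class N N1) (T_eq N N1) (Tt_eq N N1) (T_mu N N1)).
  - by move=> k; rewrite mtE; exact: limit_moment_le.
move=> k; have : (em k N t - mm N k) + (mm N k - mt N k) @[N --> \oo] --> 0 + 0.
  by apply: cvgD; [exact: ht|exact: mean_cvg].
by rewrite addr0; under eq_fun do rewrite subrKA.
Unshelve. all: by end_near.
Qed.
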